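(* Let $K\geq 2$ and $d\geq 1$ be integers. Let ${\bf W}_1,\dots,{\bf W}_K$ be $K$ independent standard $d$-dimensional Wiener processes, all starting from $0$, and let ${\bf S}_1,\dots,{\bf S}_K$ be $K$ independent simple symmetric random walks on $\mathbb{Z}^d$, all starting from $0$. Put $$D_K^{\mathbb{R}^d}(t)=\max_{i\neq j,\ i,j\leq K}\|{\bf W}_i(t)-{\bf W}_j(t)\|,\qquad D_K^{\mathbb{Z}^d}(n)=\max_{i\neq j,\ i,j\leq K}\|{\bf S}_i(n)-{\bf S}_j(n)\|.$$ Then $$\limsup_{t\to\infty}\frac{D_K^{\mathbb{R}^d}(t)}{\sqrt{t\log\log t}}=2\quad\text{a.s.}$$ and $$\limsup_{n\to\infty}\frac{D_K^{\mathbb{Z}^d}(n)}{\sqrt{n\log\log n}}=\frac{2}{\sqrt d}\quad\text{a.s.}$$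
   Context: $\|\cdot\|$ denotes the Euclidean norm in $d$ dimensions. A standard $d$-dimensional Wiener process is ${\bf W}(t)=(W_1(t),\dots,W_d(t))$ with $W_1,\dots,W_d$ independent standard one-dimensional Wiener processes (Brownian motions). The simple symmetric random walk on $\mathbb{Z}^d$ is ${\bf S}(n)={\bf X}(1)+\dots+{\bf X}(n)$, ${\bf S}(0)=0$, where the ${\bf X}(k)$ are i.i.d. with $P({\bf X}(1)=e_i)=P({\bf X}(1)=-e_i)=\frac1{2d}$, $i=1,\dots,d$, and $e_1,\dots,e_d$ are the orthogonal unit vectors of $\mathbb{Z}^d$. *)

(* Defs.v *)
From HB Require Import structures.
From mathcomp Require Import all_boot all_order all_algebra finmap.
From mathcomp Require Import all_classical all_reals all_analysis.

Set Implicit Arguments.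
Unset Strict Implicit.
Unset Printing Implicit Defensive.

Import Order.TTheory GRing.Theory Num.Theory.
Import numFieldNormedType.Exports.

Local Open Scope classical_set_scope.
Local Open Scope ring_scope.

(* The norm that the library puts on 'rV[R]_d is the maximum norm. *)
Definition enorm (R : realType) (d : nat) (v : 'rV[R]_d) : R :=
  Num.sqrt (\sum_(k < d) v 0 k ^+ 2).

(* The distances are nonnegative, so the default value 0 does not change the
   maximum once there are at least two points. *)
Definition max_dist (R : realType) (K d : nat) (x : 'I_K -> 'rV[R]_d) : R :=
  \big[Num.max/0]_(p : 'I_K * 'I_K | p.1 != p.2) enorm (x p.1 - x p.2).

(* Mutual independence of a possibly infinite family of classes of events: the
   product rule holds on every finite subfamily. *)
Definition independent (R : realType) (disp : measure_display)
    (T : measurableType disp) (P : probability T R) (I : choiceType)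
    (F : I -> set_system T) : Prop :=
  forall (J : {fset I}) (A : I -> set T),
    (forall i, i \in J -> F i (A i)) ->
    P (\bigcap_(i in [set` J]) A i) = (\prod_(i <- J) P (A i))%E.

(* The sigma-algebra generated by the variables [X i], [i] in [D], with values
   in [V] equipped with the sigma-algebra [E]. *)
Definition sigma_of (T V I : Type) (D : set I) (E : set_system V)
    (X : I -> T -> V) : set_system T :=
  <<s \bigcup_(i in D) preimage_set_system setT (X i) E >>.

(* Only the values at times [t >= 0] matter; [normal_prob m s] takes the
   standard deviation [s]. The infinite sequences of times in [wiener_indep] also cover
   finite sequences, which can be continued by a constant. *)
Record wiener (R : realType) (disp : measure_display)
    (T : measurableType disp) (P : probability T R)
    (W : R -> {RV P >-> R}) : Prop := Wiener {
  wiener_start : {ae P, forall w, W 0 w = 0} ;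
  wiener_indep : forall t : nat -> R, 0 <= t 0%N -> nondecreasing_seq t ->
    independent P (fun m : nat =>
      preimage_set_system setT (W (t m.+1) \- W (t m)) measurable) ;
  wiener_normal : forall s t : R, 0 <= s -> s < t ->
    forall B : set R, measurable B ->
      pushforward P (W t \- W s) B = normal_prob 0 (Num.sqrt (t - s)) B ;
  wiener_continuous : {ae P, forall w,
    {within `[0, +oo[%classic, continuous (fun t => W t w)}} }.

(* [W k] is the [k]-th coordinate process. *)
Definition wiener_process (R : realType) (disp : measure_display)
    (T : measurableType disp) (P : probability T R) (d : nat)
    (W : 'I_d -> R -> {RV P >-> R}) : Prop :=
  (forall k, wiener (W k)) /\
  independent P (fun k : 'I_d =>
    sigma_of [set t : R | 0 <= t] measurable (fun t => W k t : T -> R)).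

Definition independent_wiener_processes (R : realType)
    (disp : measure_display) (T : measurableType disp) (P : probability T R)
    (K d : nat) (W : 'I_K -> 'I_d -> R -> {RV P >-> R}) : Prop :=
  (forall i, wiener_process (W i)) /\
  independent P (fun i : 'I_K =>
    sigma_of [set kt : 'I_d * R | 0 <= kt.2] measurable
      (fun kt => W i kt.1 kt.2 : T -> R)).

(* Z^d carries the discrete sigma-algebra [setT]; [X k] is the step made at
   time [k + 1]. *)
Definition simple_random_walk (R : realType) (disp : measure_display)
    (T : measurableType disp) (P : probability T R) (d : nat)
    (S : nat -> T -> 'rV[int]_d) : Prop :=
  exists X : nat -> T -> 'rV[int]_d,
    [/\ forall k (B : set 'rV[int]_d), measurable (X k @^-1` B),
        independent P (fun k : nat => preimage_set_system setT (X k) setT),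
        forall k (j : 'I_d),
          P (X k @^-1` [set delta_mx 0 j]) = ((2 * d%:R)^-1)%:E /\
          P (X k @^-1` [set - delta_mx 0 j]) = ((2 * d%:R)^-1)%:E
      & forall n w, S n w = \sum_(k < n) X k w].

Definition independent_random_walks (R : realType)
    (disp : measure_display) (T : measurableType disp) (P : probability T R)
    (K d : nat) (S : 'I_K -> nat -> T -> 'rV[int]_d) : Prop :=
  (forall i, simple_random_walk P (S i)) /\
  independent P (fun i : 'I_K => sigma_of [set: nat] setT (S i)).

Definition wiener_max_dist (R : realType)
    (disp : measure_display) (T : measurableType disp) (P : probability T R)
    (K d : nat) (W : 'I_K -> 'I_d -> R -> {RV P >-> R}) (t : R) (w : T) : R :=
  max_dist (fun i => \row_(k < d) W i k t w).

Definition walk_max_dist (R : realType) (T : Type) (K d : nat)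
    (S : 'I_K -> nat -> T -> 'rV[int]_d) (n : nat) (w : T) : R :=
  max_dist (fun i => map_mx (fun z : int => z%:~R : R) (S i n w)).
Arguments walk_max_dist R {T K d} S n w.

(* Main.v *)
Require Import Defs.
From HB Require Import structures.
From mathcomp Require Import all_boot all_order all_algebra finmap.
From mathcomp Require Import all_classical all_reals all_analysis.
From mathcomp Require Import measurable_realfun.
From mathcomp Require Import ring lra.

(* For a fixed direction the difference of two independent processes is one-dimensional,
   and the classical law of the iterated logarithm is proved for it by hand: tail bounds
   of order exp(-(1 +- delta) x^2 / (2 variance)), Borel-Cantelli along t = theta^k, and
   control of the process between theta^k and theta^(k+1). The difference has variance 2t
   per coordinate for the Wiener processes and 2n/d for the walks, whence the constants.
   - Walks: the pair of steps is uniform on a finite alphabet, so exponential moments are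
     finite averages. They give an exponential maximal inequality; finitely many integer
     directions determine the Euclidean norm up to a factor close to 1. The matching lower
     tail comes from a pointwise bound of an indicator by three exponentials.
   - Wiener processes: the norm at t = theta^k is bounded by covering the complement of
     a ball in dimension 2d by finitely many products of half-lines, and the oscillation
     between the times theta^k by dyadic chaining; only Gaussian marginals and product
     rules for events are needed.
   In both cases the lower bound uses increments over [q^k, q^(k+1)] with q large, the
   contribution of time q^k being negligible by the upper bound. *)

Set Implicit Arguments.
Unset Strict Implicit.
Unset Printing Implicit Defensive.

Import Order.TTheory GRing.Theory Num.Theory.
Import numFieldNormedType.Exports.

Local Open Scope classical_set_scope.
Local Open Scope ring_scope.

(** * Real-valued probabilities and the two Borel-Cantelli arguments *)

Section RealProbability.
Context (R : realType) (disp : measure_display) (T : measurableType disp)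
  (P : probability T R).
Implicit Types A B : set T.

(** The number of processes does not enter the constants: the upper bound holds simultaneously for
    finitely many pairs, and one pair gives the lower bound. The critical exponent comes from ln ln
    theta^k = ln k + const, which turns a tail exp(-rho ln ln t) into a multiple of k^-rho, summable
    exactly for rho > 1. For Wiener processes the obstacle is that the law of W1 - W2 would require
    a convolution of Gaussians. The pair is therefore kept as one process in dimension 2d. From
    above, |W1 - W2|^2 <= 2 (|W1|^2 + |W2|^2) loses nothing in the extreme case W2 = -W1. From
    below, one coordinate of W1 is asked to rise and that of W2 to fall by half the target; the
    product of the two tails has the exponent of a Gaussian of variance 2t. For walks a central
    limit theorem would be too coarse, since the probabilities in question are powers of ln n.
    Second-order bounds on the moment generating function near 0 suffice because sqrt(n ln ln n) =
    o(n) drives the optimal tilt to 0. *)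

Definition pr A : R := fine (P A).

Lemma prE A : measurable A -> P A = (pr A)%:E.
Proof. by move=> mA; rewrite /pr fineK// fin_num_measure. Qed.

Lemma pr_ge0 A : 0 <= pr A.
Proof. exact/fine_ge0/measure_ge0. Qed.

Lemma pr_le1 A : measurable A -> pr A <= 1.
Proof. by move=> mA; rewrite -lee_fin -prE// probability_le1. Qed.

Lemma prT : pr setT = 1.
Proof. by rewrite /pr probability_setT. Qed.

Lemma pr0 : pr set0 = 0.
Proof. by rewrite /pr measure0. Qed.

Lemma le_pr A B : measurable A -> measurable B -> A `<=` B -> pr A <= pr B.
Proof.
by move=> mA mB AB; rewrite -lee_fin -!prE// le_measure// inE.
Qed.

Lemma prU A B : measurable A -> measurable B -> A `&` B = set0 ->
  pr (A `|` B) = pr A + pr B.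
Proof.
move=> mA mB AB; apply: EFin_inj.
by rewrite EFinD -!prE ?measureU//; exact: measurableU.
Qed.

Lemma prD A B : measurable A -> measurable B ->
  pr (A `&` ~` B) = pr A - pr (A `&` B).
Proof.
move=> mA mB.
have mC := measurableC mB.
have -> : pr A = pr (A `&` B) + pr (A `&` ~` B).
  rewrite -prU ?setIUr -?setIUr ?setUv ?setIT//; try exact: measurableI.
  by rewrite setIACA setICr setI0.
by rewrite addrC addKr.
Qed.

Lemma prU_le A B : measurable A -> measurable B ->
  pr (A `|` B) <= pr A + pr B.
Proof.
move=> mA mB; rewrite -lee_fin EFinD -!prE ?measureU2//.
exact: measurableU.
Qed.

Lemma pr_bigU_le (I : Type) (s : seq I) (p : pred I) (F : I -> set T) :
  (forall i, measurable (F i)) ->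
  pr (\big[setU/set0]_(i <- s | p i) F i) <= \sum_(i <- s | p i) pr (F i).
Proof.
move=> mF; pose K (A : set T) (x : R) := measurable A /\ pr A <= x.
suff: K (\big[setU/set0]_(i <- s | p i) F i) (\sum_(i <- s | p i) pr (F i)).
  by case.
apply: (big_ind2 K) => [|A x B y [mA Ax] [mB By]|i _]; split => //.
- by rewrite pr0.
- exact: measurableU.
- exact: le_trans (prU_le mA mB) (lerD Ax By).
Qed.

Lemma pr_partition (V : finType) (X : T -> V) A : measurable A ->
  (forall v, measurable (X @^-1` [set v])) ->
  pr A = \sum_v pr (A `&` X @^-1` [set v]).
Proof.
move=> mA mX.
have {1}-> : A = \big[setU/set0]_(v <- enum V) (A `&` X @^-1` [set v]).
  rewrite -bigcup_seq; apply/seteqP; split=> [w Aw|w [v _ []//]].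
  by exists (X w) => //=; rewrite mem_enum.
rewrite -big_enum /=; have := enum_uniq V; elim: (enum V) => [|v s IH].
  by rewrite !big_nil pr0.
move=> /= /andP[vs us]; rewrite !big_cons prU ?IH//.
- by apply: measurableI.
- by apply: bigsetU_measurable => u _; exact: measurableI.
rewrite -bigcup_seq -subset0 => w [[_ /= wv] [u us' [_ /= uw]]].
by move: us'; rewrite /= -uw wv (negbTE vs).
Qed.

(** First Borel-Cantelli lemma, with summability expressed by a uniform bound on real partial
    sums. *)
Lemma ae_eventually_notin (B : nat -> set T) (M : R) :
  (forall k, measurable (B k)) ->
  (forall n, \sum_(k < n) pr (B k) <= M) ->
  {ae P, forall w, exists k0, forall k, (k0 <= k)%N -> ~ B k w}.
Proof.
move=> mB hM.
have H0 : P (lim_sup_set B) = 0.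
  apply: lim_sup_set_cvg0 => //.
  apply: (@le_lt_trans _ _ M%:E); last by rewrite ltry.
  apply: lime_le.
    by apply: is_cvg_nneseries => n _ _; exact: measure_ge0.
  apply: nearW => n; rewrite big_mkord.
  have -> : (\sum_(k < n) P (B k) = (\sum_(k < n) pr (B k))%:E)%E.
    by rewrite -sumEFin; apply: eq_bigr => k _; exact: prE.
  by rewrite lee_fin.
exists (lim_sup_set B); split => //.
  apply: bigcapT_measurable => n; apply: bigcup_measurable => k _; exact: mB.
move=> w /= nw n _; apply: contrapT => nB; apply: nw.
exists n => k nk Bk; apply: nB; exists k => //.
Qed.

(** Plays the role of the second Borel-Cantelli lemma. Its product bound follows from independence
    for the Wiener processes and from conditioning on the past for the walks. Since 1 - 1/(k+1) =
    k/(k+1), the product over [m, m+n) telescopes to m/(m+n) and tends to 0. *)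
Lemma ae_frequently_in (A : nat -> set T) (k0 : nat) :
  (forall k, measurable (A k)) ->
  (forall m n, (k0 <= m)%N ->
    pr (\big[setI/setT]_(m <= k < m + n) ~` A k)
    <= \prod_(m <= k < m + n) (1 - k.+1%:R^-1)) ->
  {ae P, forall w, forall m, exists2 k, (m <= k)%N & A k w}.
Proof.
move=> mA hA; apply: ae_foralln => m.
(* The maximum with 1 makes the starting value m1/m1 of the telescoping equal to 1. *)
pose m1 := maxn m (maxn k0 1).
have m1_0 : (0 < m1)%N by rewrite /m1 !leq_max /= !orbT.
exists (\bigcap_(k in [set k | (m1 <= k)%N]) ~` A k); split.
- by apply: bigcap_measurable => [|k _]; [exists m1 => /=|exact: measurableC].
- set N := \bigcap_(k in _) _.
  have mN : measurable N.
    by apply: bigcap_measurable => [|k _]; [exists m1 => /=|exact: measurableC].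
  have Hn n : pr N <= m1%:R / (m1 + n)%:R.
    apply: (@le_trans _ _ (pr (\big[setI/setT]_(m1 <= k < m1 + n) ~` A k))).
      apply: le_pr => //.
        by apply: bigsetI_measurable => k _; exact: measurableC.
      move=> w Nw; rewrite -bigcap_seq => k /=; rewrite mem_index_iota.
      by move=> /andP[h _]; exact: Nw.
    apply: (le_trans (hA _ _ _)); first by rewrite /m1 !leq_max leqnn !orbT.
    elim: n => [|n IH].
      by rewrite addn0 big_geq// divff// pnatr_eq0 -lt0n.
    rewrite addnS big_nat_recr ?leq_addr//=.
    apply: (@le_trans _ _ (m1%:R / (m1 + n)%:R * (1 - (m1 + n).+1%:R^-1))).
      apply: ler_wpM2r IH; rewrite subr_ge0 invf_le1 ?ltr0n// ler1n//.
    have h0 : (0 : R) < (m1 + n)%:R by rewrite ltr0n addn_gt0 m1_0.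
    rewrite -natr1; set x := (m1 + n)%:R in h0 *.
    rewrite le_eqVlt; apply/orP; left; apply/eqP; field.
    by rewrite -natrD natr1 !pnatr_eq0 /= -lt0n addn_gt0 m1_0.
  suff : pr N <= 0.
    move=> h; apply: (etrans (prE mN)); congr EFin.
    by apply/eqP; rewrite eq_le h pr_ge0.
  apply/ler_addgt0Pr => e e0; rewrite add0r.
  pose n := (Num.truncn (m1%:R / e)).+1.
  apply: (le_trans (Hn n)).
  rewrite ler_pdivrMr ?ltr0n ?addn_gt0 ?m1_0// mulrC -ler_pdivrMr//.
  apply: (le_trans (ltW (Num.Theory.truncnS_gt _))).
  by rewrite ler_nat leq_addl.
- move=> w /= nw k m1k Ak; apply: nw; exists k => //.
  by apply: leq_trans m1k; rewrite leq_max leqnn.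
Qed.

End RealProbability.

(** * The scale sqrt(t ln ln t), series along geometric times, limits superior *)

Section IteratedLogarithm.
Context (R : realType).
Implicit Types (x t : R) (k n : nat).

Lemma lnln_exp (theta : R) k : 1 < theta -> (0 < k)%N ->
  ln (ln (theta ^+ k)) = ln k%:R + ln (ln theta).
Proof.
move=> h1 k0; have l0 := ln_gt0 h1.
rewrite lnXn; last exact: lt_trans h1.
by rewrite -[ln theta *+ k]mulr_natl lnM ?posrE ?ltr0n.
Qed.

Lemma exp_unbounded (theta x : R) : 1 < theta ->
  exists k0, forall k, (k0 <= k)%N -> x <= theta ^+ k.
Proof.
move=> h1; have h0 : 0 < theta - 1 by rewrite subr_gt0.
exists (Num.truncn (x / (theta - 1))).+1 => k hk.
have : x / (theta - 1) <= k%:R.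
  apply: (le_trans (ltW (Num.Theory.truncnS_gt _))); by rewrite ler_nat.
rewrite ler_pdivrMr// => /le_trans; apply.
have : forall m, m%:R * (theta - 1) + 1 <= theta ^+ m.
  elim=> [|m IH]; first by rewrite mul0r add0r expr0.
  rewrite exprS -natr1.
  apply: (@le_trans _ _ (theta * (m%:R * (theta - 1) + 1))); last first.
    by rewrite ler_pM2l// (lt_trans ltr01).
  have m0 : (0 : R) <= m%:R by rewrite ler0n.
  suff : 0 <= m%:R * (theta - 1) ^+ 2 by lra.
  by rewrite mulr_ge0// sqr_ge0.
move=> /(_ k) hk'; apply: le_trans hk'; by rewrite lerDl.
Qed.

Lemma lnln_ge M x : expR (expR M) <= x -> M <= ln (ln x) :> R.
Proof.
move=> h; have x0 : 0 < x by apply: lt_le_trans h; exact: expR_gt0.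
have h2 : expR M <= ln x by rewrite -ler_expR lnK ?posrE.
by rewrite -ler_expR lnK// posrE; apply: lt_le_trans h2; exact: expR_gt0.
Qed.

Lemma lnln_exp_unbounded (theta M : R) : 1 < theta ->
  exists k0, forall k, (k0 <= k)%N -> M <= ln (ln (theta ^+ k)).
Proof.
move=> /(exp_unbounded (expR (expR M)))[k0 hk]; exists k0 => k k0k.
exact/lnln_ge/hk.
Qed.

Lemma le_lnln s t : expR 1 <= s -> s <= t -> ln (ln s) <= ln (ln t) :> R.
Proof.
move=> es st; have s0 : 0 < s by apply: lt_le_trans es; exact: expR_gt0.
have t0 := lt_le_trans s0 st.
have l1 : 1 <= ln s by rewrite -ler_expR lnK ?posrE.
have l2 : ln s <= ln t by rewrite ler_ln ?posrE.
have l3 := lt_le_trans ltr01 l1.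
by rewrite ler_ln ?posrE// (lt_le_trans l3).
Qed.

Lemma lnln_ge0 t : expR 1 <= t -> 0 <= ln (ln t) :> R.
Proof. by move=> h; apply: lnln_ge; rewrite expR0. Qed.

Definition lilscale t : R := Num.sqrt (t * ln (ln t)).

Lemma lilscale_ge0 t : 0 <= lilscale t.
Proof. exact: sqrtr_ge0. Qed.

Lemma sqr_lilscale t : expR 1 <= t -> lilscale t ^+ 2 = t * ln (ln t).
Proof.
move=> h; rewrite sqr_sqrtr// mulr_ge0 ?lnln_ge0//.
by apply: le_trans h; exact: expR_ge0.
Qed.

Lemma le_lilscale s t : expR 1 <= s -> s <= t -> lilscale s <= lilscale t.
Proof.
move=> es st; apply: ler_wsqrtr; apply: ler_pM => //.
- by apply: le_trans es; exact: expR_ge0.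
- exact: lnln_ge0.
- exact: le_lnln.
Qed.

Lemma lilscale_gt0 t : expR (expR 1) <= t -> 0 < lilscale t.
Proof.
move=> h; rewrite sqrtr_gt0 mulr_gt0//.
  by apply: lt_le_trans h; exact: expR_gt0.
by apply: lt_le_trans (lnln_ge h); exact: ltr01.
Qed.

(* Since [ln (k.+1 / k) >= k.+1^-1], the terms are bounded by the differences of
   the sequence [k |-> k^-e / e]. *)
Lemma sum_expRN_ln_le (e : R) n : 0 < e ->
  \sum_(k < n) expR (- ((1 + e) * ln k.+2%:R)) <= e^-1.
Proof.
move=> e0; pose g k := expR (- (e * ln k.+1%:R)) : R.
suff H : \sum_(k < n) expR (- ((1 + e) * ln k.+2%:R)) <= (1 - g n) / e.
  apply: (le_trans H); rewrite ler_piMl ?invr_ge0 ?(ltW e0)//.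
  by rewrite gerBl expR_ge0.
elim: n => [|n IH].
  by rewrite big_ord0 /g ln1 mulr0 oppr0 expR0 subrr mul0r.
rewrite big_ord_recr /=.
apply: (le_trans (lerD IH (lexx _))).
rewrite ler_pdivlMr// mulrDl divfK ?gt_eqF//.
rewrite [X in _ + X <= _](_ : _ = g n.+1 * (e / n.+2%:R)); last first.
  rewrite /g; set l := ln _; have -> : - ((1 + e) * l) = - l + - (e * l) by ring.
  rewrite expRD (expRN l) /l lnK ?posrE ?ltr0n//; ring.
have hl : n.+2%:R^-1 <= ln n.+2%:R - ln n.+1%:R :> R.
  have -> : ln n.+2%:R - ln n.+1%:R = - ln (1 + - n.+2%:R^-1) :> R.
    rewrite -opprB -ln_div ?posrE ?ltr0n//; congr (- ln _).
    by rewrite -[n.+1%:R](addrK 1) natr1 mulrDl divff ?pnatr_eq0// mulN1r.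
  rewrite lerNr; apply: le_ln1Dx.
  by rewrite ltrN2 invf_lt1 ?ltr0n// ltr1n.
have hg : g n = g n.+1 * expR (e * (ln n.+2%:R - ln n.+1%:R)).
  by rewrite /g -expRD; congr expR; ring.
suff : g n.+1 * (1 + e / n.+2%:R) <= g n by rewrite mulrDr mulr1; set y := g n.+1 * (e / _); lra.
rewrite hg ler_pM2l ?expR_gt0//.
apply: le_trans (expR_ge1Dx _); rewrite lerD2l ler_pM2l//.
Qed.

(** By [lnln_exp] the assumed bound is a constant times k^-rho. The terms below k0 + 2 are bounded
    by 1; the shift by 2 makes the rest comparable with [sum_expRN_ln_le], whose terms start at
    2. *)
Lemma sum_expRN_lnln_bounded (theta rho C : R) k0 (p : nat -> R) :
  1 < theta -> 1 < rho -> 0 <= C -> (forall k, p k <= 1) ->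
  (forall k, (k0 <= k)%N -> p k <= C * expR (- (rho * ln (ln (theta ^+ k))))) ->
  exists M, forall n, \sum_(k < n) p k <= M.
Proof.
move=> h1 hr C0 p1 hp.
pose D := C * expR (- (rho * ln (ln theta))).
have D0 : 0 <= D by rewrite mulr_ge0 ?expR_ge0.
exists ((k0 + 2)%:R + D * (rho - 1)^-1) => n.
have hq k : p k <= (k < k0 + 2)%:R + D * expR (- (rho * ln k%:R)).
  have E0 : 0 <= D * expR (- (rho * ln k%:R)) by rewrite mulr_ge0 ?expR_ge0.
  case: ltnP => hk; first by apply: (le_trans (p1 k)); rewrite lerDl.
  rewrite add0r; have k0k : (k0 <= k)%N by apply: leq_trans hk; rewrite leq_addr.
  apply: (le_trans (hp k k0k)); rewrite lnln_exp//; last first.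
    by apply: leq_trans hk; rewrite addn2.
  by rewrite mulrDr opprD expRD /D -mulrA [X in C * X <= _]mulrC.
have hs m : \sum_(k < m) p (k + (k0 + 2))%N <= D / (rho - 1).
  apply: (@le_trans _ _ (\sum_(k < m) D * expR (- ((1 + (rho - 1)) * ln k.+2%:R)))).
    apply: ler_sum => k _; apply: (le_trans (hq _)).
    rewrite ltnNge leq_addl add0r ler_wpM2l// ler_expR lerN2.
    rewrite [1 + _]addrC subrK ler_wpM2l ?(le_trans ler01 (ltW hr))//.
    rewrite ler_ln ?posrE ?ltr0n ?addn2 ?addnS// ler_nat.
    by rewrite ltnS ltnS leq_addr.
  by rewrite -big_distrr /= ler_wpM2l// sum_expRN_ln_le// subr_gt0.
have hb m : \sum_(k < m) p k <= m%:R.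
  apply: (@le_trans _ _ (\sum_(k < m) 1)); first exact: ler_sum.
  by rewrite sumr_const card_ord.
have [hn|hn] := leqP n (k0 + 2).
  apply: (le_trans (hb n)); rewrite -[X in X <= _]addr0 lerD ?ler_nat//.
  by rewrite mulr_ge0// invr_ge0 subr_ge0 ltW.
rewrite -(subnKC (ltnW hn)) big_split_ord /= lerD//; first exact: hb.
by rewrite (eq_bigr (fun i : 'I_ _ => p (i + (k0 + 2))%N)) ?hs// => i _; rewrite addnC.
Qed.

(** Supplies the divergent comparison series of [ae_frequently_in]: the constant gamma ln ln theta
    is absorbed once (1 - gamma) ln (k+1) exceeds it. *)
Lemma expRN_lnln_ge_inv (theta gamma : R) : 1 < theta -> 0 <= gamma -> gamma < 1 ->
  exists k0, forall k, (k0 <= k)%N ->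
    k.+1%:R^-1 <= expR (- (gamma * ln (ln (theta ^+ k.+1)))).
Proof.
move=> h1 g0 g1; have d0 : 0 < 1 - gamma by rewrite subr_gt0.
pose x := gamma * ln (ln theta) / (1 - gamma).
exists (Num.truncn (expR x)) => k hk.
have h : x <= ln k.+1%:R.
  rewrite -ler_expR lnK ?posrE ?ltr0n//.
  by apply: (le_trans (ltW (Num.Theory.truncnS_gt _))); rewrite ler_nat.
rewrite lnln_exp// -[leLHS]lnK ?posrE ?invr_gt0 ?ltr0n//.
rewrite ler_expR lnV ?posrE ?ltr0n// lerN2.
by move: h; rewrite /x ler_pdivrMr//; lra.
Qed.

Lemma exp_block (theta t : R) k0 : 1 < theta -> theta ^+ k0 <= t ->
  exists2 k, (k0 <= k)%N & theta ^+ k <= t < theta ^+ k.+1.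
Proof.
move=> h1 ht.
have ex : exists k, t < theta ^+ k.
  have [k hk] := exp_unbounded (t + 1) h1; exists k.
  by apply: lt_le_trans (hk k (leqnn _)); rewrite ltrDl.
case: (ex_minnP ex) => m hm min.
have k0m : (k0 < m)%N.
  rewrite ltnNge; apply/negP => mk.
  have := le_lt_trans ht hm; apply/negP; rewrite -leNgt.
  by rewrite ler_weXn2l// ltW.
exists m.-1; first by rewrite -ltnS prednK// (leq_ltn_trans _ k0m).
have m0 : (0 < m)%N by rewrite (leq_ltn_trans _ k0m).
rewrite prednK// hm andbT leNgt; apply/negP => /min.
by rewrite -ltnS prednK// ltnn.
Qed.

Lemma limf_esup_eq (X : choiceType) (Y : filteredType X) (F : set_system Y)
    {FF : Filter F} (u : Y -> R) (c : R) :
  (forall e, 0 < e -> \forall y \near F, u y <= c + e) ->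
  (forall e, 0 < e -> ~ \forall y \near F, u y < c - e) ->
  limf_esup (fun y => (u y)%:E) F = c%:E.
Proof.
move=> hu hl; apply/eqP; rewrite eq_le; apply/andP; split.
  apply/lee_addgt0Pr => e e0.
  apply: (@le_trans _ _ (ereal_sup [set (u y)%:E | y in [set y | u y <= c + e]])).
    apply: ereal_inf_lbound; exists [set y | u y <= c + e] => //; exact: hu.
  by apply: ge_ereal_sup => _ [y hy <-]; rewrite -EFinD lee_fin.
apply: le_ereal_inf_tmp => _ [V FV <-].
rewrite leNgt; apply/negP => hV.
(* If the supremum over [V] is finite, half its gap to [c] serves; if it is -oo, any [e] does. *)
have [e e0 he] : exists2 e, 0 < e & (ereal_sup [set (u y)%:E | y in V] < (c - e)%:E)%E.
  move: hV; case: (ereal_sup _) => [r| |] //= hr.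
    exists ((c - r) / 2); rewrite lte_fin in hr; first by rewrite divr_gt0 ?subr_gt0.
    by rewrite lte_fin; lra.
  by exists 1 => //; rewrite ltNyr.
apply: (hl e e0); apply: filterS FV => y Vy /=.
rewrite -lte_fin; apply: le_lt_trans he; apply: ereal_sup_ubound.
by exists y.
Qed.

End IteratedLogarithm.

(** * Taylor bounds for the exponential near 0 *)

Section ExponentialTaylorBounds.
Context (R : realType).
Implicit Types t u y l : R.

(** One integration step of a Taylor argument: each of the next three bounds has a lower-order bound
    as the sign of its derivative. *)
Lemma ge0_of_derive_ge0 (f df : R -> R) t :
  (forall x : R, is_derive x (1 : R) f (df x)) ->
  (forall x : R, 0 < x -> 0 <= df x) -> 0 <= f 0 -> 0 <= t -> 0 <= f t.
Proof.
move=> hd h0 f0 t0; apply: (le_trans f0).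
apply: (@ger0_derive1_ndecry R f 0) => //.
- move=> x; rewrite in_itv /= andbT => x0.
  by rewrite derive1E; case: (hd x) => _ ->; exact: h0.
- apply: continuous_subspaceT => x; apply: differentiable_continuous.
  by apply/derivable1_diffP; case: (hd x).
Qed.

#[local] Instance is_derive_expRN (x : R) :
  is_derive x (1 : R) (expR \o -%R) (- expR (- x)).
Proof.
rewrite -mulrN1; exact: is_derive1_comp.
Qed.

Lemma expR_ge_deg2 t : 0 <= t -> 1 + t + t ^+ 2 / 2 <= expR t.
Proof.
move=> t0; pose p : {poly R} := 1 + 'X + (2^-1)%:P * 'X^2.
suff : 0 <= (expR - horner p) t.
  by rewrite /p !fctE !hornerE /=; lra.
apply: (@ge0_of_derive_ge0 _ (fun x => expR x - p^`().[x])) => // [x _|].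
  by have := expR_ge1Dx x; rewrite /p !poly.derivE !hornerE /=; lra.
by rewrite /p !fctE !hornerE /= expR0; lra.
Qed.

Lemma expRN_le_deg2 t : 0 <= t -> expR (- t) <= 1 - t + t ^+ 2 / 2.
Proof.
move=> t0; pose p : {poly R} := 1 - 'X + (2^-1)%:P * 'X^2.
suff : 0 <= (horner p - (expR \o -%R)) t.
  by rewrite /p !fctE !hornerE /=; lra.
apply: (@ge0_of_derive_ge0 _ (fun x => p^`().[x] - - expR (- x))) => // [x _|].
  by have := expR_ge1Dx (- x); rewrite /p !poly.derivE !hornerE /=; lra.
by rewrite /p !fctE !hornerE /= oppr0 expR0; lra.
Qed.

Lemma expRN_ge_deg3 t : 0 <= t -> 1 - t + t ^+ 2 / 2 - t ^+ 3 / 6 <= expR (- t).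
Proof.
move=> t0; pose p : {poly R} := 1 - 'X + (2^-1)%:P * 'X^2 - (6^-1)%:P * 'X^3.
suff : 0 <= ((expR \o -%R) - horner p) t.
  by rewrite /p !fctE !hornerE /=; lra.
apply: (@ge0_of_derive_ge0 _ (fun x => - expR (- x) - p^`().[x])) => // [x x0|].
  by have := expRN_le_deg2 (ltW x0); rewrite /p !poly.derivE !hornerE /=; lra.
by rewrite /p !fctE !hornerE /= oppr0 expR0; lra.
Qed.

(** Inverts the lower bound on [expR (- t)]: the product of the two polynomials exceeds 1 by t^3
    times a factor that is positive for t <= 1/2. *)
Lemma expR_le_deg3 t : 0 <= t -> t <= 2^-1 -> expR t <= 1 + t + t ^+ 2 / 2 + t ^+ 3.
Proof.
move=> t0 t1; have h := expRN_ge_deg3 t0.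
set a := 1 - t + t ^+ 2 / 2 - t ^+ 3 / 6 in h.
have t2 : 0 <= t ^+ 2 by rewrite sqr_ge0.
have t3 : 0 <= t ^+ 3 by rewrite exprn_ge0.
have t3' : t ^+ 3 <= 2^-1 ^+ 3 by rewrite lerXn2r// nnegrE//.
have a0 : 0 < a by rewrite /a; lra.
rewrite -[t in leLHS]opprK expRN.
have h2 : (expR (- t))^-1 <= a^-1 by rewrite lef_pV2 ?posrE ?expR_gt0.
apply: (le_trans h2); rewrite -div1r ler_pdivrMr//.
rewrite -subr_ge0 /a.
have -> : (1 + t + t ^+ 2 / 2 + t ^+ 3) * (1 - t + t ^+ 2 / 2 - t ^+ 3 / 6) - 1 =
  t ^+ 3 * (5 / 6 - 11 / 12 * t + 5 / 12 * t ^+ 2 - t ^+ 3 / 6) by field.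
by rewrite mulr_ge0//; lra.
Qed.

Lemma expR_cubic_bounds u : `|u| <= 2^-1 ->
  1 + u + u ^+ 2 / 2 - `|u| ^+ 3 <= expR u <= 1 + u + u ^+ 2 / 2 + `|u| ^+ 3.
Proof.
have [u0|u0] := leP 0 u => hu.
  move: hu; rewrite (ger0_norm u0) => hu.
  have h3 : 0 <= u ^+ 3 by rewrite exprn_ge0.
  by apply/andP; split; [have := expR_ge_deg2 u0; lra|exact: expR_le_deg3].
have [v hv] : exists v, u = - v by exists (- u); rewrite opprK.
subst u; have v0 : 0 <= v by rewrite -oppr_le0 ltW.
move: hu; rewrite normrN (ger0_norm v0) => hu.
have h3 : 0 <= v ^+ 3 by rewrite exprn_ge0.
have := expRN_ge_deg3 v0; have := expRN_le_deg2 v0; rewrite sqrrN.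
by move=> *; apply/andP; split; lra.
Qed.

(** From e^-z >= 1 - z at z = y - y^2, since (1 + y)(1 - y + y^2) = 1 + y^3 >= 1. It turns a
    polynomial lower bound on a moment generating function into an exponential one. *)
Lemma expR_le1D y : 0 <= y -> expR (y - y ^+ 2) <= 1 + y.
Proof.
move=> y0; rewrite -[y - _]opprK expRN.
have h := expR_ge1Dx (- (y - y ^+ 2)).
have p : 0 < 1 + - (y - y ^+ 2).
  have -> : 1 + - (y - y ^+ 2) = (y - 2^-1) ^+ 2 + 3 / 4 by field.
  by rewrite ltr_wpDl ?sqr_ge0.
apply: (@le_trans _ _ (1 + - (y - y ^+ 2))^-1).
  by rewrite lef_pV2 ?posrE ?expR_gt0.
rewrite -div1r ler_pdivrMr//.
have -> : (1 + y) * (1 + - (y - y ^+ 2)) = 1 + y ^+ 3 by ring.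
by rewrite lerDl exprn_ge0.
Qed.

End ExponentialTaylorBounds.

(** * Moment generating functions under the uniform law on a finite set *)

Section MomentGeneratingFunction.
Context (R : realType) (V : finType).
Implicit Types (f : V -> R) (l eta : R).

Definition avg f : R := #|V|%:R^-1 * \sum_v f v.

Definition mgf f l : R := avg (fun v => expR (l * f v)).

Hypothesis V0 : (0 < #|V|)%N.

Let cV : 0 < #|V|%:R^-1 :> R.
Proof. by rewrite invr_gt0 ltr0n. Qed.

Lemma le_avg f g : (forall v, f v <= g v) -> avg f <= avg g.
Proof. by move=> h; rewrite /avg ler_pM2l//; exact: ler_sum. Qed.

Lemma avg_cst (c : R) : avg (fun=> c) = c.
Proof.
by rewrite /avg sumr_const -[c *+ _]mulr_natl mulrA mulVf ?mul1r// pnatr_eq0 -lt0n.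
Qed.

Lemma avgD f g : avg (fun v => f v + g v) = avg f + avg g.
Proof. by rewrite /avg big_split mulrDr. Qed.

Lemma avgZ (c : R) f : avg (fun v => c * f v) = c * avg f.
Proof. by rewrite /avg -big_distrr /= mulrCA. Qed.

Lemma mgf_ge1 f l : avg f = 0 -> 1 <= mgf f l.
Proof.
move=> f0; apply: (@le_trans _ _ (avg (fun v => 1 + l * f v))).
  by rewrite avgD avg_cst avgZ f0 mulr0 addr0.
by apply: le_avg => v; exact: expR_ge1Dx.
Qed.

Let fbound f : exists2 B : R, 1 <= B & forall v, `|f v| <= B.
Proof.
exists (1 + \sum_v `|f v|); first by rewrite lerDl sumr_ge0.
move=> v; rewrite (bigD1 v)//= addrCA lerDl addr_ge0// sumr_ge0//.
Qed.

(** The second-order expansion of the logarithm at 0. The upper half is stated for variance at most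
    [s2], so that directions of different lengths can share one [s2]. *)
Lemma mgf_bounds f (s2 : R) eta : avg f = 0 -> avg (fun v => f v ^+ 2) <= s2 ->
  0 < s2 -> 0 < eta -> eta <= 1 ->
  exists2 l0, 0 < l0 & forall l, 0 <= l -> l <= l0 ->
    mgf f l <= expR (l ^+ 2 * s2 / 2 * (1 + eta)) /\
    (avg (fun v => f v ^+ 2) = s2 -> expR (l ^+ 2 * s2 / 2 * (1 - eta)) <= mgf f l).
Proof.
move=> f0 fs s0 e0 e1; have [B B1 hB] := fbound f.
have B0 : 0 < B := lt_le_trans ltr01 B1.
(* [B ^+ 3] pays for the cubic Taylor remainder and [s2 ^+ 2] for the loss y^2 in [expR_le1D]. In
   [l0], the first bound gives |l f| <= 1/2 and the last one keeps l C below the margin eta s2 /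
   2. *)
pose C := B ^+ 3 + s2 ^+ 2.
have B3 : 0 < B ^+ 3 by rewrite exprn_gt0.
have s22 : 0 < s2 ^+ 2 by rewrite exprn_gt0.
have C0 : 0 < C by rewrite addr_gt0.
pose l0 := Num.min (2 * B)^-1 (Num.min 1 (eta * s2 / (2 * C))).
exists l0.
  by rewrite !lt_min ltr01 invr_gt0 mulr_gt0// divr_gt0 ?mulr_gt0.
move=> l l_0; rewrite !le_min => /and3P[l1 l2 l3].
have hu v : `|l * f v| <= 2^-1.
  rewrite normrM ger0_norm//; apply: (@le_trans _ _ (l * B)).
    by rewrite ler_wpM2l.
  by move: l1; rewrite invfM ler_pdivlMr// mulrC.
have hu3 v : `|l * f v| ^+ 3 <= l ^+ 3 * B ^+ 3.
  by rewrite normrM ger0_norm// exprMn ler_wpM2l ?exprn_ge0// lerXn2r ?nnegrE// ltW.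
have lC : l * C <= eta * s2 / 2.
  by move: l3; rewrite invfM mulrA ler_pdivlMr.
have E c : avg (fun v => 1 + l * f v + l ^+ 2 / 2 * f v ^+ 2 + c) =
    1 + l ^+ 2 / 2 * avg (fun v => f v ^+ 2) + c.
  by rewrite !avgD !avg_cst !avgZ f0 mulr0 addr0.
have lB : l ^+ 3 * B ^+ 3 <= l ^+ 2 * (eta * s2 / 2).
  rewrite exprSr -mulrA ler_wpM2l ?sqr_ge0//; apply: le_trans lC.
  by rewrite ler_wpM2l// lerDl ltW.
split.
  apply: (@le_trans _ _ (1 + l ^+ 2 / 2 * s2 + l ^+ 3 * B ^+ 3)); last first.
    apply: le_trans (expR_ge1Dx _); rewrite -addrA lerD2l.
    by move: lB; rewrite mulrDr mulr1; lra.
  apply: (@le_trans _ _ (1 + l ^+ 2 / 2 * avg (fun v => f v ^+ 2) + l ^+ 3 * B ^+ 3)).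
    rewrite -E; apply: le_avg => v.
    have /andP[_] := expR_cubic_bounds (hu v); move=> /le_trans; apply.
    by rewrite exprMn lerD ?hu3//; lra.
  by rewrite lerD2r lerD2l ler_wpM2l// mulr_ge0 ?sqr_ge0.
move=> fs2.
apply: (@le_trans _ _ (1 + l ^+ 2 / 2 * s2 - l ^+ 3 * B ^+ 3)); last first.
  rewrite -fs2 -E; apply: le_avg => v.
  have /andP[h _] := expR_cubic_bounds (hu v); apply: le_trans h.
  rewrite exprMn; have := hu3 v; lra.
set y := l ^+ 2 / 2 * s2 - l ^+ 3 * B ^+ 3.
have y0 : 0 <= y.
  suff : l ^+ 2 * (eta * s2 / 2) <= l ^+ 2 / 2 * s2 by rewrite /y; lra.
  have h : eta * s2 <= s2 by rewrite ler_piMl// ltW.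
  have -> : l ^+ 2 / 2 * s2 = l ^+ 2 * (s2 / 2) by field.
  by rewrite ler_wpM2l ?sqr_ge0//; lra.
rewrite -addrA; apply: le_trans (expR_le1D y0); rewrite ler_expR.
have hy : y <= l ^+ 2 / 2 * s2 by rewrite /y gerBl mulr_ge0 ?exprn_ge0 // ltW.
have hy2 : y ^+ 2 <= (l ^+ 2 / 2 * s2) ^+ 2.
  by rewrite lerXn2r// nnegrE// (le_trans y0).
have h4 : (l ^+ 2 / 2 * s2) ^+ 2 <= l ^+ 2 * (l * s2 ^+ 2).
  have -> : (l ^+ 2 / 2 * s2) ^+ 2 = l ^+ 2 * (l * (l / 4 * s2 ^+ 2)) by field.
  rewrite ler_wpM2l ?sqr_ge0// ler_wpM2l// ler_piMl ?sqr_ge0//; lra.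
have h5 : l ^+ 2 * (l * C) <= l ^+ 2 * (eta * s2 / 2).
  by rewrite ler_wpM2l ?sqr_ge0.
have h6 : l ^+ 2 * (l * C) = l ^+ 3 * B ^+ 3 + l ^+ 2 * (l * s2 ^+ 2).
  by rewrite /C; ring.
have -> : l ^+ 2 * s2 / 2 * (1 - eta) = l ^+ 2 / 2 * s2 - l ^+ 2 * (eta * s2 / 2).
  by field.
by rewrite /y in hy2 h6 *; lra.
Qed.

End MomentGeneratingFunction.

(** * Partial sums of a uniform process on a finite alphabet *)

Section UniformProcess.
Context (R : realType) (disp : measure_display) (T : measurableType disp)
  (P : probability T R) (V : finType) (X : nat -> T -> V).
Implicit Types (A : set T) (f : V -> R) (m n : nat) (l d x : R).

Local Notation pr := (pr P).
Local Notation N1 := (#|V|%:R^-1 : R).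

Definition cylinder m n (u : nat -> V) : set T :=
  [set w | forall k, (k < n)%N -> X (m + k)%N w = u k].

Hypothesis mX : forall k v, measurable (X k @^-1` [set v]).
Hypothesis uX : forall n u, pr (cylinder 0 n u) = N1 ^+ n.

(* [past m A] says that [A] is independent of the process after time [m]. *)
Definition past m A : Prop :=
  measurable A /\ forall n u, pr (A `&` cylinder m n u) = pr A * N1 ^+ n.

Lemma measurable_cylinder m n u : measurable (cylinder m n u).
Proof.
have -> : cylinder m n u =
    \bigcap_(k in [set k | (k < n)%N]) (X (m + k)%N @^-1` [set u k]).
  by apply/seteqP; split=> w /= h k /h.
have [->|n0] := posnP n; last by apply: bigcap_measurable => [|k _]; [exists 0%N|].
have -> : [set k | (k < 0)%N] = set0 by apply/seteqP; split.
by rewrite bigcap_set0.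
Qed.

Lemma past_setT : past 0 setT.
Proof. by split=> // n u; rewrite setTI uX prT mul1r. Qed.

Lemma past_step m A v : past m A -> pr (A `&` X m @^-1` [set v]) = pr A * N1.
Proof.
move=> [mA hA]; rewrite -[N1]expr1 -(hA 1%N (fun=> v)); congr (pr (_ `&` _)).
apply/seteqP; split => w /=.
  by move=> h [|//] _; rewrite addn0.
by move=> /(_ 0%N isT); rewrite addn0.
Qed.

Lemma past_stepS m A v : past m A -> past m.+1 (A `&` X m @^-1` [set v]).
Proof.
move=> pA; have [mA hA] := pA; split; first exact: measurableI.
move=> n u; rewrite past_step// -mulrA -exprS.
rewrite -(hA n.+1 (fun k => if k is k'.+1 then u k' else v)) -setIA.
congr (pr (_ `&` _)); apply/seteqP; split => w /=.
  by move=> [hv hu] [_|k]; rewrite ?addn0// ltnS addnS => /hu; rewrite addSn.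
move=> h; split; first by have := h 0%N isT; rewrite addn0.
by move=> k kn; have := h k.+1; rewrite ltnS addnS addSn; exact.
Qed.

(** Both sides of the product rule in [past] are additive over the finite partition by the value of
    [X m]; this is what allows inductions to condition on one letter. *)
Lemma past_partition m (l : nat) A : measurable A ->
  (forall v, past l (A `&` X m @^-1` [set v])) -> past l A.
Proof.
move=> mA hA; split=> // n u.
rewrite (pr_partition (X := X m) P _ (mX m)); last first.
  by apply: measurableI => //; exact: measurable_cylinder.
rewrite [pr A](pr_partition (X := X m) P mA (mX m)) big_distrl /=.
by apply: eq_bigr => v _; rewrite setIAC; case: (hA v) => _ ->.
Qed.

Lemma past_set0 m : past m set0.
Proof. by split=> // n u; rewrite set0I pr0 mul0r. Qed.

Definition psum f m n w : R := \sum_(k < n) f (X (m + k)%N w).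

Lemma psum0 f m w : psum f m 0 w = 0.
Proof. by rewrite /psum big_ord0. Qed.

Lemma psumS f m n w : psum f m n.+1 w = f (X m w) + psum f m.+1 n w.
Proof.
rewrite /psum big_ord_recl /= addn0; congr (_ + _).
by apply: eq_bigr => k _; rewrite /bump /= addnA addn1.
Qed.

Lemma psumD f m n k w : psum f m (n + k) w = psum f m n w + psum f (m + n) k w.
Proof.
rewrite /psum big_split_ord /=; congr (_ + _).
by apply: eq_bigr => i _; rewrite addnA.
Qed.

Let psum_split f m n (Q : R -> Prop) A v :
  A `&` [set w | Q (psum f m n.+1 w)] `&` X m @^-1` [set v] =
  (A `&` X m @^-1` [set v]) `&` [set w | Q (f v + psum f m.+1 n w)].
Proof.
apply/seteqP; split => w /=.
  by move=> [[Aw]]; rewrite psumS => h xv; rewrite -xv.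
by move=> [[Aw xv] h]; rewrite psumS xv.
Qed.

(** With finitely many letters the event is a finite union over the first letter, so [Q] can be any
    predicate; the induction shifts it by [f v]. *)
Lemma measurable_psum f m n (Q : R -> Prop) : measurable [set w | Q (psum f m n w)].
Proof.
elim: n m Q => [|n IH] m Q.
  have -> : [set w | Q (psum f m 0 w)] = [set w | Q 0].
    by apply/seteqP; split=> w /=; rewrite psum0.
  have [q|q] := pselect (Q 0).
    by rewrite (_ : [set _ | _] = setT)//; apply/seteqP; split.
  by rewrite (_ : [set _ | _] = set0)//; apply/seteqP; split.
rewrite (_ : [set _ | _] = \big[setU/set0]_(v <- enum V)
    (X m @^-1` [set v] `&` [set w | Q (f v + psum f m.+1 n w)])).
  by apply: bigsetU_measurable => v _; apply: measurableI => //; exact: (IH m.+1 (fun z => Q (f v + z))).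
rewrite -bigcup_seq; apply/seteqP; split => w /=.
  by rewrite psumS => h; exists (X m w) => //=; rewrite mem_enum.
by move=> [v _ [/= xv h]]; rewrite psumS xv.
Qed.

Lemma past_psum f m n (Q : R -> Prop) A : past m A ->
  past (m + n) (A `&` [set w | Q (psum f m n w)]).
Proof.
elim: n m Q A => [|n IH] m Q A pA.
  rewrite addn0; have [q|q] := pselect (Q 0).
    rewrite (_ : A `&` _ = A)//; apply/seteqP; split => w /=; first by case.
    by rewrite psum0.
  rewrite (_ : A `&` _ = set0); first exact: past_set0.
  by apply/seteqP; split => w //=; rewrite psum0 => -[].
apply: (@past_partition m).
  by case: pA => mA _; apply: measurableI => //; exact: measurable_psum.
move=> v; rewrite psum_split -addSnnS.
exact: (IH m.+1 (fun z => Q (f v + z)) _ (past_stepS v pA)).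
Qed.

Hypothesis V0 : (0 < #|V|)%N.

(* The induction is on the first step: a sum of [n.+1] steps reaches [x > 0] iff the
   remaining [n] steps reach [x - f v], where [v] is the first step. *)
Lemma max_ineq f l m n x A : avg f = 0 -> 0 <= l -> past m A ->
  pr (A `&` [set w | exists2 k, (k <= n)%N & x <= psum f m k w])
    <= pr A * (expR (- (l * x)) * mgf f l ^+ n).
Proof.
move=> f0 l0; have M1 := mgf_ge1 V0 l f0.
have mE m' n' x' : measurable [set w | exists2 k, (k <= n')%N & x' <= psum f m' k w].
  rewrite (_ : [set _ | _] = \bigcup_(k in [set k | (k <= n')%N])
     [set w | x' <= psum f m' k w]); last first.
    by apply/seteqP; split => w /= [k]; exists k.
  by apply: bigcup_measurable => k _; exact: (measurable_psum f m' k (fun z => x' <= z)).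
elim: n m x A => [|n IH] m x A pA; have [mA hA] := pA.
all: have [x0|x0] := leP x 0.
- apply: (@le_trans _ _ (pr A)).
    by apply: le_pr => //; exact: measurableI.
  rewrite ler_peMr ?pr_ge0// mulr_ege1//.
    by rewrite -expR0 ler_expR oppr_ge0 mulr_ge0_le0.
- rewrite (_ : _ `&` _ = set0) ?pr0.
    by rewrite mulr_ge0 ?pr_ge0// mulr_ge0 ?expR_ge0// exprn_ge0// (le_trans ler01).
  apply/seteqP; split => w //= [_ [k]]; rewrite leqn0 => /eqP ->.
  by rewrite psum0 leNgt x0.
(* At a level x <= 0 the bound is trivial, since e^(-l x) >= 1 and, [f] being centred, [mgf f l] >=
   1. *)
- apply: (@le_trans _ _ (pr A)).
    by apply: le_pr => //; exact: measurableI.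
  rewrite ler_peMr ?pr_ge0// mulr_ege1//.
    by rewrite -expR0 ler_expR oppr_ge0 mulr_ge0_le0.
  by rewrite exprn_ege1.
- rewrite (pr_partition (X := X m) P _ (mX m)); last exact: measurableI.
  (* Averaging the factor e^(l f v), left by the shift of the level, over the first letter gives one
     more factor [mgf f l]. *)
  apply: (@le_trans _ _ (\sum_v pr A * N1 * (expR (- (l * (x - f v))) * mgf f l ^+ n))).
    apply: ler_sum => v _; rewrite -(past_step v pA).
    apply: le_trans (IH m.+1 _ _ (past_stepS v pA)).
    have mv : measurable (A `&` X m @^-1` [set v]) by exact: measurableI.
    apply: le_pr; [| |].
    + by apply: measurableI => //; exact: measurableI.
    + exact: measurableI.
    + move=> w /= [[Aw [[|k]]]] kn; first by rewrite psum0 leNgt x0.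
      rewrite psumS => hx xv; split => //; exists k => //.
      by rewrite lerBlDl -xv.
  have -> : \sum_v pr A * N1 * (expR (- (l * (x - f v))) * mgf f l ^+ n) =
    pr A * (expR (- (l * x)) * (mgf f l * mgf f l ^+ n)).
    rewrite [in X in _ * (_ * (X * _))]/mgf /avg !(big_distrl, big_distrr) /=.
    apply: eq_bigr => v _.
    have -> : - (l * (x - f v)) = - (l * x) + l * f v by ring.
    by rewrite expRD; ring.
  by rewrite exprS.
Qed.

(** The hypotheses say that the exponential sum is at most the indicator of [Q]; the conclusion is
    that inequality integrated over [A]. No integral is formed: conditioning on the first letter
    multiplies [c j] by e^(l_j f v), which is why the induction generalizes [c] and [Q]. *)
Lemma expectation_lb (J : finType) (c l : J -> R) f m n (Q : R -> Prop) A :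
  (forall z, Q z -> \sum_j c j * expR (l j * z) <= 1) ->
  (forall z, ~ Q z -> \sum_j c j * expR (l j * z) <= 0) ->
  past m A ->
  pr A * (\sum_j c j * mgf f (l j) ^+ n)
    <= pr (A `&` [set w | Q (psum f m n w)]).
Proof.
elim: n m c Q A => [|n IH] m c Q A hQ hN pA; have [mA hA] := pA.
  under eq_bigr do rewrite expr0 mulr1.
  have e0 : \sum_j c j = \sum_j c j * expR (l j * 0).
    by apply: eq_bigr => j _; rewrite mulr0 expR0 mulr1.
  rewrite e0; have [q|q] := pselect (Q 0).
    rewrite (_ : A `&` _ = A); first by rewrite ler_piMr ?pr_ge0 ?hQ.
    by apply/seteqP; split => w /=; [case|rewrite psum0].
  rewrite (_ : A `&` _ = set0); first by rewrite pr0 mulr_ge0_le0 ?pr_ge0 ?hN.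
  by apply/seteqP; split => w //=; rewrite psum0 => -[].
rewrite [leRHS](pr_partition (X := X m) P _ (mX m)); last first.
  by apply: measurableI => //; exact: measurable_psum.
apply: (@le_trans _ _ (\sum_v pr A * N1 *
    (\sum_j (c j * expR (l j * f v)) * mgf f (l j) ^+ n))); last first.
  apply: ler_sum => v _; rewrite psum_split -(past_step v pA).
  apply: (IH m.+1 _ (fun z => Q (f v + z)) _ _ _ (past_stepS v pA)) => z qz.
    apply: le_trans (hQ _ qz); rewrite le_eqVlt; apply/orP; left; apply/eqP.
    by apply: eq_bigr => j _; rewrite mulrDr expRD mulrA.
  apply: le_trans (hN _ qz); rewrite le_eqVlt; apply/orP; left; apply/eqP.
  by apply: eq_bigr => j _; rewrite mulrDr expRD mulrA.
rewrite le_eqVlt; apply/orP; left; apply/eqP.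
rewrite -big_distrr /= -mulrA; congr (_ * _).
rewrite exchange_big /= big_distrr /=; apply: eq_bigr => j _.
rewrite exprS {1}/mgf /avg -!big_distrl /= -big_distrr /=; ring.
Qed.

(* Exponential tilting without a central limit theorem: on the interval between
   [(1 - d) * x] and [(1 + d) * x] the combination [e^(lz) - ...] of three exponentials
   is at most [e^(l(1+d)x)], and it is nonpositive elsewhere. *)
Lemma psum_tail_lb f l d x m n A : 0 <= l -> 0 < d -> d < 1 -> past m A ->
  pr A * (expR (- (l * (1 + d) * x)) *
    (mgf f l ^+ n - expR (- (d * l * (1 + d) * x)) * mgf f ((1 + d) * l) ^+ n
      - expR (d * l * (1 - d) * x) * mgf f ((1 - d) * l) ^+ n))
  <= pr (A `&` [set w | (1 - d) * x <= psum f m n w]).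
Proof.
move=> l0 d0 d1 pA.
pose E0 := expR (- (l * (1 + d) * x)).
pose c (j : 'I_3) := [:: E0; - (E0 * expR (- (d * l * (1 + d) * x)));
  - (E0 * expR (d * l * (1 - d) * x))]`_j.
pose lj (j : 'I_3) := [:: l; (1 + d) * l; (1 - d) * l]`_j.
have E (h : R -> R) : \sum_j c j * h (lj j) =
   E0 * (h l - expR (- (d * l * (1 + d) * x)) * h ((1 + d) * l)
      - expR (d * l * (1 - d) * x) * h ((1 - d) * l)).
  by rewrite !big_ord_recl big_ord0 /c /lj /=; ring.
rewrite -/E0 -(E (fun y => mgf f y ^+ n)).
have key z : \sum_j c j * expR (lj j * z) = E0 * expR (l * z) *
   (1 - expR (d * l * (z - (1 + d) * x)) - expR (d * l * ((1 - d) * x - z))).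
  rewrite (E (fun y => expR (y * z))) -[RHS]mulrA; congr (_ * _).
  rewrite !mulrBr mulr1 -!expRD; congr (_ - expR _ - expR _); ring.
have E00 : 0 < E0 by exact: expR_gt0.
apply: (@expectation_lb _ c lj f m n (fun z => (1 - d) * x <= z) A) => // z hz;
  rewrite key.
  have [zx|zx] := leP z ((1 + d) * x).
    apply: (@le_trans _ _ (E0 * expR (l * z) * 1)).
      apply: ler_wpM2l; first by rewrite mulr_ge0 ?expR_ge0// ltW.
      have := expR_ge0 (d * l * (z - (1 + d) * x)).
      by have := expR_ge0 (d * l * ((1 - d) * x - z)); lra.
    rewrite mulr1 /E0 -expRD -[leRHS]expR0 ler_expR -mulrA addrC subr_le0 ler_wpM2l//.
  apply: (@le_trans _ _ 0) => //; rewrite pmulr_rle0 ?mulr_gt0 ?expR_gt0//.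
  have : 1 <= expR (d * l * (z - (1 + d) * x)).
    by rewrite -[leLHS]expR0 ler_expR mulr_ge0 ?(mulr_ge0 (ltW d0))// subr_ge0 ltW.
  by have := expR_ge0 (d * l * ((1 - d) * x - z)); lra.
rewrite pmulr_rle0 ?mulr_gt0 ?expR_gt0//.
have : 1 <= expR (d * l * ((1 - d) * x - z)).
  rewrite -[leLHS]expR0 ler_expR mulr_ge0 ?(mulr_ge0 (ltW d0))// subr_ge0 ltW//.
  by rewrite ltNge; apply/negP.
by have := expR_ge0 (d * l * (z - (1 + d) * x)); lra.
Qed.

End UniformProcess.

(** * Iterated logarithm bounds for one-dimensional sums of uniform letters *)

Section UniformProcessLIL.
Context (R : realType).

(** ln ln t <= ln t = 2 ln sqrt t <= 2 sqrt t. It brings the optimal tilt, of order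
    [lilscale t / t], into the range of [mgf_bounds]. *)
Lemma lilscale_small (e : R) : 0 < e ->
  exists t0, forall t, t0 <= t -> lilscale t <= e * t.
Proof.
move=> e0; pose a := 2 / e ^+ 2.
have a0 : 0 < a by rewrite divr_gt0// exprn_gt0.
exists (expR 1 + a ^+ 2) => t ht.
have t1 : expR 1 <= t by apply: le_trans ht; rewrite lerDl sqr_ge0.
have t0 : 0 < t by apply: lt_le_trans t1; exact: expR_gt0.
have at2 : a ^+ 2 <= t by apply: le_trans ht; rewrite lerDr expR_ge0.
pose s := Num.sqrt t.
have s0 : 0 < s by rewrite sqrtr_gt0.
have ts : t = s ^+ 2 by rewrite sqr_sqrtr// ltW.
have as_ : a <= s by rewrite -(ger0_norm (ltW a0)) -sqrtr_sqr ler_wsqrtr.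
have h1 : ln (ln t) <= 2 * s.
  have l0 : 0 < ln t by rewrite ln_gt0// (lt_le_trans _ t1)// -expR0 ltr_expR.
  apply: (le_trans (ltW (ln_sublinear l0))).
  by rewrite ts lnXn// -[_ *+ 2]mulr_natl ler_wpM2l// ltW// ln_sublinear.
have h2 : 2 <= e ^+ 2 * s.
  by move: as_; rewrite /a ler_pdivrMr ?exprn_gt0// mulrC.
rewrite -(ger0_norm (lilscale_ge0 t)) -[leRHS]ger0_norm; last by rewrite mulr_ge0// ltW.
rewrite -ler_sqr ?nnegrE// !real_normK ?num_real// sqr_lilscale// exprMn.
rewrite [t ^+ 2]expr2 mulrA [leRHS]mulrC ler_pM2l//.
apply: (le_trans h1); rewrite [X in e ^+ 2 * X]ts [s ^+ 2]expr2 mulrA.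
by rewrite ler_pM2r.
Qed.

Context (disp : measure_display) (T : measurableType disp)
  (P : probability T R) (V : finType) (X : nat -> T -> V).
Hypothesis mX : forall k v, measurable (X k @^-1` [set v]).
Hypothesis uX : forall n u, pr P (cylinder X 0 n u) = (#|V|%:R^-1) ^+ n.
Hypothesis V0 : (0 < #|V|)%N.

(** Two factors [theta] are lost: one because the maximum belonging to theta^k runs up to
    theta^(k+1), one in the bound on the moment generating function. Hence rho = r / theta^2, and
    eta <= (r - 1) / 6 keeps it above 1. *)
Lemma psum_lil_upper (f : V -> R) (s2 c : R) : avg f = 0 ->
  avg (fun v => f v ^+ 2) <= s2 -> 0 < s2 -> 0 < c -> 2 * s2 < c ^+ 2 ->
  {ae P, forall w, exists n0, forall n, (n0 <= n)%N ->
    psum X f 0 n w <= c * lilscale n%:R}.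
Proof.
move=> f0 fs s0 c0 hc; pose r := c ^+ 2 / (2 * s2).
have s20 : 0 < 2 * s2 by rewrite mulr_gt0.
have r1 : 1 < r by rewrite ltr_pdivlMr// mul1r.
pose eta := Num.min 1 ((r - 1) / 6).
have e0 : 0 < eta by rewrite lt_min ltr01 divr_gt0// subr_gt0.
have e1 : eta <= 1 by rewrite ge_min lexx.
have e2 : eta <= (r - 1) / 6 by rewrite ge_min lexx orbT.
pose theta := 1 + eta.
have th1 : 1 < theta by rewrite ltrDl.
have th0 : 0 < theta := lt_trans ltr01 th1.
pose rho := r / theta ^+ 2.
have th2 : theta ^+ 2 < r.
  have : eta ^+ 2 <= eta by rewrite expr2 ler_piMl// ltW.
  by rewrite /theta sqrrD; lra.
have rho1 : 1 < rho by rewrite ltr_pdivlMr ?exprn_gt0// mul1r.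
have [l0 l00 hM] := mgf_bounds V0 f0 fs s0 e0 e1.
pose x k := c * lilscale (theta ^+ k).
pose N k := Num.truncn (theta ^+ k.+1).
pose bad k := [set w | exists2 j, (j <= N k)%N & x k <= psum X f 0 j w].
have mbad k : measurable (bad k).
  rewrite (_ : bad k = \bigcup_(j in [set j | (j <= N k)%N])
     [set w | x k <= psum X f 0 j w]); last first.
    by apply/seteqP; split => w /= [j]; exists j.
  by apply: bigcup_measurable => j _; exact: (measurable_psum mX f 0 j (fun z => x k <= z)).
have [t0 ht0] := lilscale_small (divr_gt0 (mulr_gt0 l00 s0) c0).
have [k1 hk1] := exp_unbounded (Num.max t0 (expR 1)) th1.
have hbad k : (k1 <= k)%N -> pr P (bad k) <= 1 * expR (- (rho * ln (ln (theta ^+ k)))).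
  move=> /hk1; rewrite ge_max => /andP[k2 k3].
  have tk0 : 0 < theta ^+ k by rewrite exprn_gt0.
  pose D := s2 * theta * theta ^+ k.+1.
  have D0 : 0 < D by rewrite !mulr_gt0// exprn_gt0.
  (* The minimizer of -l x + l^2 D / 2, where [D] is the inflated variance at the end of the
     block. *)
  pose l := x k / D.
  have x0 : 0 <= x k by rewrite mulr_ge0 ?lilscale_ge0// ltW.
  have l_0 : 0 <= l by rewrite divr_ge0// ltW.
  have ll0 : l <= l0.
    rewrite ler_pdivrMr//; have := ht0 _ k2.
    rewrite mulrAC ler_pdivlMr// mulrC -/(x k) => /le_trans; apply.
    rewrite /D !mulrA -[leLHS]mulr1 exprS.
    have -> : l0 * s2 * theta * (theta * theta ^+ k) =
      l0 * s2 * theta ^+ k * theta ^+ 2 by ring.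
    by rewrite ler_pM2l ?mulr_gt0// exprn_ege1// ltW.
  have := max_ineq mX V0 (N k) (x k) f0 l_0 (past_setT uX).
  rewrite setTI prT !mul1r => /le_trans; apply.
  have [hM1 _] := hM l l_0 ll0.
  apply: (@le_trans _ _ (expR (- (l * x k)) * expR (l ^+ 2 * s2 / 2 * theta) ^+ N k)).
    rewrite ler_pM2l ?expR_gt0// lerXn2r// nnegrE ?expR_ge0//.
    by apply: le_trans (mgf_ge1 V0 l f0).
  rewrite -expRM_natl -expRD ler_expR.
  apply: (@le_trans _ _ (- (l * x k) + theta ^+ k.+1 * (l ^+ 2 * s2 / 2 * theta))).
    rewrite lerD2l; apply: ler_wpM2r.
      by rewrite mulr_ge0 ?(ltW th0)// divr_ge0// mulr_ge0 ?sqr_ge0// ltW.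
    by rewrite Num.Theory.truncn_le exprn_ge0// ltW.
  have -> : - (l * x k) + theta ^+ k.+1 * (l ^+ 2 * s2 / 2 * theta) =
     - (x k ^+ 2 / (2 * D)).
    by rewrite /l /D; field; rewrite !gt_eqF// exprn_gt0.
  rewrite lerN2 /x exprMn sqr_lilscale// /D /rho /r [theta ^+ k.+1]exprS.
  rewrite le_eqVlt; apply/orP; left; apply/eqP; field.
  by rewrite !gt_eqF.
have [M hMM] := sum_expRN_lnln_bounded th1 rho1 ler01 (fun k => pr_le1 P (mbad k)) hbad.
have H := ae_eventually_notin mbad hMM.
apply: filterS H => w /= [k0 hw].
pose k2 := maxn k0 k1.
exists (N k2).+1 => n hn.
have hn' : theta ^+ k2.+1 <= n%:R.
  by apply: (le_trans (ltW (Num.Theory.truncnS_gt _))); rewrite ler_nat.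
have [k kk /andP[t1 t2]] := exp_block th1 hn'.
have kk0 : (k0 <= k)%N by apply: leq_trans (ltnW kk); rewrite leq_maxl.
have kk1 : (k1 <= k)%N by apply: leq_trans (ltnW kk); rewrite leq_maxr.
have h : psum X f 0 n w < x k.
  rewrite ltNge; apply/negP => h; apply: (hw k kk0); exists n => //.
  rewrite /N Num.Theory.truncn_ge_nat ?exprn_ge0 ?(ltW th0)//; exact: ltW.
apply: (le_trans (ltW h)); rewrite /x ler_pM2l// le_lilscale//.
by move: (hk1 k kk1); rewrite ge_max => /andP[].
Qed.

(** [psum_tail_lb] is used with the Gaussian tilt l = x / (n s2). With y = x^2 / (n s2), each
    correction term has an exponent smaller by d^2 y / 2 than the main one; for eta = d^2 / 10 at
    least d^2 y / 4 of this survives, and y >= 8 / d^2 makes it 2. So each correction is at most a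
    quarter of the lower bound [G] of the main term. *)
Lemma psum_tail_lb_gauss (f : V -> R) (s2 d : R) : avg f = 0 ->
  avg (fun v => f v ^+ 2) = s2 -> 0 < s2 -> 0 < d -> d <= 2^-1 ->
  exists2 l0, 0 < l0 & forall (x : R) m n A, past P X m A -> (0 < n)%N -> 0 <= x ->
    x / (n%:R * s2) <= l0 -> 8 / d ^+ 2 <= x ^+ 2 / (n%:R * s2) ->
    pr P A * expR (- ((2^-1 + 3 * d) * (x ^+ 2 / (n%:R * s2))))
      <= pr P (A `&` [set w | (1 - d) * x <= psum X f m n w]).
Proof.
move=> f0 fs s0 d0 d1; have d20 : 0 < d ^+ 2 by rewrite exprn_gt0.
have d2d : d ^+ 2 <= d / 2 by rewrite expr2 ler_wpM2l// ltW.
pose eta := d ^+ 2 / 10.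
have e0 : 0 < eta by rewrite divr_gt0.
have e1 : eta <= 1 by rewrite /eta; lra.
have fs' : avg (fun v => f v ^+ 2) <= s2 by rewrite fs.
have [l0 l00 hM] := mgf_bounds V0 f0 fs' s0 e0 e1.
exists (l0 / 2); first by rewrite divr_gt0.
move=> x m n A pA n0 x0; set D := n%:R * s2; set y := x ^+ 2 / D.
have nR : 0 < n%:R :> R by rewrite ltr0n.
have D0 : 0 < D by rewrite mulr_gt0.
set l := x / D => hl hy.
have l_0 : 0 <= l by rewrite divr_ge0// ltW.
have d3 : d < 1 by lra.
apply: le_trans (psum_tail_lb mX f x n l_0 d0 d3 pA).
rewrite ler_wpM2l ?pr_ge0//.
have y8 : 8 <= y * d ^+ 2 by move: hy; rewrite ler_pdivrMr.
have yd : 1 <= d * y.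
  have : y * d ^+ 2 <= y * d.
    by rewrite ler_wpM2l ?divr_ge0 ?sqr_ge0 ?(ltW D0)//; lra.
  by lra.
have y0 : 0 <= y by rewrite divr_ge0 ?sqr_ge0// ltW.
have lx : l * x = y by rewrite /l /y; field; rewrite gt_eqF.
have nl : n%:R * (l ^+ 2 * s2) = y.
  by rewrite /l /y /D; field; rewrite !gt_eqF.
have Hup (b : R) : 0 <= b -> b <= 2 -> mgf f (b * l) ^+ n <= expR (b ^+ 2 * y / 2 * (1 + eta)).
  move=> b0 b2; have bl0 : 0 <= b * l by rewrite mulr_ge0.
  have bl1 : b * l <= l0.
    apply: (@le_trans _ _ (2 * l)); first by rewrite ler_wpM2r.
    by move: hl; lra.
  have [h _] := hM _ bl0 bl1.
  apply: (@le_trans _ _ (expR ((b * l) ^+ 2 * s2 / 2 * (1 + eta)) ^+ n)).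
    by rewrite lerXn2r// nnegrE ?expR_ge0// (le_trans _ (mgf_ge1 V0 _ f0)).
  rewrite -expRM_natl -nl ler_expR le_eqVlt; apply/orP; left; apply/eqP; by field.
have Hlo : expR (y / 2 * (1 - eta)) <= mgf f l ^+ n.
  have ll : l <= l0 by move: hl; lra.
  have [_ /(_ fs) h] := hM _ l_0 ll.
  apply: (@le_trans _ _ (expR (l ^+ 2 * s2 / 2 * (1 - eta)) ^+ n)).
    rewrite -expRM_natl -nl ler_expR le_eqVlt; apply/orP; left; apply/eqP; by field.
  by rewrite lerXn2r// nnegrE ?expR_ge0// (le_trans _ (mgf_ge1 V0 _ f0)).
have b1 : 0 <= 1 + d by lra.
have b1' : 1 + d <= 2 by lra.
have b2 : 0 <= 1 - d by lra.
have b2' : 1 - d <= 2 by lra.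
have := Hup _ b1 b1'; have := Hup _ b2 b2' => H2 H1.
pose G := expR (y / 2 * (1 - eta)).
have G0 : 0 < G := expR_gt0 _.
have four : expR (- 2) <= 4^-1 :> R.
  rewrite expRN lef_pV2 ?posrE ?expR_gt0//.
  have h2 : 0 <= 2 :> R by [].
  by have := expR_ge_deg2 h2; lra.
have G1 : expR (- (d * l * (1 + d) * x)) * mgf f ((1 + d) * l) ^+ n <= G / 4.
  apply: (@le_trans _ _ (expR (- (d * l * (1 + d) * x)) * expR ((1 + d) ^+ 2 * y / 2 * (1 + eta)))).
    by rewrite ler_pM2l ?expR_gt0.
  rewrite -expRD; apply: (@le_trans _ _ (G * expR (- 2))); last by rewrite ler_pM2l.
  rewrite -expRD ler_expR.
  have -> : d * l * (1 + d) * x = d * (1 + d) * y by rewrite -lx; ring.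
  have h : (1 + d) ^+ 2 * eta * y <= 4 * eta * y.
    rewrite ler_wpM2r// ler_wpM2r ?(ltW e0)//.
    have -> : 4 = 2 ^+ 2 :> R by ring.
    by rewrite lerXn2r// nnegrE; lra.
  have -> : - (d * (1 + d) * y) + (1 + d) ^+ 2 * y / 2 * (1 + eta) =
     y / 2 - y * d ^+ 2 / 2 + ((1 + d) ^+ 2 * eta * y) / 2 by field.
  by move: h; rewrite /eta; lra.
have G2 : expR (d * l * (1 - d) * x) * mgf f ((1 - d) * l) ^+ n <= G / 4.
  apply: (@le_trans _ _ (expR (d * l * (1 - d) * x) * expR ((1 - d) ^+ 2 * y / 2 * (1 + eta)))).
    by rewrite ler_pM2l ?expR_gt0.
  rewrite -expRD; apply: (@le_trans _ _ (G * expR (- 2))); last by rewrite ler_pM2l.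
  rewrite -expRD ler_expR.
  have -> : d * l * (1 - d) * x = d * (1 - d) * y by rewrite -lx; ring.
  have h : (1 - d) ^+ 2 * eta * y <= 1 * eta * y.
    rewrite ler_wpM2r// ler_wpM2r ?(ltW e0)//.
    by rewrite expr_le1//; lra.
  have -> : d * (1 - d) * y + (1 - d) ^+ 2 * y / 2 * (1 + eta) =
     y / 2 - y * d ^+ 2 / 2 + ((1 - d) ^+ 2 * eta * y) / 2 by field.
  by move: h; rewrite /eta; lra.
apply: (@le_trans _ _ (expR (- (l * (1 + d) * x)) * (G / 2))); last first.
  by rewrite ler_pM2l ?expR_gt0// /G; move: Hlo G1 G2; rewrite -/G; lra.
(* The remaining factor 1/2 is at least e^-1, and d y >= 1 lets the slack 3 d absorb it. *)
have half : expR (- 1) <= 2^-1 :> R.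
  rewrite expRN lef_pV2 ?posrE ?expR_gt0//.
  by have := @expR_ge1Dx R 1; lra.
apply: (@le_trans _ _ (expR (- (l * (1 + d) * x)) * (G * expR (- 1)))); last first.
  by rewrite ler_pM2l ?expR_gt0// ler_pM2l.
rewrite -!expRD ler_expR.
have -> : l * (1 + d) * x = (1 + d) * y by rewrite -lx; ring.
have : y * d ^+ 2 <= y * (d / 2) by rewrite ler_wpM2l.
by rewrite /eta; lra.
Qed.

(** The increments are tested one after the other: the tail bound holds on every event of the past,
    so each failure costs a factor 1 - 1/(k+1). *)
Lemma psum_increments_frequently (f : V -> R) (s2 c : R) : avg f = 0 ->
  avg (fun v => f v ^+ 2) = s2 -> 0 < s2 -> 0 < c -> c ^+ 2 < 2 * s2 ->
  exists q0, forall q, (q0 <= q)%N ->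
  {ae P, forall w, forall m, exists2 k, (m <= k)%N &
    c * lilscale (q%:R ^+ k.+1) <= psum X f (q ^ k) (q ^ k.+1 - q ^ k) w}.
Proof.
move=> f0 fs s0 c0 hc; pose r := c ^+ 2 / (2 * s2).
have s20 : 0 < 2 * s2 by rewrite mulr_gt0.
have r0 : 0 < r by rewrite divr_gt0// exprn_gt0.
have r1 : r < 1 by rewrite ltr_pdivrMr// mul1r.
(* With this [d] and 1/q <= d, r (1 + 6 d) < 1 - 3 d <= (1 - d)^3 <= (1 - d)^2 (1 - 1/q), so the
   exponent [gamma] is below 1. *)
pose d := (1 - r) / 10.
have d0 : 0 < d by rewrite divr_gt0// subr_gt0.
have d1 : d <= 2^-1 by rewrite /d; lra.
have [l0 l00 hT] := psum_tail_lb_gauss f0 fs s0 d0 d1.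
exists (Num.truncn d^-1).+2 => q hq.
have q1 : (1 < q)%N by apply: leq_trans hq.
have q0 : (0 < q)%N := ltnW q1.
have qR1 : 1 < q%:R :> R by rewrite ltr1n.
have qR0 : 0 < q%:R :> R by rewrite ltr0n.
have hqd : q%:R^-1 <= d.
  rewrite -[leRHS]invrK lef_pV2 ?posrE ?invr_gt0//.
  apply: (le_trans (ltW (Num.Theory.truncnS_gt _))); rewrite ler_nat.
  exact: ltnW.
pose n k := (q ^ k.+1 - q ^ k)%N.
have nE k : (n k)%:R = q%:R ^+ k.+1 * (1 - q%:R^-1) :> R.
  rewrite natrB ?leq_exp2l// !natrX mulrBr mulr1 exprS mulrAC divff ?mul1r//.
  by rewrite gt_eqF.
have a0 : 0 < 1 - q%:R^-1 :> R by rewrite subr_gt0 invf_lt1.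
(* Divided by 1 - d because [psum_tail_lb_gauss] reaches only 1 - d times its level. *)
pose x k := c * lilscale (q%:R ^+ k.+1) / (1 - d).
pose gamma := r * (1 + 6 * d) / ((1 - d) ^+ 2 * (1 - q%:R^-1)).
have dd : 0 < 1 - d by lra.
have g0 : 0 <= gamma.
  apply: divr_ge0; apply: mulr_ge0; rewrite ?sqr_ge0 ?(ltW a0) ?(ltW r0)//.
  by rewrite addr_ge0// mulr_ge0// ltW.
have g1 : gamma < 1.
  rewrite ltr_pdivrMr ?mulr_gt0 ?exprn_gt0// mul1r.
  apply: (@lt_le_trans _ _ ((1 - d) ^+ 2 * (1 - d))); last first.
    by rewrite ler_pM2l ?exprn_gt0// lerD2l lerN2.
  have h1 : r * (1 + 6 * d) < 1 - 3 * d.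
    apply: (@le_lt_trans _ _ (r + 6 * d)); last by rewrite /d; lra.
    by rewrite mulrDr mulr1 lerD2l ler_piMl ?(ltW r1)//; lra.
  apply: (lt_le_trans h1).
  have -> : (1 - d) ^+ 2 * (1 - d) = 1 - 3 * d + d ^+ 2 * (3 - d) by ring.
  by rewrite lerDl mulr_ge0 ?sqr_ge0//; lra.
have yE k : expR 1 <= q%:R ^+ k.+1 :> R ->
    (2^-1 + 3 * d) * (x k ^+ 2 / ((n k)%:R * s2)) = gamma * ln (ln (q%:R ^+ k.+1)).
  move=> h; rewrite /x expr_div_n exprMn sqr_lilscale// nE /gamma /r.
  have : q%:R ^+ k.+1 != 0 :> R by rewrite gt_eqF// exprn_gt0.
  move: (q%:R ^+ k.+1) => Q Q0.
  have a0' : 1 - q%:R^-1 != 0 :> R by rewrite gt_eqF.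
  move: (1 - q%:R^-1) a0' => a a0'; field.
  by rewrite Q0 a0' !gt_eqF.
pose A k := [set w | c * lilscale (q%:R ^+ k.+1) <= psum X f (q ^ k) (n k) w].
have mA k : measurable (A k).
  exact: (measurable_psum mX f _ _ (fun z => c * lilscale (q%:R ^+ k.+1) <= z)).
have [t0 ht0] := lilscale_small (divr_gt0 (mulr_gt0 (mulr_gt0 (mulr_gt0 l00 s0) dd) a0) c0).
have [k1 hk1] := exp_unbounded (Num.max t0 (expR 1)) qR1.
have [k2 hk2] := lnln_exp_unbounded (8 / d ^+ 2 * (2^-1 + 3 * d) / gamma) qR1.
have [k3 hk3] := expRN_lnln_ge_inv qR1 g0 g1.
have gg0 : 0 < gamma.
  by apply: divr_gt0; apply: mulr_gt0; rewrite ?exprn_gt0// addr_gt0// mulr_gt0.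
have hA k C : (maxn k1 (maxn k2 k3) <= k)%N -> past P X (q ^ k) C ->
    pr P C * k.+1%:R^-1 <= pr P (C `&` A k).
  rewrite !geq_max => /and3P[kk1 kk2 kk3] pC.
  have := hk1 k.+1 (leqW kk1); rewrite ge_max => /andP[h1 h2].
  have := hk2 k.+1 (leqW kk2) => h3.
  have Q0 : 0 < q%:R ^+ k.+1 :> R by rewrite exprn_gt0.
  have nk0 : (0 < n k)%N by rewrite subn_gt0 ltn_exp2l.
  have nR0 : 0 < (n k)%:R :> R by rewrite ltr0n.
  have x0 : 0 <= x k.
    by rewrite divr_ge0 ?(ltW dd)// mulr_ge0 ?lilscale_ge0// ltW.
  apply: (@le_trans _ _ (pr P C * expR (- ((2^-1 + 3 * d) * (x k ^+ 2 / ((n k)%:R * s2)))))).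
    by rewrite ler_wpM2l ?pr_ge0// yE// hk3.
  have -> : A k = [set w | (1 - d) * x k <= psum X f (q ^ k) (n k) w].
    by rewrite /A /x mulrCA divff ?mulr1// gt_eqF.
  apply: hT => //.
    rewrite ler_pdivrMr ?mulr_gt0// /x ler_pdivrMr// nE.
    have := ht0 _ h1; rewrite mulrAC ler_pdivlMr// mulrC => /le_trans; apply.
    by rewrite le_eqVlt; apply/orP; left; apply/eqP; ring.
  have h4 : 0 < 2^-1 + 3 * d by lra.
  rewrite -(ler_pM2l h4) yE// mulrC.
  by move: h3; rewrite ler_pdivrMr// [_ * gamma]mulrC.
apply: (@ae_frequently_in _ _ _ P A (maxn k1 (maxn k2 k3))) => // m j hm.
suff : past P X (q ^ (m + j)) (\big[setI/setT]_(m <= k < m + j) ~` A k) /\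
   pr P (\big[setI/setT]_(m <= k < m + j) ~` A k) <=
   \prod_(m <= k < m + j) (1 - k.+1%:R^-1) by case.
elim: j => [|j [IH1 IH2]].
  rewrite addn0 !big_geq// prT; split=> //.
  have := past_psum mX f (q ^ m) (fun=> True) (past_setT uX).
  by rewrite add0n (_ : _ `&` _ = setT)//; apply/seteqP; split.
rewrite addnS !big_nat_recr ?leq_addr//=; split.
  have := past_psum mX f (n (m + j)) (fun z => ~ (c * lilscale (q%:R ^+ (m + j).+1) <= z)) IH1.
  by rewrite subnKC// leq_exp2l.
have mC : measurable (\big[setI/setT]_(m <= k < m + j) ~` A k) by case: IH1.
rewrite prD//; apply: (@le_trans _ _ (pr P (\big[setI/setT]_(m <= k < m + j) ~` A k) * (1 - (m + j).+1%:R^-1))).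
  rewrite mulrBr mulr1 lerD2l lerN2 hA//.
  by apply: leq_trans hm _; rewrite leq_addr.
by rewrite ler_wpM2r// subr_ge0 invf_le1 ?ltr0n// ler1n.
Qed.

End UniformProcessLIL.

(** * Independence as a product rule for real probabilities *)

Section Independence.
Context (R : realType) (disp : measure_display) (T : measurableType disp)
  (P : probability T R).

Lemma independent_seq (I : choiceType) (F : I -> set_system T) (s : seq I)
    (A : I -> set T) : independent P F -> uniq s ->
  (forall i, i \in s -> F i (A i)) -> (forall i, i \in s -> measurable (A i)) ->
  pr P (\bigcap_(i in [set` s]) A i) = \prod_(i <- s) pr P (A i).
Proof.
move=> iF us FA mA; pose J := [fset i in s]%fset.
have Js : enum_fset J =i s by move=> i; rewrite in_fset.
have := iF J A; rewrite (_ : [set` J] = [set` s]); last first.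
  by apply/seteqP; split => i /=; rewrite Js.
move=> h; have {h} : (P (\bigcap_(i in [set` s]) A i) = \prod_(i <- J) P (A i))%E.
  by apply: h => i; rewrite Js; exact: FA.
rewrite (perm_big s) /=; last by apply: uniq_perm => //; exact: fset_uniq.
rewrite /pr => ->.
elim: s {us J Js FA} mA => [|i s IH] mA; first by rewrite !big_nil.
have mi : measurable (A i) by apply: mA; rewrite mem_head.
have ms j : j \in s -> measurable (A j) by move=> js; apply: mA; rewrite inE js orbT.
rewrite !big_cons -(IH ms) fineM ?fin_num_measure//.
rewrite big_seq prode_fin_num// => j js; rewrite fin_num_measure//; exact: ms.
Qed.

Lemma independent_pair (I : choiceType) (F : I -> set_system T) (i j : I) (A B : set T) :
  independent P F -> i != j -> F i A -> F j B -> measurable A -> measurable B ->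
  pr P (A `&` B) = pr P A * pr P B.
Proof.
move=> iF ij FA FB mA mB; pose C k := if k == i then A else B.
have Ci : C i = A by rewrite /C eqxx.
have Cj : C j = B by rewrite /C eq_sym (negbTE ij).
have := @independent_seq I F [:: i; j] C iF.
rewrite big_cons big_seq1 Ci Cj => <-.
- by congr (pr P _); rewrite bigcap_seq !big_cons big_nil setIT Ci Cj.
- by rewrite /= inE ij.
- by move=> k; rewrite !inE => /orP[/eqP ->|/eqP ->]; rewrite ?Ci ?Cj.
- by move=> k; rewrite !inE => /orP[/eqP ->|/eqP ->]; rewrite ?Ci ?Cj.
Qed.

Lemma sigma_of_sub_measurable (U I : Type) (D : set I) (E : set_system U)
    (X : I -> T -> U) :
  (forall i B, D i -> E B -> measurable (X i @^-1` B)) ->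
  sigma_of D E X `<=` measurable.
Proof.
move=> h; apply: smallest_sub; first exact: sigma_algebra_measurable.
by move=> A [i Di [B EB <-]]; rewrite setTI; exact: h.
Qed.

Lemma sigma_of_preimage (U I : Type) (D : set I) (E : set_system U)
    (X : I -> T -> U) i B : D i -> E B -> sigma_of D E X (X i @^-1` B).
Proof.
move=> Di EB; apply: sub_gen_smallest; exists i => //.
by exists B => //; rewrite setTI.
Qed.

End Independence.

(** * Coding the steps of one walk by letters *)

Section WalkAlphabet.
Context (R : realType) (d : nat).

Definition unit_step (u : 'I_d * bool) : 'rV[int]_d := (-1) ^+ u.2 *: delta_mx 0 u.1.

Lemma unit_step_inj : injective unit_step.
Proof.
move=> [k b] [l c] /matrixP /(_ 0); rewrite /unit_step /=.
have [<-{l}|kl] := eqVneq k l => h.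
  by move: (h k); rewrite !mxE !eqxx; case: b {h}; case: c.
move: (h k); rewrite !mxE !eqxx (negbTE kl) mulr0.
by case: b {h}.
Qed.

Context (u0 : 'I_d * bool).

(** [u0] is the default letter for vectors other than unit steps, which occur with probability 0. *)
Definition letter (x : 'rV[int]_d) : 'I_d * bool :=
  odflt u0 [pick u | unit_step u == x].

Lemma letterK u : letter (unit_step u) = u.
Proof.
rewrite /letter; case: pickP => [v /eqP /unit_step_inj -> //|/(_ u)].
by rewrite eqxx.
Qed.

Context (disp : measure_display) (T : measurableType disp)
  (P : probability T R).
Variables (S : nat -> T -> 'rV[int]_d) (X : nat -> T -> 'rV[int]_d).
Hypothesis mX : forall k (B : set 'rV[int]_d), measurable (X k @^-1` B).
Hypothesis iX : independent P (fun k : nat => preimage_set_system setT (X k) setT).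
Hypothesis pX : forall k (j : 'I_d),
  P (X k @^-1` [set delta_mx 0 j]) = ((2 * d%:R)^-1)%:E /\
  P (X k @^-1` [set - delta_mx 0 j]) = ((2 * d%:R)^-1)%:E.
Hypothesis SX : forall n w, S n w = \sum_(k < n) X k w.

Let d0 : (0 < d)%N.
Proof. by case: u0 => -[k kd] _; exact: leq_ltn_trans kd. Qed.

Let letters k u : set T := [set w | letter (X k w) = u].

Let mletters k u : measurable (letters k u).
Proof. exact: (mX k [set x | letter x = u]). Qed.

Let pr_unit_step k u : pr P (X k @^-1` [set unit_step u]) = (2 * d%:R)^-1.
Proof.
rewrite /pr /unit_step; case: u => j [] /=; have [h1 h2] := pX k j.
  by rewrite expr1 scaleN1r h2.
by rewrite expr0 scale1r h1.
Qed.

Let sum_cst : \sum_(u : 'I_d * bool) (2 * d%:R)^-1 = 1 :> R.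
Proof.
rewrite sumr_const card_prod card_ord card_bool -[_ *+ _]mulr_natl natrM.
by rewrite mulrC [d%:R * _]mulrC mulVf// mulf_neq0// pnatr_eq0 -?lt0n.
Qed.

(** The 2d unit steps have total probability 1, which leaves a null set for all other values. *)
Lemma ae_unit_step : {ae P, forall w, forall k, X k w = unit_step (letter (X k w))}.
Proof.
apply: ae_foralln => k.
pose A := \big[setU/set0]_(u <- enum {: 'I_d * bool}) X k @^-1` [set unit_step u].
have mA : measurable A by apply: bigsetU_measurable => u _; exact: mX.
have pA : pr P A = 1.
  rewrite (pr_partition (X := letter \o X k) P mA (mletters k)) -sum_cst.
  apply: eq_bigr => u _; rewrite -(pr_unit_step k u); congr (pr P _).
  rewrite /A -bigcup_seq; apply/seteqP; split => w /=.
    by move=> [[v _ /= ->]]; rewrite letterK => ->.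
  have hu : u \in enum {: 'I_d * bool} by rewrite mem_enum.
  by move=> xu; split; [exists u|rewrite xu letterK].
exists (~` A); split; first exact: measurableC.
  apply: (etrans (prE P (measurableC mA))); congr EFin.
  by have := prD P measurableT mA; rewrite !setTI prT pA subrr.
move=> w /= nw Aw; apply: nw; move: Aw; rewrite /A -bigcup_seq => -[u _ /= ->].
by rewrite letterK.
Qed.

(** The default letter can only enlarge an event. Each one has probability at least 1/(2d) and the
    total is 1, so equality holds throughout. *)
Let pr_letters k u : pr P (letters k u) = (2 * d%:R)^-1.
Proof.
have ge v : (2 * d%:R)^-1 <= pr P (letters k v).
  rewrite -(pr_unit_step k v); apply: le_pr; [exact: mX|exact: mletters|].
  by move=> w xv; rewrite /letters /= xv letterK.
have sum1 : \sum_v pr P (letters k v) = 1.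
  rewrite -(prT P) (pr_partition (X := letter \o X k) P measurableT (mletters k)).
  by apply: eq_bigr => v _; rewrite setTI.
apply/eqP; rewrite eq_le ge andbT -subr_ge0.
have : \sum_(v | v != u) (2 * d%:R)^-1 <= \sum_(v | v != u) pr P (letters k v).
  by apply: ler_sum => v _; exact: ge.
move: sum1 sum_cst; rewrite (bigD1 u)//= => e1; rewrite (bigD1 u)//= => e2.
by move: e1 e2; move: (\sum_(v | _) _) (\sum_(v | _) _) => a b; lra.
Qed.

Lemma pr_letters_cylinder n (u : nat -> 'I_d * bool) :
  pr P [set w | forall k, (k < n)%N -> letter (X k w) = u k] = ((2 * d%:R)^-1) ^+ n.
Proof.
have := @independent_seq R disp T P _ _ (iota 0 n) (fun k => letters k (u k)) iX (iota_uniq _ _).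
rewrite (_ : [set` iota 0 n] = [set k | (k < n)%N]); last first.
  by apply/seteqP; split => k /=; rewrite mem_iota.
under eq_bigr do rewrite pr_letters.
rewrite big_const_seq count_predT size_iota iter_mulr_1 => <- // k _.
by exists [set x | letter x = u k] => //; rewrite setTI.
Qed.

(** Independence of the walks is stated for positions, so a step has to be read off as a difference
    of consecutive positions; a letter event is then a countable union over pairs of lattice
    points. *)
Lemma sigma_of_letters_cylinder n (u : nat -> 'I_d * bool) :
  sigma_of [set: nat] setT S [set w | forall k, (k < n)%N -> letter (X k w) = u k].
Proof.
pose G := \bigcup_(i in [set: nat]) preimage_set_system setT (S i) setT.
pose T' := g_sigma_algebraType G.
suff : measurable ([set w | forall k, (k < n)%N -> letter (X k w) = u k] : set T') by [].
have mS k x : measurable (S k @^-1` [set x] : set T').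
  exact: (@sigma_of_preimage _ _ _ _ _ _ S k [set x]).
have XE k w : X k w = S k.+1 w - S k w.
  by rewrite !SX big_ord_recr /= addrAC subrr add0r.
have mk k : measurable ([set w | letter (X k w) = u k] : set T').
  rewrite (_ : [set w | _] = \bigcup_(p : 'rV[int]_d * 'rV[int]_d)
     (S k.+1 @^-1` [set p.1] `&` S k @^-1` [set p.2] `&`
      [set w | letter (p.1 - p.2) = u k])); last first.
    apply/seteqP; split => w /=; rewrite XE; first by move=> h; exists (S k.+1 w, S k w).
    by move=> [[a b] _ /= [[-> ->]]].
  apply: countable_bigcupT_measurable => [|p]; first exact: countableP.
  apply: (@measurableI _ T'); first by apply: (@measurableI _ T').
  have [e|e] := pselect (letter (p.1 - p.2) = u k).
    by rewrite (_ : [set w | _] = setT); [exact: measurableT|apply/seteqP; split].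
  by rewrite (_ : [set w | _] = set0); [exact: measurable0|apply/seteqP; split].
rewrite (_ : [set w | _] = \bigcap_(k in [set k | (k < n)%N])
   [set w | letter (X k w) = u k]); last by apply/seteqP; split => w /= h k /h.
have [->|n0] := posnP n.
  by rewrite (_ : [set k | _] = set0) ?bigcap_set0; [exact: measurableT|apply/seteqP; split].
by apply: (@bigcap_measurable _ T'); [exists 0%N|move=> k _; exact: mk].
Qed.

End WalkAlphabet.

(** * Two independent walks as one uniform process on pairs of letters *)

Section WalkPair.
Context (R : realType) (d : nat) (d0 : (0 < d)%N) (disp : measure_display)
  (T : measurableType disp) (P : probability T R).
Variables S1 S2 : nat -> T -> 'rV[int]_d.

Lemma walk_pair_uniform : simple_random_walk P S1 -> simple_random_walk P S2 ->
  (forall A B, sigma_of [set: nat] setT S1 A -> sigma_of [set: nat] setT S2 B ->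
    measurable A -> measurable B -> pr P (A `&` B) = pr P A * pr P B) ->
  exists Y : nat -> T -> ('I_d * bool) * ('I_d * bool),
    [/\ forall k v, measurable (Y k @^-1` [set v]),
        forall n u, pr P (cylinder Y 0 n u) =
          (#|{: ('I_d * bool) * ('I_d * bool)}|%:R^-1) ^+ n
      & {ae P, forall w, forall n, S1 n w - S2 n w =
          \sum_(k < n) (unit_step (Y k w).1 - unit_step (Y k w).2)}].
Proof.
move=> [X1 [mX1 iX1 pX1 SX1]] [X2 [mX2 iX2 pX2 SX2]] ind.
pose u0 : 'I_d * bool := (Ordinal d0, false).
pose L := letter u0.
exists (fun k w => (L (X1 k w), L (X2 k w))); split.
- move=> k [v1 v2].
  rewrite (_ : _ @^-1` _ = X1 k @^-1` [set x | L x = v1] `&` X2 k @^-1` [set x | L x = v2]).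
    by apply: measurableI.
  by apply/seteqP; split => w /= [-> ->].
- move=> n u; pose A1 := [set w | forall k, (k < n)%N -> L (X1 k w) = (u k).1].
  pose A2 := [set w | forall k, (k < n)%N -> L (X2 k w) = (u k).2].
  have s1 : sigma_of [set: nat] setT S1 A1 by exact: sigma_of_letters_cylinder.
  have s2 : sigma_of [set: nat] setT S2 A2 by exact: sigma_of_letters_cylinder.
  have mS (S X : nat -> T -> 'rV[int]_d) : (forall n w, S n w = \sum_(k < n) X k w) ->
      (forall k (B : set 'rV[int]_d), measurable (X k @^-1` B)) ->
      sigma_of [set: nat] setT S `<=` measurable.
    move=> SX mX; apply: sigma_of_sub_measurable => i B _ _.
    elim: i B => [|i IH] B.
      have -> : S 0%N @^-1` B = [set w | B 0].
        by apply/seteqP; split => w /=; rewrite SX big_ord0.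
      have [e|e] := pselect (B 0).
        by rewrite (_ : [set w | _] = setT)//; apply/seteqP; split.
      by rewrite (_ : [set w | _] = set0)//; apply/seteqP; split.
    rewrite (_ : _ @^-1` _ = \bigcup_(p : 'rV[int]_d)
       (S i @^-1` [set p] `&` X i @^-1` [set x | B (p + x)])).
      apply: countable_bigcupT_measurable => [|p]; first exact: countableP.
      exact: measurableI.
    have SS w : S i.+1 w = S i w + X i w by rewrite !SX big_ord_recr.
    apply/seteqP; split => w /=; rewrite SS; first by move=> h; exists (S i w).
    by move=> [p _ /= [->]].
  have -> : cylinder (fun k w => (L (X1 k w), L (X2 k w))) 0 n u = A1 `&` A2.
    apply/seteqP; split => w /=.
      by move=> h; split => k /h; rewrite add0n => <-.
    by move=> [h1 h2] k kn; rewrite add0n h1// h2//; case: (u k).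
  rewrite ind//; [|exact: mS SX1 mX1 _ s1|exact: mS SX2 mX2 _ s2].
  rewrite /A1 /A2 (pr_letters_cylinder u0 mX1 iX1 pX1) (pr_letters_cylinder u0 mX2 iX2 pX2).
  rewrite -exprMn -invfM; congr (_^-1 ^+ _).
  rewrite !card_prod card_ord card_bool !natrM; ring.
- have h1 := ae_unit_step u0 mX1 pX1; have h2 := ae_unit_step u0 mX2 pX2.
  apply: filterS2 h1 h2 => w h1 h2 n; rewrite SX1 SX2 -sumrB.
  by apply: eq_bigr => k _ /=; rewrite {1}h1 {1}h2.
Qed.

End WalkPair.

(** * Euclidean norm, integer directions, limits superior of ratios *)

Section EuclideanNorm.
Context (R : realType).

Lemma sqr_enorm d (x : 'rV[R]_d) : enorm x ^+ 2 = \sum_(k < d) x 0 k ^+ 2.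
Proof. by rewrite sqr_sqrtr// sumr_ge0// => k _; exact: sqr_ge0. Qed.

Lemma enorm_ge0 d (x : 'rV[R]_d) : 0 <= enorm x.
Proof. exact: sqrtr_ge0. Qed.

Lemma le_coord_enorm d (x : 'rV[R]_d) k : `|x 0 k| <= enorm x.
Proof.
rewrite -sqrtr_sqr ler_wsqrtr// (bigD1 k)//= lerDl.
by apply: sumr_ge0 => j _; exact: sqr_ge0.
Qed.

(** Ordinals up to 2M, shifted by M, stand for the integers from -M to M, so that the directions
    form a finite type. *)
Definition grid_vec M d (a : {ffun 'I_d -> 'I_(2 * M).+1}) (k : 'I_d) : R :=
  (a k)%:R - M%:R.

(* [a] rounds [M *: x / enorm x] towards 0, which changes each coordinate by at most 1. *)
Lemma direction_net M d (x : 'rV[R]_d) : (0 < d)%N ->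
  exists a : {ffun 'I_d -> 'I_(2 * M).+1},
    \sum_k grid_vec a k ^+ 2 <= M%:R ^+ 2 /\
    (M%:R - d%:R) * enorm x <= \sum_k grid_vec a k * x 0 k.
Proof.
move=> d0; pose N := enorm x.
have [N0|Npos] := eqVneq N 0.
  pose a : {ffun 'I_d -> 'I_(2 * M).+1} := [ffun=> inord M].
  exists a; have a0 k : grid_vec a k = 0.
    by rewrite /grid_vec ffunE inordK ?subrr// ltnS mul2n -addnn leq_addr.
  rewrite -/N N0 mulr0 !big1 ?sqr_ge0//; first by move=> k _; rewrite a0 mul0r.
  by move=> k _; rewrite a0 expr0n.
have {}Npos : 0 < N by rewrite lt_def Npos enorm_ge0.
pose y k := M%:R * `|x 0 k| / N.
have y0 k : 0 <= y k by rewrite divr_ge0 ?mulr_ge0 ?enorm_ge0.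
have yM k : y k <= M%:R.
  by rewrite ler_pdivrMr// ler_wpM2l// le_coord_enorm.
pose t k := Num.truncn (y k).
have tM k : (t k <= M)%N.
  by rewrite -(ler_nat R) (le_trans _ (yM k))// Num.Theory.truncn_le.
pose a : {ffun 'I_d -> 'I_(2 * M).+1} :=
  [ffun k => inord (if 0 <= x 0 k then (M + t k)%N else (M - t k)%N)].
exists a; have aE k : grid_vec a k = (if 0 <= x 0 k then 1 else -1) * (t k)%:R.
  rewrite /grid_vec ffunE; case: ifP => _; rewrite inordK.
  - by rewrite natrD addrAC subrr add0r mul1r.
  - by rewrite ltnS mul2n -addnn leq_add2l.
  - by rewrite natrB// addrAC subrr add0r mulN1r.
  - by rewrite ltnS mul2n -addnn (leq_trans (leq_subr _ _))// leq_addr.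
split.
  apply: (@le_trans _ _ (\sum_k y k ^+ 2)).
    apply: ler_sum => k _; rewrite aE exprMn.
    rewrite (_ : _ ^+ 2 * _ = (t k)%:R ^+ 2); last by case: ifP; rewrite ?sqrrN expr1n mul1r.
    by rewrite lerXn2r// ?nnegrE// Num.Theory.truncn_le.
  rewrite (eq_bigr (fun k => (M%:R / N) ^+ 2 * x 0 k ^+ 2)); last first.
    by move=> k _; rewrite /y mulrAC exprMn real_normK ?num_real.
  by rewrite -big_distrr /= -sqr_enorm -exprMn -/N divfK// gt_eqF.
have tx k : y k * `|x 0 k| - N <= grid_vec a k * x 0 k.
  rewrite aE [leRHS](_ : _ = (t k)%:R * `|x 0 k|); last first.
    by case: ifP => h; [rewrite mul1r ger0_norm|rewrite mulN1r mulNr -mulrN ltr0_norm// ltNge h].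
  have h : y k - 1 <= (t k)%:R by have := Num.Theory.truncnS_gt (y k); rewrite -natr1 -/(t k); lra.
  apply: (@le_trans _ _ ((y k - 1) * `|x 0 k|)); last by rewrite ler_wpM2r.
  by rewrite mulrBl mul1r lerB ?le_coord_enorm.
apply: le_trans (ler_sum _ (fun k _ => tx k)).
rewrite sumrB sumr_const card_ord.
rewrite (eq_bigr (fun k => M%:R / N * x 0 k ^+ 2)); last first.
  by move=> k _; rewrite /y -[x 0 k ^+ 2]real_normK ?num_real//; ring.
rewrite -big_distrr /= -sqr_enorm -/N.
have -> : M%:R / N * N ^+ 2 = M%:R * N by field; rewrite gt_eqF.
by rewrite mulrBl [d%:R * _]mulr_natl.
Qed.

Lemma limf_esup_ratio (X : choiceType) (Y : filteredType X) (F : set_system Y)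
    {FF : Filter F} (D phi : Y -> R) (c : R) : 0 < c ->
  (\forall y \near F, 0 < phi y) ->
  (forall e, c < e -> \forall y \near F, D y <= e * phi y) ->
  (forall e, 0 < e -> e < c -> ~ \forall y \near F, D y < e * phi y) ->
  limf_esup (fun y => (D y / phi y)%:E) F = c%:E.
Proof.
move=> c0 hphi hu hl; apply: limf_esup_eq => e e0.
  have h := hu (c + e); rewrite ltrDl in h; have {}h := h e0.
  by apply: filterS2 hphi h => y p0 h; rewrite ler_pdivrMr.
(* [c / 2] keeps the level positive when [c - e] is not. *)
move=> h; pose e' := Num.max (c - e) (c / 2).
apply: (hl e'); rewrite ?lt_max ?gt_max ?divr_gt0 ?orbT//.
  by rewrite gtrBl e0 /=; lra.
apply: filterS2 hphi h => y p0; rewrite ltr_pdivrMr// => /lt_le_trans; apply.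
by rewrite ler_pM2r// le_max lexx.
Qed.

(** From t to q t the scale grows at least by sqrt q; this makes the position at time q^k negligible
    at time q^(k+1). *)
Lemma le_lilscale_mul (q t : R) : 1 <= q -> expR 1 <= t ->
  lilscale t <= lilscale (q * t) / Num.sqrt q.
Proof.
move=> q1 t1; have q0 : 0 < q := lt_le_trans ltr01 q1.
have t0 : 0 < t by apply: lt_le_trans t1; exact: expR_gt0.
rewrite ler_pdivlMr ?sqrtr_gt0// -sqrtrM; last first.
  by rewrite mulr_ge0 ?lnln_ge0// ltW.
apply: ler_wsqrtr; rewrite [leLHS]mulrC mulrA.
apply: ler_wpM2l; first by rewrite mulr_ge0// ltW.
by rewrite le_lnln// ler_peMl// ltW.
Qed.

End EuclideanNorm.

Arguments grid_vec {R M d} a k.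

(** * Upper and lower bounds for the distance of two walks *)

Section WalkPairLIL.
Context (R : realType) (d : nat) (d0 : (0 < d)%N).

Let letter2 : finType := (('I_d * bool) * ('I_d * bool))%type.

(** The scalar product of [a] with the difference of the two coded unit steps. *)
Definition step_form (a : 'I_d -> R) (v : ('I_d * bool) * ('I_d * bool)) : R :=
  (-1) ^+ v.1.2 * a v.1.1 - (-1) ^+ v.2.2 * a v.2.1.

Let dR : d%:R != 0 :> R.
Proof. by rewrite pnatr_eq0 -lt0n. Qed.

Let card2 : #|letter2|%:R = (2 * d%:R) ^+ 2 :> R.
Proof. by rewrite !card_prod card_ord card_bool !natrM; ring. Qed.

Let sum_signed (a : 'I_d -> R) : \sum_(u : 'I_d * bool) (-1) ^+ u.2 * a u.1 = 0.
Proof.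
rewrite -(pair_bigA _ (fun k (b : bool) => (-1) ^+ b * a k)) /=.
by apply: big1 => k _; rewrite big_bool /= expr1 expr0 mulN1r mul1r addNr.
Qed.

Let sum_signed_sqr (a : 'I_d -> R) :
  \sum_(u : 'I_d * bool) ((-1) ^+ u.2 * a u.1) ^+ 2 = 2 * \sum_k a k ^+ 2.
Proof.
rewrite -(pair_bigA _ (fun k (b : bool) => ((-1) ^+ b * a k) ^+ 2)) /=.
rewrite big_distrr /=; apply: eq_bigr => k _.
by rewrite big_bool /= expr1 expr0 mulN1r mul1r sqrrN mulr_natl.
Qed.

Lemma avg_step_form (a : 'I_d -> R) : avg (step_form a) = 0.
Proof.
rewrite /avg (_ : \sum_v _ = 0) ?mulr0// /step_form sumrB.
rewrite -(pair_bigA _ (fun (u _ : 'I_d * bool) => (-1) ^+ u.2 * a u.1)) /=.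
rewrite -(pair_bigA _ (fun (_ u : 'I_d * bool) => (-1) ^+ u.2 * a u.1)) /=.
rewrite exchange_big /= [X in X - _]big1; last by move=> u _; exact: sum_signed.
by rewrite big1 ?subrr// => u _; exact: sum_signed.
Qed.

(** The two steps are independent and centred, so the cross term vanishes and each contributes |a|^2
    / d. *)
Lemma avg_sqr_step_form (a : 'I_d -> R) :
  avg (fun v => step_form a v ^+ 2) = 2 / d%:R * \sum_k a k ^+ 2.
Proof.
pose g (u : 'I_d * bool) : R := (-1) ^+ u.2 * a u.1.
have E : \sum_v step_form a v ^+ 2 = 2 * (2 * d%:R) * \sum_u g u ^+ 2.
  rewrite -(pair_bigA _ (fun u u' => (g u - g u') ^+ 2)) /=.
  have cU (x : R) : \sum_(u : 'I_d * bool) x = 2 * d%:R * x.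
    by rewrite sumr_const card_prod card_ord card_bool -[x *+ _]mulr_natl natrM [d%:R * _]mulrC.
  transitivity (\sum_u (2 * d%:R * g u ^+ 2 + \sum_u' g u' ^+ 2)).
    apply: eq_bigr => u _.
    rewrite (eq_bigr (fun u' => g u ^+ 2 + ((-2 * g u) * g u' + g u' ^+ 2))).
      by rewrite !big_split /= cU -big_distrr /= sum_signed mulr0 add0r.
    by move=> u' _; ring.
  by rewrite big_split /= cU -big_distrr /=; ring.
rewrite /avg E sum_signed_sqr card2; field; exact: dR.
Qed.

Lemma step_form_sum (a : 'I_d -> R) v :
  \sum_k a k * ((unit_step v.1 - unit_step v.2) 0 k)%:~R = step_form a v.
Proof.
have one (u : 'I_d * bool) : \sum_k a k * (unit_step u 0 k)%:~R = (-1) ^+ u.2 * a u.1.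
  rewrite (bigD1 u.1)//= big1 ?addr0.
    by rewrite !mxE !eqxx mulr1 rmorphXn /= rmorphN1 mulrC.
  by move=> k ku; rewrite !mxE (negbTE ku) andbF /= !(mulr0, mulr0z).
rewrite /step_form -!one -sumrB; apply: eq_bigr => k _.
by rewrite -mulrBr -rmorphB !mxE.
Qed.

Context (disp : measure_display) (T : measurableType disp) (P : probability T R).
Variables S1 S2 : nat -> T -> 'rV[int]_d.
Hypotheses (hS1 : simple_random_walk P S1) (hS2 : simple_random_walk P S2).
Hypothesis ind : forall A B,
  sigma_of [set: nat] setT S1 A -> sigma_of [set: nat] setT S2 B ->
  measurable A -> measurable B -> pr P (A `&` B) = pr P A * pr P B.

Let Z n w : 'rV[R]_d :=
  map_mx (fun z : int => z%:~R) (S1 n w) - map_mx (fun z : int => z%:~R) (S2 n w).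

Let Z_psum (Y : nat -> T -> ('I_d * bool) * ('I_d * bool)) w :
  (forall n, S1 n w - S2 n w =
     \sum_(k < n) (unit_step (Y k w).1 - unit_step (Y k w).2)) ->
  forall (a : 'I_d -> R) n, \sum_k a k * Z n w 0 k = psum Y (step_form a) 0 n w.
Proof.
move=> h a n; rewrite /psum.
rewrite (eq_bigr (fun k => \sum_(t < n) a k *
    ((unit_step (Y t w).1 - unit_step (Y t w).2) 0 k)%:~R)); last first.
  move=> k _; rewrite -big_distrr /=; congr (_ * _).
  rewrite -(rmorph_sum intr) /= -summxE -h !mxE.
  by rewrite rmorphB.
rewrite exchange_big /=; apply: eq_bigr => t _; rewrite add0n.
exact: step_form_sum.
Qed.

Let card20 : (0 < #|letter2|)%N.
Proof. by rewrite !card_prod card_ord card_bool !muln_gt0 d0. Qed.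

Let sd0 : 0 < Num.sqrt d%:R :> R.
Proof. by rewrite sqrtr_gt0 ltr0n. Qed.

Let sqr_sd : Num.sqrt d%:R ^+ 2 = d%:R :> R.
Proof. by rewrite sqr_sqrtr. Qed.

Lemma walk_pair_upper c : 2 / Num.sqrt d%:R < c ->
  {ae P, forall w, exists n0, forall n, (n0 <= n)%N ->
    enorm (Z n w) <= c * lilscale n%:R}.
Proof.
move=> hc; have [Y [mY uY YS]] := walk_pair_uniform d0 hS1 hS2 ind.
pose s := 2 / Num.sqrt d%:R : R.
have s0 : 0 < s by rewrite divr_gt0.
have c0 : 0 < c := lt_trans s0 hc.
have cs : 0 < c - s by rewrite subr_gt0.
(* Chosen so that s M < c (M - d). A grid direction of length at most M has one-dimensional constant
   at most s M, and by [direction_net] the level c (M - d) in all these directions gives c for the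
   norm. *)
pose M := (Num.truncn (c * d%:R / (c - s))).+1.
have hM : c * d%:R < M%:R * (c - s).
  by rewrite -ltr_pdivrMr// Num.Theory.truncnS_gt.
have Md : d%:R < M%:R :> R.
  rewrite -(ltr_pM2l c0); apply: (lt_le_trans hM).
  by rewrite [leRHS]mulrC ler_wpM2l// gerBl ltW.
have M0 : 0 < M%:R :> R by rewrite ltr0n.
have Md0 : 0 < M%:R - d%:R :> R by rewrite subr_gt0.
pose c1 := c * (M%:R - d%:R).
have c10 : 0 < c1 by rewrite mulr_gt0.
pose s2 := 2 / d%:R * M%:R ^+ 2 : R.
have s20 : 0 < s2 by rewrite mulr_gt0 ?divr_gt0 ?exprn_gt0// ltr0n.
have hc1 : 2 * s2 < c1 ^+ 2.
  have h1 : s * M%:R < c1 by rewrite /c1; move: hM; lra.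
  have -> : 2 * s2 = (s * M%:R) ^+ 2.
    rewrite /s2 /s; move: (Num.sqrt d%:R) sqr_sd sd0 => r <- r0.
    by field; rewrite gt_eqF.
  by rewrite ltrXn2r// ?nnegrE ?(ltW c10)// mulr_ge0// ltW.
pose A := {ffun 'I_d -> 'I_(2 * M).+1}.
(* Grid directions longer than M are kept with a vacuous condition, so that the quantifier ranges
   over a finite type. *)
have H (a : A) : {ae P, forall w, \sum_k @grid_vec R M d a k ^+ 2 <= M%:R ^+ 2 ->
    exists n0, forall n, (n0 <= n)%N ->
    psum Y (step_form (grid_vec a)) 0 n w <= c1 * lilscale n%:R}.
  have [h|h] := pselect (\sum_k @grid_vec R M d a k ^+ 2 <= M%:R ^+ 2); last first.
    by apply: nearW => w.
  have hf : avg (fun v => step_form (grid_vec a) v ^+ 2) <= s2.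
    by rewrite avg_sqr_step_form ler_wpM2l// divr_ge0.
  have := psum_lil_upper mY uY card20 (avg_step_form (grid_vec a)) hf s20 c10 hc1.
  by apply: filterS.
have H' : {ae P, forall w, forall a : A, \sum_k @grid_vec R M d a k ^+ 2 <= M%:R ^+ 2 ->
    exists n0, forall n, (n0 <= n)%N ->
    psum Y (step_form (grid_vec a)) 0 n w <= c1 * lilscale n%:R}.
  by apply: filter_forall => a; exact: H.
apply: filterS2 H' YS => w hw hY.
have /choice[n0 hn0] : forall a : A, exists n0, \sum_k @grid_vec R M d a k ^+ 2 <= M%:R ^+ 2 ->
    forall n, (n0 <= n)%N -> psum Y (step_form (grid_vec a)) 0 n w <= c1 * lilscale n%:R.
  move=> a; have [h|h] := pselect (\sum_k @grid_vec R M d a k ^+ 2 <= M%:R ^+ 2).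
    by have [n0 hn0] := hw a h; exists n0.
  by exists 0%N.
exists (\max_a n0 a)%N => n hn.
have [a [ha1 ha2]] := direction_net M (Z n w) d0.
rewrite -(ler_pM2l Md0); apply: (le_trans ha2).
rewrite (Z_psum hY) mulrA [_ * c]mulrC; apply: hn0 => //.
by apply: leq_trans hn; exact: leq_bigmax.
Qed.

(** One coordinate already reaches the constant: the difference has variance 2n/d in every unit
    direction. *)
Lemma walk_pair_lower c : 0 < c -> c < 2 / Num.sqrt d%:R ->
  {ae P, forall w, forall n0, exists2 n, (n0 <= n)%N &
    c * lilscale n%:R <= enorm (Z n w)}.
Proof.
move=> c0 hc; have [Y [mY uY YS]] := walk_pair_uniform d0 hS1 hS2 ind.
pose s := 2 / Num.sqrt d%:R : R.
have s0 : 0 < s by rewrite divr_gt0.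
pose c1 := (c + s) / 2.
have c1c : c < c1 by rewrite /c1 -/s in hc *; lra.
have c1s : c1 < s by rewrite /c1 -/s in hc *; lra.
have c10 : 0 < c1 := lt_trans c0 c1c.
have dc : 0 < c1 - c by rewrite subr_gt0.
(* A constant above [s] bounds the position at time q^k; [q] is chosen with C / sqrt q <= c1 - c, so
   that this position costs no more than the gap between [c1] and [c]. *)
pose C := s + 1.
have C0 : 0 < C by rewrite addr_gt0.
have sC : s < C by rewrite ltrDl.
pose k0 : 'I_d := Ordinal d0.
pose a k : R := (k == k0)%:R.
have a2 : \sum_k a k ^+ 2 = 1.
  rewrite (bigD1 k0)//= /a eqxx big1 ?expr1n ?addr0// => k /negbTE ->.
  by rewrite expr0n.
have fs : avg (fun v => step_form a v ^+ 2) = 2 / d%:R.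
  by rewrite avg_sqr_step_form a2 mulr1.
have s20 : 0 < 2 / d%:R :> R by rewrite divr_gt0// ltr0n.
have hc1 : c1 ^+ 2 < 2 * (2 / d%:R).
  have -> : 2 * (2 / d%:R) = s ^+ 2.
    rewrite /s; move: (Num.sqrt d%:R) sqr_sd sd0 => r <- r0.
    by field; rewrite gt_eqF.
  by rewrite ltrXn2r// ?nnegrE ?ltW.
have [q0 hq0] := psum_increments_frequently mY uY card20 (avg_step_form a) fs s20 c10 hc1.
pose q := maxn q0 (maxn 2 (Num.truncn ((C / (c1 - c)) ^+ 2)).+1).
have q00 : (q0 <= q)%N by rewrite leq_maxl.
have q2 : (2 <= q)%N by rewrite !leq_max leqnn orbT.
have q1 : (1 <= q)%N := ltnW q2.
have qR1 : 1 < q%:R :> R by rewrite ltr1n.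
have hq : C / Num.sqrt q%:R <= c1 - c.
  rewrite ler_pdivrMr ?sqrtr_gt0 ?ltr0n// mulrC -ler_pdivrMr//.
  rewrite -[leLHS]ger0_norm ?divr_ge0 ?(ltW C0) ?(ltW dc)// -sqrtr_sqr ler_wsqrtr//.
  apply: (le_trans (ltW (Num.Theory.truncnS_gt _))).
  by rewrite ler_nat !leq_max leqnn !orbT.
have H1 := hq0 q q00; have H2 := walk_pair_upper sC.
apply: (@filterS3 _ _ _ _ _ _ _ _ H1 H2 YS) => w hw [n1 hn1] hY n0.
have [k1 hk1] := exp_unbounded (Num.max (expR 1) (maxn n0 n1)%:R) qR1.
have [k kk hk] := hw k1.
have := hk1 k kk; rewrite ge_max => /andP[e1 hnk].
have nk : (maxn n0 n1 <= q ^ k)%N by rewrite -(ler_nat R) natrX.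
have qkk : (q ^ k <= q ^ k.+1)%N by rewrite leq_exp2l.
exists (q ^ k.+1)%N.
  by apply: leq_trans qkk; apply: leq_trans nk; rewrite leq_maxl.
have ZE n : Z n w 0 k0 = psum Y (step_form a) 0 n w.
  rewrite -(Z_psum hY) (bigD1 k0)//= /a eqxx mul1r big1 ?addr0// => j /negbTE ->.
  by rewrite mul0r.
have hinc : psum Y (step_form a) (q ^ k) (q ^ k.+1 - q ^ k) w = Z (q ^ k.+1)%N w 0 k0 - Z (q ^ k)%N w 0 k0.
  by rewrite !ZE -[in RHS](subnKC qkk) psumD add0n addrAC subrr add0r.
rewrite hinc -natrX in hk.
have h1 : enorm (Z (q ^ k)%N w) <= C * lilscale (q ^ k)%:R.
  by apply: hn1; apply: leq_trans nk; rewrite leq_maxr.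
have h2 : C * lilscale (q ^ k)%:R <= (c1 - c) * lilscale (q ^ k.+1)%:R.
  apply: (@le_trans _ _ (C * (lilscale (q%:R * (q ^ k)%:R) / Num.sqrt q%:R))).
    by rewrite ler_pM2l// le_lilscale_mul ?(ltW qR1)// natrX.
  rewrite -natrM -expnS mulrCA mulrC ler_wpM2r ?lilscale_ge0//.
have h3 := le_coord_enorm (Z (q ^ k)%N w) k0.
have h4 := le_coord_enorm (Z (q ^ k.+1)%N w) k0.
have h5 := ler_norm (Z (q ^ k.+1)%N w 0 k0).
have h6 := ler_norm (- Z (q ^ k)%N w 0 k0).
rewrite normrN in h6.
by move: hk h1 h2 h3 h4 h5 h6; lra.
Qed.

End WalkPairLIL.

(** * Maximum over pairs, and the law for walks *)

Section MaxDist.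
Context (R : realType).

Lemma max_dist_le K d (x : 'I_K -> 'rV[R]_d) C : 0 <= C ->
  (forall i j, i != j -> enorm (x i - x j) <= C) -> max_dist x <= C.
Proof. by move=> C0 h; apply: bigmax_le => // -[i j] /= /h. Qed.

Lemma le_max_dist K d (x : 'I_K -> 'rV[R]_d) i j : i != j ->
  enorm (x i - x j) <= max_dist x.
Proof.
by move=> ij; rewrite /max_dist (bigmaxD1 (i, j))//= le_max lexx.
Qed.

Context (disp : measure_display) (T : measurableType disp) (P : probability T R).

(** Countably many levels tending to [c] from both sides suffice, so the exceptional null sets can
    be united. The factor 1 - 1/(n+2), rather than 1 - 1/(n+1), keeps the lower levels positive. *)
Lemma ae_limf_esup_ratio (X : choiceType) (Y : filteredType X) (F : set_system Y)
    {FF : Filter F} (D : T -> Y -> R) (phi : Y -> R) (c : R) : 0 < c ->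
  (\forall y \near F, 0 < phi y) ->
  (forall e, c < e -> {ae P, forall w, \forall y \near F, D w y <= e * phi y}) ->
  (forall e, 0 < e -> e < c ->
    {ae P, forall w, ~ \forall y \near F, D w y < e * phi y}) ->
  {ae P, forall w, limf_esup (fun y => (D w y / phi y)%:E) F = c%:E}.
Proof.
move=> c0 hphi hu hl.
have archi (x : R) : 0 < x -> exists n : nat, n.+1%:R^-1 <= x.
  move=> x0; exists (Num.truncn x^-1).
  rewrite -[leRHS]invrK lef_pV2 ?posrE ?invr_gt0//.
  exact: ltW (Num.Theory.truncnS_gt _).
have Hu : {ae P, forall w, forall n, \forall y \near F, D w y <= (c + n.+1%:R^-1) * phi y}.
  by apply: ae_foralln => n; apply: hu; rewrite ltrDl invr_gt0 ltr0n.
have Hl : {ae P, forall w, forall n, ~ \forall y \near F, D w y < (c * (1 - n.+2%:R^-1)) * phi y}.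
  apply: ae_foralln => n; have h : n.+2%:R^-1 < 1 :> R by rewrite invf_lt1 ?ltr0n// ltr1n.
  apply: hl; first by rewrite mulr_gt0// subr_gt0.
  by rewrite gtr_pMr// gtrBl invr_gt0 ltr0n.
apply: filterS2 Hu Hl => w hu' hl'.
apply: limf_esup_ratio => // e.
  move=> ce; have ec0 : 0 < e - c by rewrite subr_gt0.
  have [n hn] := archi _ ec0.
  apply: filterS2 hphi (hu' n) => y p0 /le_trans; apply.
  by rewrite ler_pM2r// addrC -lerBrDr.
move=> e0 ec; have d0 : 0 < 1 - e / c by rewrite subr_gt0 ltr_pdivrMr// mul1r.
have [n hn] := archi _ d0.
have hn2 : n.+2%:R^-1 <= 1 - e / c :> R.
  by apply: le_trans hn; rewrite lef_pV2 ?posrE ?ltr0n// ler_nat.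
apply: contra_not (hl' n) => h; apply: filterS2 hphi h => y p0 /lt_le_trans; apply.
by rewrite ler_pM2r// mulrC -ler_pdivrMr// lerBrDr -lerBrDl.
Qed.

Lemma walk_max_dist_lil (K d : nat) (hK : (2 <= K)%N) (hd : (1 <= d)%N)
    (S : 'I_K -> nat -> T -> 'rV[int]_d) : independent_random_walks P S ->
  {ae P, forall w,
       limn_esup (fun n : nat =>
         (walk_max_dist R S n w / Num.sqrt (n%:R * ln (ln n%:R)))%:E)
       = (2 / Num.sqrt d%:R)%:E}.
Proof.
move=> [hS iS].
have ind i j : i != j -> forall A B,
  sigma_of [set: nat] setT (S i) A -> sigma_of [set: nat] setT (S j) B ->
  measurable A -> measurable B -> pr P (A `&` B) = pr P A * pr P B.
  by move=> ij A B sA sB mA mB; exact: (independent_pair iS ij sA sB).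
apply: (@ae_limf_esup_ratio _ _ _ _ (fun w n => walk_max_dist R S n w)
  (fun n => lilscale n%:R)).
- by rewrite divr_gt0// sqrtr_gt0 ltr0n.
- exists (Num.truncn (expR (expR 1 : R))).+1 => // n /= hn; apply: lilscale_gt0.
  by apply: (le_trans (ltW (Num.Theory.truncnS_gt _))); rewrite ler_nat.
- move=> e he; have e0 : 0 < e by apply: lt_trans he; rewrite divr_gt0// sqrtr_gt0 ltr0n.
  have H : {ae P, forall w, forall p : 'I_K * 'I_K, p.1 != p.2 ->
     \forall n \near \oo, enorm (map_mx (fun z : int => z%:~R : R) (S p.1 n w) -
        map_mx (fun z : int => z%:~R) (S p.2 n w)) <= e * lilscale n%:R}.
    apply: filter_forall => -[i j] /=.
    have [->|ij] := eqVneq i j; first by apply: nearW => w; rewrite ?eqxx.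
    have := walk_pair_upper hd (hS i) (hS j) (ind i j ij) he.
    by apply: filterS => w [n0 hn0] _; exists n0.
  apply: filterS H => w hw.
  have : \forall n \near \oo, forall p : 'I_K * 'I_K, p.1 != p.2 ->
     enorm (map_mx (fun z : int => z%:~R : R) (S p.1 n w) -
        map_mx (fun z : int => z%:~R) (S p.2 n w)) <= e * lilscale n%:R.
    apply: filter_forall => p; have [pp|pp] := eqVneq p.1 p.2.
      by apply: nearW.
    by apply: filterS (hw p pp).
  apply: filterS => n hn; apply: max_dist_le => [|i j ij].
    by rewrite mulr_ge0 ?lilscale_ge0// ltW.
  exact: (hn (i, j)).
(* The indices 0 and 1 exist because K >= 2, and the maximum dominates the distance of this pair. *)
- move=> e e0 he; pose i : 'I_K := Ordinal (ltnW hK); pose j : 'I_K := Ordinal hK.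
  have ij : i != j by [].
  have := walk_pair_lower hd (hS i) (hS j) (ind i j ij) e0 he.
  apply: filterS => w hw [n0 _ hn]; have [n nn hn'] := hw n0.
  have := hn n nn; apply/negP; rewrite -leNgt (le_trans hn')//.
  exact: (le_max_dist (fun i => map_mx (fun z : int => z%:~R) (S i n w))).
Qed.

End MaxDist.

(** * Gaussian tail bounds *)

Section GaussianTails.
Context (R : realType).
Implicit Types tau a : R.
Notation mu := lebesgue_measure.

Let sqrt_neq0 tau : 0 < tau -> Num.sqrt tau != 0.
Proof. by move=> h; rewrite gt_eqF// sqrtr_gt0. Qed.

Let pdfE m tau x : 0 < tau ->
  normal_pdf m (Num.sqrt tau) x = normal_peak (Num.sqrt tau) * expR (- (x - m) ^+ 2 / (2 * tau)).
Proof.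
move=> h; rewrite normal_pdfE ?sqrt_neq0// /normal_fun sqr_sqrtr ?ltW//.
by rewrite -[tau *+ 2]mulr_natl.
Qed.

(* Completing the square: on [D], the centred density is at most
   [expR (- m^2 / (2 tau))] times the density with mean [m]. *)
Let shift_bound m tau (D : set R) : 0 < tau -> measurable D ->
  (forall x, D x -> 0 <= m * (x - m)) ->
  (normal_prob 0 (Num.sqrt tau) D <= (expR (- (m ^+ 2 / (2 * tau))))%:E)%E.
Proof.
move=> t0 mD hD; set C := expR _.
have sq (x : R) : 0 <= m * (x - m) -> m ^+ 2 + (x - m) ^+ 2 <= x ^+ 2.
  move=> h; rewrite -subr_ge0 (_ : _ - _ = 2 * (m * (x - m))); last by ring.
  by rewrite mulr_ge0.
have C0 : 0 <= C := expR_ge0 _.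
apply: (@le_trans _ _ (\int[mu]_(x in D) (C * normal_pdf m (Num.sqrt tau) x)%:E)%E).
  apply: ge0_le_integral => //.
  - by move=> x _; rewrite lee_fin normal_pdf_ge0.
  - by apply/measurable_EFinP; apply: measurable_funTS; exact: measurable_normal_pdf.
  - apply/measurable_EFinP; apply: measurable_funTS; apply: measurable_funM => //.
    exact: measurable_normal_pdf.
  - move=> x /hD Dx; rewrite lee_fin !pdfE// mulrCA ler_wpM2l ?normal_peak_ge0//.
    rewrite /C -expRD ler_expR subr0 !mulNr -opprD -mulrDl lerN2.
    rewrite ler_pM2r ?invr_gt0 ?mulr_gt0//.
    exact: sq.
under eq_integral do rewrite EFinM.
rewrite ge0_integralZl//; last 2 first.
- by apply/measurable_EFinP; apply: measurable_funTS; exact: measurable_normal_pdf.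
- by move=> x _; rewrite lee_fin normal_pdf_ge0.
rewrite -[leRHS]mule1 lee_pmul2l ?lte_fin ?expR_gt0//.
exact: (@probability_le1 _ _ _ (normal_prob m (Num.sqrt tau))).
Qed.

Lemma measurable_ge a : measurable [set y : R | a <= y].
Proof.
by rewrite (_ : [set y | _] = `[a, +oo[%classic)//; apply/seteqP; split => y /=;
  rewrite in_itv /= andbT.
Qed.

Lemma measurable_le a : measurable [set y : R | y <= a].
Proof.
by rewrite (_ : [set y | _] = `]-oo, a]%classic)//; apply/seteqP; split => y /=;
  rewrite in_itv.
Qed.

Lemma ge_normE a : [set y : R | a <= `|y|] = [set y | a <= y] `|` [set y | y <= - a].
Proof.
apply/seteqP; split => y /=; first by rewrite ler_normr lerNr => /orP[]; [left|right].
by move=> [h|h]; rewrite ler_normr ?h// lerNr h orbT.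
Qed.

Lemma measurable_ge_norm a : measurable [set y : R | a <= `|y|].
Proof.
by rewrite ge_normE; apply: measurableU; [exact: measurable_ge|exact: measurable_le].
Qed.

Lemma normal_prob_ge_norm tau a : 0 < tau -> 0 <= a ->
  (normal_prob 0 (Num.sqrt tau) [set y | (a <= `|y|)%R] <=
    (2 * expR (- (a ^+ 2 / (2 * tau))))%:E)%E.
Proof.
move=> t0 a0; rewrite ge_normE.
have h := @measureU2 _ _ _ (normal_prob 0 (Num.sqrt tau)) _ _
  (measurable_ge a) (measurable_le (- a)).
apply: (le_trans h).
rewrite mulr2n mulrDl !mul1r EFinD leeD//.
  apply: shift_bound => //; first exact: measurable_ge.
  by move=> x ax; rewrite mulr_ge0// subr_ge0.
rewrite -sqrrN; apply: shift_bound => //; first exact: measurable_le.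
by move=> x /= ax; rewrite opprK mulNr -mulrN mulr_ge0// oppr_ge0 -lerBrDr sub0r.
Qed.

Let interval_bound tau (l u v : R) : 0 < tau -> l <= u ->
  (forall y, l <= y <= u -> y ^+ 2 <= v ^+ 2) ->
  (((u - l) * normal_peak (Num.sqrt tau) * expR (- (v ^+ 2 / (2 * tau))))%:E <=
   normal_prob 0 (Num.sqrt tau) `[l, u]%classic)%E.
Proof.
move=> t0 lu h; pose C := normal_peak (Num.sqrt tau) * expR (- (v ^+ 2 / (2 * tau))).
apply: (@le_trans _ _ (\int[mu]_(x in `[l, u]%classic) C%:E)%E).
  have mulu : mu `[l, u]%classic = (u - l)%:E.
    rewrite lebesgue_measure_itv /= lte_fin; case: ltP => [_|ul]; first by rewrite EFinB.
    by have -> : u - l = 0 by apply/eqP; rewrite subr_eq0 eq_le ul lu.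
  have -> := @integral_cst _ _ R mu `[l, u]%classic (measurable_itv _) C%:E.
  by rewrite [X in (_ * X)%E]mulu -EFinM lee_fin /C -mulrA mulrC.
apply: ge0_le_integral => //.
- by move=> x _; rewrite lee_fin mulr_ge0 ?normal_peak_ge0 ?expR_ge0.
- by apply/measurable_EFinP; apply: measurable_funTS; exact: measurable_normal_pdf.
- move=> x /=; rewrite in_itv /= => /h xv.
  rewrite lee_fin pdfE// /C ler_wpM2l ?normal_peak_ge0// ler_expR subr0 mulNr lerN2.
  by rewrite ler_pM2r ?invr_gt0 ?mulr_gt0.
Qed.

(** The tail contains an interval of one standard deviation s starting at a, where the density is at
    least its value at a + s. With b = a / s the loss in the exponent is b + 1/2 + K, where K = ln
    sqrt(2 pi); [b0] is so large that b^2 delta / 2 covers it, uniformly in [tau]. *)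
Lemma normal_prob_tail_lb (delta : R) : 0 < delta ->
  exists2 b0, 0 < b0 & forall tau a, 0 < tau -> b0 * Num.sqrt tau <= a ->
   ((expR (- (a ^+ 2 / (2 * tau) * (1 + delta))))%:E <=
      normal_prob 0 (Num.sqrt tau) [set y | (a <= y)%R])%E /\
   ((expR (- (a ^+ 2 / (2 * tau) * (1 + delta))))%:E <=
      normal_prob 0 (Num.sqrt tau) [set y | (y <= - a)%R])%E.
Proof.
move=> d0; pose kappa := (Num.sqrt (pi *+ 2))^-1 : R.
have k0 : 0 < kappa by rewrite invr_gt0 sqrtr_gt0 pmulrn_rgt0// pi_gt0.
pose K := - ln kappa.
exists ((1 + `|K| + 1) * 4 / delta + 1).
  by rewrite addr_gt0// divr_gt0// mulr_gt0// -addrA addr_gt0// addr_ge0_gt0.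
move=> tau a t0 hb; pose s := Num.sqrt tau.
have s0 : 0 < s by rewrite sqrtr_gt0.
have s2 : s ^+ 2 = tau by rewrite sqr_sqrtr// ltW.
have B : (1 + `|K| + 1) * 4 / delta + 1 <= a / s by rewrite ler_pdivlMr.
set b := a / s in B; have ab : a = b * s by rewrite /b divfK// gt_eqF.
have N0 := normr_ge0 K.
have b1 : 1 <= b.
  apply: le_trans B; rewrite lerDr divr_ge0// ?(ltW d0)// mulr_ge0//; lra.
have a0 : 0 <= a by rewrite ab mulr_ge0// ?ltW//; lra.
have bd : (1 + `|K| + 1) * 4 <= b * delta.
  by rewrite -ler_pdivrMr//; lra.
have key : expR (- (a ^+ 2 / (2 * tau) * (1 + delta))) <=
    s * normal_peak s * expR (- ((a + s) ^+ 2 / (2 * tau))).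
  have -> : s * normal_peak s = kappa.
    rewrite /normal_peak -[_ * pi *+ 2]mulrnAr sqrtrM ?sqr_ge0// sqrtr_sqr gtr0_norm//.
    by rewrite invfM mulrA divff ?mul1r// gt_eqF.
  have -> : kappa = expR (- K) by rewrite opprK lnK// posrE.
  rewrite -expRD ler_expR -opprD lerN2.
  have -> : (a + s) ^+ 2 / (2 * tau) = (b + 1) ^+ 2 / 2.
    by rewrite ab -s2; field; rewrite gt_eqF.
  have -> : a ^+ 2 / (2 * tau) = b ^+ 2 / 2.
    by rewrite ab -s2; field; rewrite gt_eqF.
  have h1 := ler_norm K.
  have h2 : (1 + `|K| + 1) * 4 * b <= b ^+ 2 * delta.
    have -> : b ^+ 2 * delta = b * delta * b by ring.
    by rewrite ler_wpM2r//; lra.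
  have h3 : `|K| <= `|K| * b by rewrite ler_peMr.
  by lra.
split.
  apply: (@le_trans _ _ (normal_prob 0 (Num.sqrt tau) `[a, a + s]%classic)).
    apply: le_trans (interval_bound t0 _ (v := a + s) _).
    - by rewrite lee_fin [a + s]addrC addrK addrC.
    - by rewrite lerDl ltW.
    - move=> y /andP[y1 y2]; rewrite lerXn2r// nnegrE; first exact: le_trans y1.
      by rewrite addr_ge0// ltW.
  apply: le_measure; rewrite ?inE//; first exact: measurable_ge.
  by move=> y /=; rewrite in_itv /= => /andP[].
apply: (@le_trans _ _ (normal_prob 0 (Num.sqrt tau) `[- (a + s), - a]%classic)).
  apply: le_trans (interval_bound t0 _ (v := a + s) _).
  - rewrite lee_fin opprK (_ : - a + (a + s) = s) //; ring.
  - by rewrite lerN2 lerDl ltW.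
  - move=> y /andP[y1 y2]; rewrite -sqrrN lerXn2r// ?nnegrE.
    + by rewrite lerNr oppr0 (le_trans y2)// oppr_le0.
    + by rewrite addr_ge0// ltW.
    + by rewrite lerNl.
apply: le_measure; rewrite ?inE//; first exact: measurable_le.
by move=> y /=; rewrite in_itv /= => /andP[].
Qed.

End GaussianTails.

(** * Dyadic chaining for a continuous function *)

Section DyadicChaining.
Context (R : realType) (f : R -> R) (s h x : R).

(** The ratio exceeds 1 / sqrt 2, the ratio of the standard deviations of consecutive dyadic
    increments, so that Gaussian bounds improve with the level. The factor 1/4 = 1 - r in the
    thresholds makes them sum to x. *)
Let r : R := 3 / 4.

(** An odd point of level j + 1 is one step away from an even one, which belongs to level j. *)
Lemma dyadic_chain : 0 <= x ->
  (forall j i, (i < 2 ^ j)%N ->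
    `|f (s + h * (i.+1%:R / 2 ^+ j)) - f (s + h * (i%:R / 2 ^+ j))| <= x / 4 * r ^+ j) ->
  forall j i, (i <= 2 ^ j)%N -> `|f (s + h * (i%:R / 2 ^+ j)) - f s| <= x * (1 - r ^+ j.+1).
Proof.
move=> x0 H; have rp j : 0 <= r ^+ j by rewrite exprn_ge0// /r divr_ge0.
elim=> [|j IH] i.
  case: i => [|[|//]] _.
    by rewrite mul0r mulr0 addr0 subrr normr0 mulr_ge0// /r; lra.
  have := H 0%N 0%N isT; rewrite mul0r mulr0 addr0 => /le_trans; apply.
  by rewrite /r expr0 expr1; lra.
rewrite -[i]odd_double_half; set m := i./2.
have half (k : nat) : (k.*2)%:R / 2 ^+ j.+1 = k%:R / 2 ^+ j :> R.
  by rewrite -muln2 natrM exprS; field; rewrite expf_neq0// pnatr_eq0.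
case: (odd i) => /=; rewrite ?add1n ?add0n => hi.
  have mj : (m < 2 ^ j)%N by rewrite -ltn_double -(mul2n (2 ^ j)) -expnS.
  have h1 := IH m (ltnW mj).
  have lt : (m.*2 < 2 ^ j.+1)%N by [].
  have h2 := H j.+1 _ lt.
  rewrite half in h2.
  apply: le_trans (ler_distD (f (s + h * (m%:R / 2 ^+ j))) _ _) _.
  apply: (le_trans (lerD h2 h1)); rewrite le_eqVlt; apply/orP; left; apply/eqP.
  by rewrite [r ^+ j.+2]exprS; move: (r ^+ j.+1) => p; rewrite /r; field.
have mj : (m <= 2 ^ j)%N by rewrite -leq_double -(mul2n (2 ^ j)) -expnS.
rewrite half; apply: (le_trans (IH m mj)).
rewrite ler_wpM2l// lerD2l lerN2 [leLHS]exprS ler_piMl// /r; lra.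
Qed.

(** By continuity a violation at [t] would persist nearby, in particular at the last dyadic point of
    a fine level not after [t]. *)
Lemma dyadic_bound_extend : 0 <= s -> 0 < h -> {within `[0, +oo[%classic, continuous f} ->
  (forall j i, (i <= 2 ^ j)%N -> `|f (s + h * (i%:R / 2 ^+ j)) - f s| <= x) ->
  forall t, s <= t <= s + h -> `|f t - f s| <= x.
Proof.
move=> s0 h0 /subspace_continuousP cf H t /andP[st th].
have t0 : 0 <= t := le_trans s0 st.
rewrite leNgt; apply/negP => hx; pose e := `|f t - f s| - x.
have e0 : 0 < e by rewrite subr_gt0.
have tin : `[0, +oo[%classic t by rewrite /= in_itv /= t0.
have /cvgrPdist_lt /(_ e e0) := cf t tin.
rewrite near_withinE => /nbhs_ballP[delta /= d0 hd].
have [j hj] := exp_unbounded (h / delta + 1) (ltr1n R 2).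
have {hj} := hj j (leqnn _) => hj.
have p0 : 0 < 2 ^+ j :> R by rewrite exprn_gt0.
have hj2 : h / 2 ^+ j < delta.
  rewrite ltr_pdivrMr// mulrC -ltr_pdivrMr//; apply: lt_le_trans hj.
  by rewrite ltrDl.
pose u := 2 ^+ j * ((t - s) / h).
have u0 : 0 <= u by rewrite mulr_ge0 ?divr_ge0 ?subr_ge0// ltW.
pose i := Num.truncn u.
have iu : i%:R <= u by rewrite Num.Theory.truncn_le.
have ui : u < i%:R + 1 by rewrite natr1 Num.Theory.truncnS_gt.
have ij : (i <= 2 ^ j)%N.
  rewrite -(ler_nat R) natrX; apply: (le_trans iu); rewrite /u ler_piMr ?(ltW p0)//.
  by rewrite ler_pdivrMr// mul1r lerBlDl.
pose t' := s + h * (i%:R / 2 ^+ j).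
have tE : t = s + h * (u / 2 ^+ j).
  by rewrite /u; field; rewrite !gt_eqF.
have t'0 : 0 <= t' by rewrite addr_ge0// mulr_ge0 ?divr_ge0// ltW.
have : `|f t - f t'| < e.
  apply: hd; last by rewrite /= in_itv /= t'0.
  rewrite /ball /= tE /t' opprD addrACA subrr add0r -mulrBr -mulrBl ger0_norm.
    apply: le_lt_trans hj2; rewrite ler_pM2l// ler_piMl ?invr_ge0 ?(ltW p0)//; lra.
  by rewrite mulr_ge0 ?divr_ge0 ?subr_ge0// ltW.
have := H j i ij; rewrite -/t' => h1 h2.
have := ler_distD (f t') (f t) (f s); rewrite /e in h2 *; lra.
Qed.

End DyadicChaining.

(** * Oscillation of a Wiener process between geometric times *)

Section WienerFluctuation.
Context (R : realType) (disp : measure_display) (T : measurableType disp)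
  (P : probability T R) (W : R -> {RV P >-> R}).
Hypothesis hW : wiener W.

Lemma measurable_increment (s t : R) (B : set R) : measurable B ->
  measurable [set w | B (W t w - W s w)].
Proof.
move=> mB; have mf : measurable_fun setT (W t \- W s).
  by apply: measurable_funB.
by have := mf measurableT _ mB; rewrite setTI.
Qed.

Lemma pr_increment (s t : R) (B : set R) : 0 <= s -> s < t -> measurable B ->
  (pr P [set w | B (W t w - W s w)])%:E = normal_prob 0 (Num.sqrt (t - s)) B.
Proof.
move=> s0 st mB; rewrite -prE; last exact: measurable_increment.
exact: (wiener_normal hW s0 st mB).
Qed.

Lemma pr_increment_ge_norm (s t a : R) : 0 <= s -> s < t -> 0 <= a ->
  pr P [set w | a <= `|W t w - W s w|] <= 2 * expR (- (a ^+ 2 / (2 * (t - s)))).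
Proof.
move=> s0 st a0; rewrite -lee_fin.
rewrite (pr_increment s0 st (measurable_ge_norm a)).
by apply: normal_prob_ge_norm => //; rewrite subr_gt0.
Qed.

Let level s h x j : set T := \big[setU/set0]_(i < 2 ^ j)
  [set w | x / 4 * (3 / 4) ^+ j <=
     `|W (s + h * (i.+1%:R / 2 ^+ j)) w - W (s + h * (i%:R / 2 ^+ j)) w|].

Let measurable_level s h x j : measurable (level s h x j).
Proof.
apply: bigsetU_measurable => i _.
exact: (measurable_increment _ _ (measurable_ge_norm _)).
Qed.

Let bernoulli j : 1 + j%:R / 8 <= (9 / 8) ^+ j :> R.
Proof.
elim: j => [|j IH]; first by rewrite mul0r addr0.
rewrite exprS -natr1; apply: (@le_trans _ _ (9 / 8 * (1 + j%:R / 8))).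
  by have := ler0n R j; lra.
by rewrite ler_wpM2l.
Qed.

(** The squared threshold over twice the variance is A (9/8)^j, as 2 (3/4)^2 = 9/8. The constant 512
    = 16 x 32 gives A >= 16; with (9/8)^j >= 1 + j/8 this yields a factor e^(-2j) <= 4^-j, which
    beats the 2^j intervals and leaves 2^-j. *)
Let pr_level s h x j : 0 <= s -> 0 < h -> 0 <= x -> 512 * h <= x ^+ 2 ->
  pr P (level s h x j) <= 2 * expR (- (x ^+ 2 / (32 * h))) * 2^-1 ^+ j.
Proof.
move=> s0 h0 x0 hx; set A := x ^+ 2 / (32 * h).
have A16 : 16 <= A by rewrite ler_pdivlMr ?mulr_gt0//; lra.
have p0 : 0 < 2 ^+ j :> R by rewrite exprn_gt0.
apply: (le_trans (pr_bigU_le P _ _ _)).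
  by move=> i; exact: (measurable_increment _ _ (measurable_ge_norm _)).
apply: (@le_trans _ _ (\sum_(i < 2 ^ j) 2 * expR (- (A * (9 / 8) ^+ j)))).
  apply: ler_sum => i _.
  have i0 : 0 <= i%:R / 2 ^+ j :> R by rewrite divr_ge0// ltW.
  have d : s + h * (i.+1%:R / 2 ^+ j) - (s + h * (i%:R / 2 ^+ j)) = h / 2 ^+ j.
    by rewrite -[i.+1%:R]natr1; field; rewrite gt_eqF.
  apply: (le_trans (pr_increment_ge_norm _ _ _)).
  - by rewrite addr_ge0// mulr_ge0// ltW.
  - by rewrite -subr_gt0 d divr_gt0.
  - by rewrite mulr_ge0 ?divr_ge0// exprn_ge0// divr_ge0.
  rewrite d ler_wpM2l// ler_expR lerN2 le_eqVlt; apply/orP; left; apply/eqP.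
  have -> : (9 / 8) ^+ j = 2 ^+ j * ((3 / 4) ^+ j) ^+ 2 :> R.
    by rewrite -exprM mulnC exprM -exprMn; congr (_ ^+ _); field.
  by rewrite /A; field; rewrite !gt_eqF.
rewrite sumr_const card_ord -[_ *+ _]mulr_natl natrX.
have h1 : expR (- (A * (9 / 8) ^+ j)) <= expR (- A) * 4^-1 ^+ j.
  apply: (@le_trans _ _ (expR (- (A * (1 + j%:R / 8))))).
    by rewrite ler_expR lerN2 ler_wpM2l ?bernoulli//; lra.
  have -> : - (A * (1 + j%:R / 8)) = - A + j%:R * - (A / 8) by field.
  rewrite expRD expRM_natl ler_pM2l ?expR_gt0// lerXn2r ?nnegrE ?expR_ge0//.
  apply: (@le_trans _ _ (expR (- 2))); first by rewrite ler_expR lerN2; lra.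
  rewrite expRN lef_pV2 ?posrE ?expR_gt0//.
  have h2 : 0 <= 2 :> R by [].
  by have := expR_ge_deg2 h2; lra.
have -> : 2 * expR (- A) * 2^-1 ^+ j = 2 ^+ j * (2 * (expR (- A) * 4^-1 ^+ j)).
  have -> : 4^-1 = 2^-1 * 2^-1 :> R by field.
  by rewrite exprMn !exprVn; field; rewrite gt_eqF.
by rewrite ler_wpM2l ?(ltW p0)// ler_wpM2l.
Qed.

(** The supremum over a continuum of times is enclosed in the measurable event [B] that some dyadic
    increment reaches its threshold; continuity enters pathwise, outside [B]. *)
Lemma pr_oscillation s h x : 0 <= s -> 0 < h -> 0 <= x -> 512 * h <= x ^+ 2 ->
  exists2 B : set T, measurable B /\ pr P B <= 4 * expR (- (x ^+ 2 / (32 * h)))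
    & forall w, {within `[0, +oo[%classic, continuous (fun t => W t w)} -> ~ B w ->
      forall t, s <= t <= s + h -> `|W t w - W s w| <= x.
Proof.
move=> s0 h0 x0 hx; pose B := \bigcup_j level s h x j.
have mB : measurable B by apply: bigcupT_measurable => j; exact: measurable_level.
exists B.
  split => //; set E := expR _.
  have E0 : 0 <= E := expR_ge0 _.
  rewrite -lee_fin -prE//.
  have sB : B `<=` \bigcup_j level s h x j by [].
  have hs := measure_sigma_subadditive P (measurable_level s h x) mB sB.
  apply: (le_trans hs).
  apply: lime_le.
    by apply: is_cvg_nneseries => n _ _; exact: measure_ge0.
  apply: nearW => n; rewrite big_mkord.
  have -> : (\sum_(k < n) P (level s h x k) = (\sum_(k < n) pr P (level s h x k))%:E)%E.
    by rewrite -sumEFin; apply: eq_bigr => k _; exact: (prE P (measurable_level s h x k)).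
  rewrite lee_fin.
  apply: (@le_trans _ _ (\sum_(k < n) 2 * E * 2^-1 ^+ k)).
    by apply: ler_sum => k _; exact: pr_level.
  suff : \sum_(k < n) 2 * E * 2^-1 ^+ k = 4 * E * (1 - 2^-1 ^+ n).
    by move=> ->; rewrite ler_piMr ?mulr_ge0// gerBl exprn_ge0// invr_ge0.
  elim: n => [|n IH]; first by rewrite big_ord0 expr0 subrr mulr0.
  by rewrite big_ord_recr /= IH exprS; field.
move=> w cw nB; apply: (dyadic_bound_extend s0 h0 cw) => j i ij.
have step k l : (l < 2 ^ k)%N ->
    `|W (s + h * (l.+1%:R / 2 ^+ k)) w - W (s + h * (l%:R / 2 ^+ k)) w| <=
      x / 4 * (3 / 4) ^+ k.
  move=> lk; rewrite ltW// ltNge; apply/negP => hl; apply: nB.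
  exists k => //; rewrite /level -bigcup_seq.
  by exists (Ordinal lk) => //=; rewrite mem_index_enum.
apply: (le_trans (@dyadic_chain R (fun t => W t w) s h x x0 step j i ij)).
by rewrite ler_piMr// gerBl exprn_ge0// divr_ge0.
Qed.

Lemma wiener_fluctuation (theta eps : R) : 1 < theta -> 0 < eps ->
  32 * (theta - 1) < eps ^+ 2 ->
  {ae P, forall w, exists k0, forall k, (k0 <= k)%N -> forall t,
    theta ^+ k <= t <= theta ^+ k.+1 ->
    `|W t w - W (theta ^+ k) w| <= eps * lilscale (theta ^+ k)}.
Proof.
move=> th1 e0 hth; have th0 : 0 < theta := lt_trans ltr01 th1.
have d0 : 0 < theta - 1 by rewrite subr_gt0.
(* For blocks of length theta^k (theta - 1) the exponent x^2 / (32 h) equals rho ln ln theta^k; the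
   hypothesis on [theta] says rho > 1. *)
pose rho := eps ^+ 2 / (32 * (theta - 1)).
have rho1 : 1 < rho by rewrite ltr_pdivlMr ?mul1r// mulr_gt0.
pose h k := theta ^+ k * (theta - 1).
pose x k := eps * lilscale (theta ^+ k).
have p0 k : 0 < theta ^+ k by rewrite exprn_gt0.
have h0 k : 0 < h k by rewrite mulr_gt0.
have x0 k : 0 <= x k by rewrite mulr_ge0 ?lilscale_ge0// ltW.
have [k1 hk1] := exp_unbounded (expR 1) th1.
(* The value 16 yields the hypothesis 512 h <= x^2 of [pr_oscillation]. *)
have [k2 hk2] := lnln_exp_unbounded 16 th1.
have rhoE k : (k1 <= k)%N -> x k ^+ 2 / (32 * h k) = rho * ln (ln (theta ^+ k)).
  move=> /hk1 e1; rewrite /x exprMn sqr_lilscale// /h /rho; field.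
  by rewrite !gt_eqF.
pose good k (B : set T) := [/\ measurable B, (maxn k1 k2 <= k)%N ->
    pr P B <= 4 * expR (- (rho * ln (ln (theta ^+ k)))) &
  (maxn k1 k2 <= k)%N -> forall w,
   {within `[0, +oo[%classic, continuous (fun t => W t w)} -> ~ B w ->
      forall t, theta ^+ k <= t <= theta ^+ k.+1 -> `|W t w - W (theta ^+ k) w| <= x k].
have /choice[B hB] : forall k, exists B, good k B.
  move=> k; have [kk|kk] := leqP (maxn k1 k2) k; last first.
    by exists set0; split; rewrite // leqNgt kk.
  have kk1 : (k1 <= k)%N by apply: leq_trans kk; rewrite leq_maxl.
  have kk2 : (k2 <= k)%N by apply: leq_trans kk; rewrite leq_maxr.
  have hx : 512 * h k <= x k ^+ 2.
    have l16 : 16 <= rho * ln (ln (theta ^+ k)).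
      apply: (le_trans (hk2 k kk2)); rewrite ler_peMl ?(ltW rho1)//.
      exact: lnln_ge0 (hk1 k kk1).
    by move: l16; rewrite -rhoE// ler_pdivlMr ?mulr_gt0//; lra.
  have [B [mB pB] wB] := pr_oscillation (ltW (p0 k)) (h0 k) (x0 k) hx.
  exists B; split => // _; first by rewrite -rhoE.
  move=> w cw nB t; have -> : theta ^+ k.+1 = theta ^+ k + h k by rewrite /h exprS; ring.
  exact: wB.
have mB k : measurable (B k) by case: (hB k).
have [M hM] := sum_expRN_lnln_bounded th1 rho1 (ler0n R 4)
   (fun k => pr_le1 P (mB k)) (k0 := maxn k1 k2)
   (fun k => let: And3 _ h _ := hB k in h).
apply: filterS2 (ae_eventually_notin mB hM) (wiener_continuous hW) => w [k0 hk0] cw.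
exists (maxn k0 (maxn k1 k2)) => k; rewrite geq_max => /andP[kk0 kk].
by case: (hB k) => _ _ /(_ kk w cw (hk0 k kk0)).
Qed.

End WienerFluctuation.

(** * Covering the complement of a ball by products of half-lines *)

Section GridCover.
Context (R : realType).

(* [a] rounds [M |y j| / r] down; rounding costs at most [sqrt #|J|] in Euclidean norm. *)
Lemma grid_cover (J : finType) (y : J -> R) (r : R) (M : nat) : 0 < r ->
  (#|J| <= M)%N -> (0 < M)%N -> r ^+ 2 <= \sum_j y j ^+ 2 ->
  exists a : {ffun J -> 'I_M.+1},
    (M%:R - #|J|%:R) ^+ 2 <= \sum_j (a j)%:R ^+ 2 :> R /\
    forall j, (a j)%:R * (r / M%:R) <= `|y j|.
Proof.
move=> r0 JM M0 hr; have MR : 0 < M%:R :> R by rewrite ltr0n.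
pose u j := M%:R * `|y j| / r.
have u0 j : 0 <= u j by rewrite divr_ge0 ?mulr_ge0// ltW.
pose a : {ffun J -> 'I_M.+1} := [ffun j => inord (minn M (Num.truncn (u j)))].
have aE j : a j = minn M (Num.truncn (u j)) :> nat.
  by rewrite ffunE inordK// ltnS geq_minl.
have ua j : (a j)%:R <= u j.
  rewrite aE; apply: (@le_trans _ _ (Num.truncn (u j))%:R).
    by rewrite ler_nat geq_minr.
  by rewrite Num.Theory.truncn_le.
have MJ : 0 <= M%:R - #|J|%:R :> R by rewrite subr_ge0 ler_nat.
exists a; split; last first.
  by move=> j; move: (ua j); rewrite /u ler_pdivlMr// mulrA ler_pdivrMr// mulrC [M%:R * _]mulrC mulrC.
have S0 : 0 <= \sum_j (a j)%:R ^+ 2 :> R by apply: sumr_ge0 => j _; exact: sqr_ge0.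
(* A coordinate at the cap M alone contributes M^2; otherwise nothing is capped and rounding costs
   at most 1 per coordinate. *)
have [/existsP[j /eqP aj]|/existsPn hM] := boolP [exists j, a j == M :> nat].
  apply: (@le_trans _ _ (M%:R ^+ 2)).
    by rewrite lerXn2r// ?nnegrE// gerBl.
  by rewrite (bigD1 j)//= aj lerDl; apply: sumr_ge0 => k _; exact: sqr_ge0.
have ua1 j : u j <= (a j)%:R + 1.
  have h := hM j; rewrite natr1 aE (_ : minn _ _ = Num.truncn (u j)).
    exact: ltW (Num.Theory.truncnS_gt _).
  by move: h; rewrite aE /minn; case: ltnP => //; rewrite eqxx.
pose N := Num.sqrt (\sum_j (a j)%:R ^+ 2 : R).
have N2 : N ^+ 2 = \sum_j (a j)%:R ^+ 2 by rewrite sqr_sqrtr.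
have N0 : 0 <= N := sqrtr_ge0 _.
have aN j : (a j)%:R <= N.
  rewrite -[leLHS]ger0_norm// -sqrtr_sqr ler_wsqrtr// (bigD1 j)//= lerDl.
  by apply: sumr_ge0 => k _; exact: sqr_ge0.
have M2 : M%:R ^+ 2 <= (N + #|J|%:R) ^+ 2 :> R.
  apply: (@le_trans _ _ (\sum_j u j ^+ 2)).
    rewrite (eq_bigr (fun j => (M%:R / r) ^+ 2 * y j ^+ 2)); last first.
      by move=> j _; rewrite /u mulrAC exprMn real_normK ?num_real.
    rewrite -big_distrr /= expr_div_n mulrAC ler_pdivlMr ?exprn_gt0//.
    by rewrite ler_pM2l ?exprn_gt0.
  apply: (@le_trans _ _ (\sum_j ((a j)%:R ^+ 2 + (2 * N + 1)))).
    apply: ler_sum => j _; apply: (@le_trans _ _ (((a j)%:R + 1) ^+ 2)).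
      by rewrite lerXn2r// ?nnegrE// addr_ge0.
    rewrite sqrrD expr1n mulr1 -addrA lerD2l lerD2r -mulr_natl ler_wpM2l//.
  have sc : \sum_(j : J) (2 * N + 1) = #|J|%:R * (2 * N + 1).
    by rewrite sumr_const; apply/esym; exact: mulr_natl.
  have m2 : #|J|%:R <= #|J|%:R ^+ 2 :> R.
    by rewrite -natrX ler_nat; case: #|J| => // n; rewrite expnS expn1 leq_pmulr.
  rewrite big_split /= -N2 sc; move: #|J|%:R m2 => m m2.
  have -> : (N + m) ^+ 2 = N ^+ 2 + 2 * (N * m) + m ^+ 2 by ring.
  by lra.
rewrite -N2 lerXn2r// ?nnegrE// lerBlDr.
by rewrite -(ler_pXn2r (_ : 0 < 2)%N) ?nnegrE// addr_ge0.
Qed.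

(** The second summand is measured in the l1 norm because fluctuations are controlled coordinate by
    coordinate. *)
Lemma enorm_add_le d (x y : 'rV[R]_d) : enorm (x + y) <= enorm x + \sum_k `|y 0 k|.
Proof.
pose S : R := \sum_k `|y 0 k|; have S0 : 0 <= S by apply: sumr_ge0.
rewrite -/S.
have N0 := enorm_ge0 x.
rewrite -(ler_pXn2r (_ : 0 < 2)%N) ?nnegrE ?enorm_ge0 ?addr_ge0//.
rewrite sqr_enorm sqrrD sqr_enorm.
have yS k : `|y 0 k| <= S by rewrite /S (bigD1 k)//= lerDl sumr_ge0.
apply: (@le_trans _ _ (\sum_k (x 0 k ^+ 2 + (2 * enorm x * `|y 0 k| + S * `|y 0 k|)))).
  apply: ler_sum => k _; rewrite mxE sqrrD -addrA lerD2l lerD//.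
    rewrite -mulr_natl -mulrA ler_wpM2l//; apply: (le_trans (ler_norm _)).
    by rewrite normrM ler_wpM2r// le_coord_enorm.
  by rewrite -[y 0 k ^+ 2]real_normK ?num_real// expr2 ler_wpM2r.
rewrite !big_split /= -!big_distrr /= -/S -addrA lerD2l -expr2.
by rewrite [X in _ <= X + _](_ : _ = 2 * enorm x * S)//; ring.
Qed.

End GridCover.

(** * Increments in generated sigma-algebras *)

Section SigmaIncrements.
Context (R : realType) (disp : measure_display) (T : measurableType disp)
  (I : Type) (D : set I) (U : I -> T -> R).

(** Equipping [T] with the generated sigma-algebra reduces the claim to measurability of a
    difference of measurable functions. *)
Lemma sigma_of_increment i j (B : set R) : D i -> D j -> measurable B ->
  sigma_of D measurable U [set w | B (U j w - U i w)].
Proof.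
move=> Di Dj mB; pose G := \bigcup_(i in D) preimage_set_system setT (U i) measurable.
pose T' := g_sigma_algebraType G.
have mU k : D k -> measurable_fun setT (U k : T' -> R).
  by move=> Dk _ C mC; rewrite setTI; exact: sigma_of_preimage.
have mf : measurable_fun setT ((U j : T' -> R) \- U i).
  by apply: measurable_funB; exact: mU.
by have := mf measurableT _ mB; rewrite setTI.
Qed.

Lemma sigma_of_bigcap (J : choiceType) (s : seq J) (A : J -> set T) :
  (forall j, j \in s -> sigma_of D measurable U (A j)) ->
  sigma_of D measurable U (\bigcap_(j in [set` s]) A j).
Proof.
move=> h; pose G := \bigcup_(i in D) preimage_set_system setT (U i) measurable.
suff : measurable (\bigcap_(j in [set` s]) A j : set (g_sigma_algebraType G)) by [].
rewrite bigcap_seq big_seq.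
by apply: (@bigsetI_measurable _ (g_sigma_algebraType G)) => j /h.
Qed.

End SigmaIncrements.

(** * Upper bound for the distance of two Wiener processes *)

Section WienerPairUpper.
Context (R : realType) (d : nat) (disp : measure_display) (T : measurableType disp)
  (P : probability T R) (W1 W2 : 'I_d -> R -> {RV P >-> R}).
Hypotheses (hW1 : wiener_process W1) (hW2 : wiener_process W2).
Hypothesis ind : forall A B,
  sigma_of [set kt : 'I_d * R | 0 <= kt.2] measurable (fun kt => W1 kt.1 kt.2 : T -> R) A ->
  sigma_of [set kt : 'I_d * R | 0 <= kt.2] measurable (fun kt => W2 kt.1 kt.2 : T -> R) B ->
  measurable A -> measurable B -> pr P (A `&` B) = pr P A * pr P B.

(** Independence of the coordinates gives a product of Gaussian tails, whose exponents add up to the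
    squared length of the corner [b]. *)
Lemma pr_wiener_box (W : 'I_d -> R -> {RV P >-> R}) t (b : 'I_d -> R) :
  wiener_process W -> 0 < t -> (forall k, 0 <= b k) ->
  pr P (\bigcap_(k in [set` enum 'I_d]) [set w | b k <= `|W k t w - W k 0 w|])
    <= 2 ^+ d * expR (- ((\sum_k b k ^+ 2) / (2 * t))).
Proof.
move=> [hW iW] t0 b0.
rewrite (independent_seq iW (enum_uniq _)); last 2 first.
- move=> k _; apply: (@sigma_of_increment R disp T R _ (fun s => W k s : T -> R) 0 t
    [set y | b k <= `|y|]) => //=; [exact: ltW|exact: measurable_ge_norm].
- by move=> k _; exact: (measurable_increment (W k) 0 t (measurable_ge_norm _)).
rewrite big_enum /=.
apply: (@le_trans _ _ (\prod_(k < d) (2 * expR (- (b k ^+ 2 / (2 * t)))))).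
  apply: ler_prod => k _; rewrite pr_ge0 /=.
  by have := pr_increment_ge_norm (hW k) (lexx 0) t0 (b0 k); rewrite subr0.
rewrite big_split /= prodr_const card_ord -expR_sum.
by rewrite mulr_suml sumrN.
Qed.

Let sqnorm t w := \sum_k (W1 k t w - W1 k 0 w) ^+ 2 + \sum_k (W2 k t w - W2 k 0 w) ^+ 2.

(** In units of r / M the corners form a grid independent of [t] and [r], so the number of boxes
    enters only [C]. Each corner used has length at least (1 - 2d/M) r, whence the factor in the
    exponent. *)
Lemma pr_wiener_pair_sqnorm (M : nat) : (2 * d <= M)%N -> (0 < M)%N ->
  exists2 C : R, 0 <= C & forall t r, 0 < t -> 0 < r ->
    exists2 B : set T, measurable B /\
       pr P B <= C * expR (- ((M%:R - (2 * d)%:R) ^+ 2 / M%:R ^+ 2 * (r ^+ 2 / (2 * t))))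
     & forall w, r ^+ 2 <= sqnorm t w -> B w.
Proof.
move=> dM M0; have MR : 0 < M%:R :> R by rewrite ltr0n.
pose J : finType := ('I_d + 'I_d)%type.
have cJ : #|J| = (2 * d)%N by rewrite card_sum card_ord mul2n addnn.
pose G : finType := {ffun J -> 'I_M.+1}.
exists (#|G|%:R * (2 ^+ d * 2 ^+ d)); first by rewrite mulr_ge0// mulr_ge0// exprn_ge0.
move=> t r t0 r0.
set E := expR _; have E0 : 0 <= E := expR_ge0 _.
pose b (a : G) j : R := (a j)%:R * (r / M%:R).
have b0 a j : 0 <= b a j by rewrite mulr_ge0// divr_ge0// ltW.
pose A1 a := \bigcap_(k in [set` enum 'I_d]) [set w | b a (inl k) <= `|W1 k t w - W1 k 0 w|].
pose A2 a := \bigcap_(k in [set` enum 'I_d]) [set w | b a (inr k) <= `|W2 k t w - W2 k 0 w|].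
have sA (W : 'I_d -> R -> {RV P >-> R}) (c : 'I_d -> R) :
   sigma_of [set kt : 'I_d * R | 0 <= kt.2] measurable (fun kt => W kt.1 kt.2 : T -> R)
     (\bigcap_(k in [set` enum 'I_d]) [set w | c k <= `|W k t w - W k 0 w|]).
  apply: sigma_of_bigcap => k _.
  apply: (@sigma_of_increment R disp T _ _ (fun kt => W kt.1 kt.2 : T -> R) (k, 0) (k, t)
    [set y | c k <= `|y|]) => //=; [exact: ltW|exact: measurable_ge_norm].
have mA (W : 'I_d -> R -> {RV P >-> R}) (c : 'I_d -> R) : wiener_process W ->
   measurable (\bigcap_(k in [set` enum 'I_d]) [set w | c k <= `|W k t w - W k 0 w|]).
  move=> [hW _]; rewrite bigcap_seq; apply: bigsetI_measurable => k _.
  exact: (measurable_increment (W k) 0 t (measurable_ge_norm _)).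
pose good (a : G) := (M%:R - (2 * d)%:R) ^+ 2 <= \sum_j (a j)%:R ^+ 2 :> R.
pose B := \big[setU/set0]_(a <- enum G | good a) (A1 a `&` A2 a).
have mAA a : measurable (A1 a `&` A2 a) by apply: measurableI; exact: mA.
exists B.
  split; first exact: bigsetU_measurable.
  apply: (le_trans (pr_bigU_le P _ _ mAA)).
  apply: (@le_trans _ _ (\sum_(a <- enum G | good a) 2 ^+ d * 2 ^+ d * E)).
    apply: ler_sum => a ga; rewrite ind//; try exact: sA; try exact: mA.
    have p1 := pr_wiener_box hW1 t0 (fun k => b0 a (inl k)).
    have p2 := pr_wiener_box hW2 t0 (fun k => b0 a (inr k)).
    apply: (le_trans (ler_pM _ _ p1 p2)); rewrite ?pr_ge0//.
    rewrite mulrACA -expRD ler_wpM2l ?mulr_ge0 ?exprn_ge0//.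
    rewrite /E ler_expR -opprD lerN2 -mulrDl mulrA ler_pM2r ?invr_gt0 ?mulr_gt0//.
    have -> : \sum_k b a (inl k) ^+ 2 + \sum_k b a (inr k) ^+ 2 =
        (\sum_j (a j)%:R ^+ 2) * (r ^+ 2 / M%:R ^+ 2).
      rewrite big_sumType /= mulrDl !mulr_suml.
      by congr (_ + _); apply: eq_bigr => k _; rewrite /b exprMn expr_div_n.
    rewrite mulrAC -(mulrA _ (r ^+ 2)); apply: ler_wpM2r => //.
    by rewrite divr_ge0 ?sqr_ge0.
  rewrite -mulrA mulrA [leRHS](_ : _ = \sum_(a <- enum G) 2 ^+ d * 2 ^+ d * E).
    rewrite [leRHS](bigID good) /= lerDl; apply: sumr_ge0 => a _.
    by rewrite !mulr_ge0// exprn_ge0.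
  by rewrite big_enum /= sumr_const -[RHS]mulr_natl !mulrA.
move=> w hw.
pose y (j : J) := match j with inl k => W1 k t w - W1 k 0 w | inr k => W2 k t w - W2 k 0 w end.
have hy : r ^+ 2 <= \sum_j y j ^+ 2 by rewrite big_sumType.
have JM : (#|J| <= M)%N by rewrite cJ.
have [a [ga ha]] := grid_cover r0 JM M0 hy.
rewrite cJ in ga; rewrite /B -bigcup_seq_cond; exists a.
  by rewrite /= mem_enum.
by split => k _ /=; [exact: (ha (inl k))|exact: (ha (inr k))].
Qed.

Lemma wiener_pair_grid_upper (theta c : R) : 1 < theta -> 2 < c ->
  {ae P, forall w, exists k0, forall k, (k0 <= k)%N ->
    sqnorm (theta ^+ k) w <= (c * lilscale (theta ^+ k)) ^+ 2 / 2}.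
Proof.
move=> th1 c2; have th0 : 0 < theta := lt_trans ltr01 th1.
have c0 : 0 < c by apply: lt_trans c2.
have c20 : 0 < c - 2 by rewrite subr_gt0.
(* Chosen so that (M - 2d) c > 2 M, that is rho > 1. *)
pose M := (Num.truncn ((2 * d)%:R * c / (c - 2)) + 2 * d).+1.
have hM : (2 * d)%:R * c < M%:R * (c - 2).
  rewrite -ltr_pdivrMr//; apply: (lt_le_trans (Num.Theory.truncnS_gt _)).
  by rewrite ler_nat ltnS leq_addr.
have dM : (2 * d <= M)%N by rewrite leqW// leq_addl.
have MR : 0 < M%:R :> R by rewrite ltr0n.
have [C C0 hC] := pr_wiener_pair_sqnorm dM (ltn0Sn _).
pose rho := (M%:R - (2 * d)%:R) ^+ 2 / M%:R ^+ 2 * (c ^+ 2 / 4).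
have rho1 : 1 < rho.
  have -> : rho = ((M%:R - (2 * d)%:R) * c / (2 * M%:R)) ^+ 2.
    by rewrite /rho; field; rewrite gt_eqF.
  rewrite exprn_egt1// ltr_pdivlMr ?mulr_gt0// mul1r; lra.
(* The division by sqrt 2 reflects that |W1 - W2|^2 is at most twice the squared norm of the
   pair. *)
pose r k := c * lilscale (theta ^+ k) / Num.sqrt 2.
have [k1 hk1] := exp_unbounded (expR (expR 1)) th1.
have p0 k : 0 < theta ^+ k by rewrite exprn_gt0.
have e1e : expR 1 <= expR (expR 1) :> R by rewrite ler_expR; have := @expR_ge1Dx R 1; lra.
have s20 : 0 < Num.sqrt 2 :> R by rewrite sqrtr_gt0.
have r2 k : r k ^+ 2 = (c * lilscale (theta ^+ k)) ^+ 2 / 2.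
  by rewrite /r expr_div_n sqr_sqrtr.
pose good k (B : set T) := [/\ measurable B, (k1 <= k)%N ->
    pr P B <= C * expR (- (rho * ln (ln (theta ^+ k)))) &
  (k1 <= k)%N -> forall w, r k ^+ 2 <= sqnorm (theta ^+ k) w -> B w].
have /choice[B hB] : forall k, exists B, good k B.
  move=> k; have [kk|kk] := leqP k1 k; last first.
    by exists set0; split; rewrite // leqNgt kk.
  have e1 := le_trans e1e (hk1 k kk).
  have r0 : 0 < r k by rewrite divr_gt0// mulr_gt0// lilscale_gt0// hk1.
  have [B [mB pB] wB] := hC _ _ (p0 k) r0.
  exists B; split => // _; rewrite (_ : rho * _ =
    (M%:R - (2 * d)%:R) ^+ 2 / M%:R ^+ 2 * (r k ^+ 2 / (2 * theta ^+ k)))//.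
  rewrite r2 exprMn sqr_lilscale// /rho; field.
  by rewrite !gt_eqF.
have mB k : measurable (B k) by case: (hB k).
have [N hN] := sum_expRN_lnln_bounded th1 rho1 C0
   (fun k => pr_le1 P (mB k)) (k0 := k1)
   (fun k => let: And3 _ h _ := hB k in h).
apply: filterS (ae_eventually_notin mB hN) => w [k0 hk0].
exists (maxn k0 k1) => k; rewrite geq_max => /andP[kk0 kk].
rewrite -r2 ltW// ltNge; apply/negP => h; apply: (hk0 k kk0).
by case: (hB k) => _ _ /(_ kk w h).
Qed.

Let Z t w : 'rV[R]_d := \row_k W1 k t w - \row_k W2 k t w.

Lemma wiener_pair_upper c : 2 < c ->
  {ae P, forall w, exists t0, forall t, t0 <= t -> enorm (Z t w) <= c * lilscale t}.
Proof.
move=> c2; pose c' := (c + 2) / 2.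
have c2' : 2 < c' by rewrite /c'; lra.
have c0 : 0 < c' by apply: lt_trans c2'.
have dd : 0 < 2 * d%:R + 1 :> R by rewrite ltr_wpDl ?mulr_ge0.
(* Two processes fluctuate in each of d coordinates, an error of at most 2 d eps L <= (c - c') L;
   the added 1 keeps the denominator positive. *)
pose eps := (c - c') / (2 * d%:R + 1).
have cc' : 0 < c - c' by rewrite /c'; lra.
have e0 : 0 < eps by rewrite divr_gt0.
(* 33 > 32 gives the strict inequality required by [wiener_fluctuation]. *)
pose theta := 1 + eps ^+ 2 / 33.
have e20 : 0 < eps ^+ 2 by rewrite exprn_gt0.
have th1 : 1 < theta by rewrite ltrDl divr_gt0.
have hth : 32 * (theta - 1) < eps ^+ 2 by rewrite /theta; lra.
pose W (b : bool) := if b then W1 else W2.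
have hW b : wiener_process (W b) by case: b.
have H1 : {ae P, forall w, forall (b : bool) (k : 'I_d), exists k0, forall j, (k0 <= j)%N ->
    forall t, theta ^+ j <= t <= theta ^+ j.+1 ->
    `|W b k t w - W b k (theta ^+ j) w| <= eps * lilscale (theta ^+ j)}.
  by apply: filter_forall => b; apply: filter_forall => k; case: (hW b) => h _;
    exact: wiener_fluctuation.
have H2 : {ae P, forall w, forall (b : bool) (k : 'I_d), W b k 0 w = 0}.
  by apply: filter_forall => b; apply: filter_forall => k; case: (hW b) => h _;
    exact: (wiener_start (h k)).
apply: (@filterS3 _ _ _ _ _ _ _ _ H1 H2 (wiener_pair_grid_upper th1 c2')) => w.
move=> f z [n3 hg].
have z1 := z true; have z2 := z false.
have /choice[n1 f1] := f true; have /choice[n2 f2] := f false.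
have [n4 hn4] := exp_unbounded (expR 1) th1.
pose n := maxn (maxn (\max_k n1 k) (\max_k n2 k)) (maxn n3 n4).
exists (theta ^+ n) => t nt.
have [j jn jt] := exp_block th1 nt.
have jn1 k : (n1 k <= j)%N.
  by apply: leq_trans jn; rewrite /n !leq_max (leq_bigmax k).
have jn2 k : (n2 k <= j)%N.
  by apply: leq_trans jn; rewrite /n !leq_max (leq_bigmax (F := n2) k) orbT.
have jn3 : (n3 <= j)%N by apply: leq_trans jn; rewrite /n !leq_max leqnn !orbT.
have jn4 : (n4 <= j)%N by apply: leq_trans jn; rewrite /n !leq_max leqnn !orbT.
have jt' : theta ^+ j <= t <= theta ^+ j.+1 by case/andP: jt => -> /ltW ->.
pose Lj := lilscale (theta ^+ j).
have L0 : 0 <= Lj := lilscale_ge0 _.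
have LL : Lj <= lilscale t.
  by apply: le_lilscale; [exact: hn4|case/andP: jt].
have hZ : enorm (Z (theta ^+ j) w) <= c' * Lj.
  rewrite -(ler_pXn2r (_ : 0 < 2)%N) ?nnegrE ?enorm_ge0 ?(mulr_ge0 (ltW c0) L0)//.
  rewrite sqr_enorm; have := hg j jn3; rewrite ler_pdivlMr// => h; apply: le_trans h.
  rewrite /sqnorm -big_split /= mulr_suml; apply: ler_sum => k _.
  rewrite !mxE z1 z2 !subr0 -subr_ge0.
  rewrite (_ : _ - _ = (W1 k (theta ^+ j) w + W2 k (theta ^+ j) w) ^+ 2); last by ring.
  exact: sqr_ge0.
have -> : Z t w = Z (theta ^+ j) w + (Z t w - Z (theta ^+ j) w) by rewrite addrC subrK.
apply: (le_trans (enorm_add_le _ _)).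
have hS : \sum_k `|(Z t w - Z (theta ^+ j) w) 0 k| <= d%:R * (2 * (eps * Lj)).
  apply: (@le_trans _ _ (\sum_(k < d) 2 * (eps * Lj))); last first.
    by rewrite sumr_const card_ord [leRHS]mulr_natl.
  apply: ler_sum => k _; rewrite !mxE.
  have g1 := f1 k j (jn1 k) t jt'; have g2 := f2 k j (jn2 k) t jt'.
  rewrite (_ : _ - _ = (W1 k t w - W1 k (theta ^+ j) w) - (W2 k t w - W2 k (theta ^+ j) w)); last by ring.
  by apply: (le_trans (ler_normB _ _)); rewrite mulr2n mulrDl mul1r lerD.
apply: (le_trans (lerD hZ hS)).
apply: (@le_trans _ _ (c * Lj)); last by rewrite ler_wpM2l// (le_trans _ (ltW c2)).
have h1 : d%:R * (2 * (eps * Lj)) <= (c - c') * Lj.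
  have -> : d%:R * (2 * (eps * Lj)) = (2 * d%:R * eps) * Lj by ring.
  rewrite ler_wpM2r// /eps mulrA ler_pdivrMr// mulrC ler_wpM2l ?(ltW cc')//.
  by rewrite lerDl.
by move: h1; lra.
Qed.

End WienerPairUpper.

(** * Product rule for complements *)

Section Complements.
Context (R : realType) (disp : measure_display) (T : measurableType disp)
  (P : probability T R).

(** Independence is available for the events themselves, whereas [ae_frequently_in] speaks of
    complements. The list [s1] makes the induction work: writing one complement as a difference
    moves its event into [s1]. *)
Lemma pr_bigcap_complement (A : nat -> set T) (s1 s2 : seq nat) :
  (forall k, measurable (A k)) ->
  (forall s, uniq s -> pr P (\big[setI/setT]_(k <- s) A k) = \prod_(k <- s) pr P (A k)) ->
  uniq (s1 ++ s2) ->
  pr P (\big[setI/setT]_(k <- s1) A k `&` \big[setI/setT]_(k <- s2) ~` A k)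
    = \prod_(k <- s1) pr P (A k) * \prod_(k <- s2) (1 - pr P (A k)).
Proof.
move=> mA hA; elim: s2 s1 => [|k s2 IH] s1 u.
  by rewrite !big_nil setIT mulr1 hA// -[s1]cats0.
have u1 : uniq (s1 ++ s2).
  by move: u; rewrite !cat_uniq /= negb_or => /and3P[-> /andP[_ ->]] /andP[_ ->].
have u2 : uniq ((k :: s1) ++ s2) by move: u; rewrite -cat1s uniq_catCA.
rewrite !big_cons [~` A k `&` _]setIC setIA prD//; last first.
  apply: measurableI; apply: bigsetI_measurable => i _ //; exact: measurableC.
rewrite IH// (_ : _ `&` A k = \big[setI/setT]_(i <- k :: s1) A i `&`
    \big[setI/setT]_(i <- s2) ~` A i); last by rewrite big_cons setIAC [A k `&` _]setIC.
by rewrite IH// big_cons; ring.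
Qed.

End Complements.

(** * Lower bound for the distance of two Wiener processes *)

Section WienerPairLower.
Context (R : realType) (d : nat) (d0 : (0 < d)%N) (disp : measure_display)
  (T : measurableType disp)
  (P : probability T R) (W1 W2 : 'I_d -> R -> {RV P >-> R}).
Hypotheses (hW1 : wiener_process W1) (hW2 : wiener_process W2).
Hypothesis ind : forall A B,
  sigma_of [set kt : 'I_d * R | 0 <= kt.2] measurable (fun kt => W1 kt.1 kt.2 : T -> R) A ->
  sigma_of [set kt : 'I_d * R | 0 <= kt.2] measurable (fun kt => W2 kt.1 kt.2 : T -> R) B ->
  measurable A -> measurable B -> pr P (A `&` B) = pr P A * pr P B.

Let Z t w : 'rV[R]_d := \row_k W1 k t w - \row_k W2 k t w.

Let k0 : 'I_d := Ordinal d0.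

Lemma pr_increments_independent (W : 'I_d -> R -> {RV P >-> R}) (t : nat -> R)
    (B : nat -> set R) (s : seq nat) : wiener_process W ->
  0 <= t 0%N -> nondecreasing_seq t -> (forall m, measurable (B m)) -> uniq s ->
  pr P (\bigcap_(m in [set` s]) [set w | B m (W k0 (t m.+1) w - W k0 (t m) w)]) =
  \prod_(m <- s) pr P [set w | B m (W k0 (t m.+1) w - W k0 (t m) w)].
Proof.
move=> [hW _] t0 tm mB us.
apply: (independent_seq (wiener_indep (hW k0) t0 tm)) => // m _.
  by exists (B m) => //; rewrite setTI.
exact: (measurable_increment (W k0) _ _ (mB m)).
Qed.

Lemma wiener_pair_lower c : 0 < c -> c < 2 ->
  {ae P, forall w, forall t0, exists2 t, t0 <= t & c * lilscale t <= enorm (Z t w)}.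
Proof.
move=> c0 c2; pose c1 := (c + 2) / 2.
have c1c : c < c1 by rewrite /c1; lra.
have c12 : c1 < 2 by rewrite /c1; lra.
have c10 : 0 < c1 := lt_trans c0 c1c.
have dc : 0 < c1 - c by rewrite subr_gt0.
pose u := c1 ^+ 2 / 4.
have u0 : 0 < u by rewrite divr_gt0// exprn_gt0.
have u1 : u < 1.
  have -> : u = (c1 / 2) ^+ 2 by rewrite /u; field.
  by rewrite expr_lt1 ?divr_ge0 ?(ltW c10)//; lra.
(* [u] is the exponent of two tails at level c1 L / 2 together. Both losses fit: u (1 + delta) <= u
   + delta < 1 - delta <= 1 - 1/q, hence gamma < 1. *)
pose delta := (1 - u) / 4.
have de0 : 0 < delta by rewrite divr_gt0// subr_gt0.
have de1 : delta <= 4^-1 by rewrite /delta; lra.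
(* The first bound limits the variance lost before time q^k. By the second, the distance at time
   q^k, at most 3 times its scale since 3 > 2, costs no more than c1 - c. *)
pose q := 1 + Num.max (delta^-1) ((3 / (c1 - c)) ^+ 2).
have q1 : 1 < q by rewrite ltrDl lt_max invr_gt0 de0.
have q0 : 0 < q := lt_trans ltr01 q1.
have qd : q^-1 <= delta.
  rewrite -[leRHS]invrK lef_pV2 ?posrE ?invr_gt0//.
  by rewrite /q; apply: (@le_trans _ _ (Num.max (delta^-1) ((3 / (c1 - c)) ^+ 2)));
    rewrite ?le_max ?lexx// lerDr.
have hq : 3 / Num.sqrt q <= c1 - c.
  rewrite ler_pdivrMr ?sqrtr_gt0// mulrC -ler_pdivrMr//.
  rewrite -[leLHS]ger0_norm ?divr_ge0 ?(ltW dc)// -sqrtr_sqr ler_wsqrtr//.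
  by rewrite /q; apply: (@le_trans _ _ (Num.max (delta^-1) ((3 / (c1 - c)) ^+ 2)));
    rewrite ?le_max ?lexx ?orbT// lerDr.
have a0 : 0 < 1 - q^-1 by lra.
pose gamma := u * (1 + delta) / (1 - q^-1).
have g0 : 0 < gamma by rewrite divr_gt0// mulr_gt0// addr_gt0.
have g1 : gamma < 1.
  rewrite ltr_pdivrMr// mul1r; apply: (@lt_le_trans _ _ (1 - delta)); last lra.
  have : u * delta <= delta by rewrite ler_piMl// ltW.
  by rewrite mulrDr mulr1 /delta; lra.
pose t k : R := q ^+ k.
have t0 k : 0 < t k by rewrite exprn_gt0.
have tm : nondecreasing_seq t.
  by move=> m n mn; rewrite /t ler_weXn2l// ltW.
have tlt k : t k < t k.+1 by rewrite /t exprS ltr_pMl.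
pose x k := c1 * lilscale (t k.+1) / 2.
have x0 k : 0 <= x k by rewrite divr_ge0// mulr_ge0 ?lilscale_ge0// ltW.
pose E k := [set w | x k <= W1 k0 (t k.+1) w - W1 k0 (t k) w].
pose F k := [set w | W2 k0 (t k.+1) w - W2 k0 (t k) w <= - x k].
have mE k : measurable (E k) := measurable_increment (W1 k0) _ _ (measurable_ge (x k)).
have mF k : measurable (F k) := measurable_increment (W2 k0) _ _ (measurable_le (- x k)).
pose A k := E k `&` F k.
have mA k : measurable (A k) by exact: measurableI.
have hA s : uniq s -> pr P (\big[setI/setT]_(k <- s) A k) = \prod_(k <- s) (pr P (E k) * pr P (F k)).
  move=> us; rewrite big_split /= big_split /= -!bigcap_seq.
  rewrite -(pr_increments_independent hW1 (ltW (t0 0%N)) tm (fun k => measurable_ge (x k)) us).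
  rewrite -(pr_increments_independent hW2 (ltW (t0 0%N)) tm (fun k => measurable_le (- x k)) us).
  apply: ind.
  - apply: sigma_of_bigcap => k _.
    apply: (@sigma_of_increment R disp T _ _ (fun kt => W1 kt.1 kt.2 : T -> R) (k0, t k) (k0, t k.+1)
      [set y | x k <= y]) => /=; [exact: ltW|exact: ltW|exact: measurable_ge].
  - apply: sigma_of_bigcap => k _.
    apply: (@sigma_of_increment R disp T _ _ (fun kt => W2 kt.1 kt.2 : T -> R) (k0, t k) (k0, t k.+1)
      [set y | y <= - x k]) => /=; [exact: ltW|exact: ltW|exact: measurable_le].
  - by rewrite bigcap_seq; apply: bigsetI_measurable => k _; exact: mE.
  - by rewrite bigcap_seq; apply: bigsetI_measurable => k _; exact: mF.
have pA k : pr P (A k) = pr P (E k) * pr P (F k).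
  by have := hA [:: k] isT; rewrite !big_seq1.
have hA' s : uniq s -> pr P (\big[setI/setT]_(k <- s) A k) = \prod_(k <- s) pr P (A k).
  by move=> us; rewrite hA//; apply: eq_bigr => k _; rewrite pA.
have [b0 b00 hb] := normal_prob_tail_lb de0.
have tE k : t k.+1 - t k = t k.+1 * (1 - q^-1).
  by rewrite /t exprS; field; rewrite gt_eqF.
have [n1 hn1] := exp_unbounded (expR 1) q1.
have [n2 hn2] := lnln_exp_unbounded (b0 ^+ 2 * 4 / c1 ^+ 2) q1.
have [n3 hn3] := expRN_lnln_ge_inv q1 (ltW g0) g1.
have hk k : (maxn n1 (maxn n2 n3) <= k)%N -> k.+1%:R^-1 <= pr P (A k).
  rewrite !geq_max => /and3P[kn1 kn2 kn3].
  have e1 : expR 1 <= t k.+1 by apply: hn1; exact: leqW.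
  have lb : b0 ^+ 2 * 4 / c1 ^+ 2 <= ln (ln (t k.+1)) by apply: hn2; exact: leqW.
  have L0 := lnln_ge0 e1.
  have ta0 : 0 < t k.+1 - t k by rewrite subr_gt0.
  have bx : b0 * Num.sqrt (t k.+1 - t k) <= x k.
    rewrite -(ler_pXn2r (_ : 0 < 2)%N) ?nnegrE ?x0 ?(mulr_ge0 (ltW b00) (sqrtr_ge0 _))//.
    rewrite exprMn sqr_sqrtr ?(ltW ta0)// /x expr_div_n exprMn sqr_lilscale// tE.
    apply: (@le_trans _ _ (b0 ^+ 2 * t k.+1)).
      by rewrite ler_wpM2l ?sqr_ge0// ler_piMr ?(ltW (t0 _))// gerBl invr_ge0 ltW.
    move: lb; rewrite ler_pdivrMr ?exprn_gt0// => lb.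
    rewrite ler_pdivlMr// mulrAC mulrC [leRHS]mulrCA ler_pM2l//.
    by rewrite -[2 ^+ 2]natrX /= mulrC [leRHS]mulrC in lb *; lra.
  have [h1 h2] := hb _ _ ta0 bx.
  rewrite -(pr_increment (hW1.1 k0) (ltW (t0 k)) (tlt k) (measurable_ge _)) lee_fin in h1.
  rewrite -(pr_increment (hW2.1 k0) (ltW (t0 k)) (tlt k) (measurable_le _)) lee_fin in h2.
  apply: (le_trans (hn3 k kn3)); rewrite pA.
  apply: le_trans (ler_pM (expR_ge0 _) (expR_ge0 _) h1 h2).
  rewrite -expRD ler_expR -opprD lerN2 le_eqVlt; apply/orP; left; apply/eqP.
  rewrite /x expr_div_n exprMn sqr_lilscale// tE /gamma /u -/(t k.+1).
  move: (ln (ln (t k.+1))) (1 - q^-1) a0 (t k.+1) (t0 k.+1) => L a a0' Q Q0.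
  by field; rewrite !gt_eqF.
have HA : {ae P, forall w, forall m, exists2 k, (m <= k)%N & A k w}.
  apply: (@ae_frequently_in _ _ _ P A (maxn n1 (maxn n2 n3))) => // m n hm.
  have := @pr_bigcap_complement R disp T P A [::] (index_iota m (m + n)) mA hA' (iota_uniq _ _).
  rewrite !big_nil setTI mul1r => ->.
  rewrite big_seq [leRHS]big_seq; apply: ler_prod => k.
  rewrite mem_index_iota => /andP[mk _]; rewrite subr_ge0 pr_le1//= lerD2l lerN2.
  by apply: hk; exact: leq_trans mk.
have c3 : 2 < 3 :> R by rewrite ltr_nat.
apply: filterS2 HA (wiener_pair_upper hW1 hW2 ind c3) => w hw [s0 hs0] t1.
have [n4 hn4] := exp_unbounded (Num.max (expR 1) (Num.max s0 t1)) q1.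
have [k kn [Ek Fk]] := hw n4.
have := hn4 k kn; rewrite !ge_max -/(t k) => /and3P[e1 sk tk].
exists (t k.+1); first exact: le_trans tk (ltW (tlt k)).
have h1 : enorm (Z (t k) w) <= 3 * lilscale (t k) := hs0 _ sk.
have h2 : 3 * lilscale (t k) <= (c1 - c) * lilscale (t k.+1).
  apply: (@le_trans _ _ (3 * (lilscale (t k.+1) / Num.sqrt q))).
    by rewrite ler_pM2l// /t exprS le_lilscale_mul// ltW.
  by rewrite mulrCA mulrC ler_wpM2r ?lilscale_ge0.
have h3 := le_coord_enorm (Z (t k) w) k0.
have h4 := le_coord_enorm (Z (t k.+1) w) k0.
have h5 := ler_norm (Z (t k.+1) w 0 k0).
have h6 := ler_norm (- Z (t k) w 0 k0).
rewrite normrN in h6; move: h3 h4 h5 h6; rewrite !mxE => h3 h4 h5 h6.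
move: Ek Fk; rewrite /E /F /x /= => Ek Fk.
by move: h1 h2 h3 h4 h5 h6 Ek Fk; lra.
Qed.

End WienerPairLower.

(** * The law for Wiener processes, and the theorem *)

Lemma wiener_max_dist_lil (R : realType) (disp : measure_display)
    (T : measurableType disp) (P : probability T R) (K d : nat)
    (hK : (2 <= K)%N) (hd : (1 <= d)%N) (W : 'I_K -> 'I_d -> R -> {RV P >-> R}) :
  independent_wiener_processes W ->
  {ae P, forall w,
     limf_esup (fun t : R =>
       (wiener_max_dist W t w / Num.sqrt (t * ln (ln t)))%:E) +oo%R = 2%:E}.
Proof.
move=> [hW iW].
have ind i j : i != j -> forall A B,
  sigma_of [set kt : 'I_d * R | 0 <= kt.2] measurable (fun kt => W i kt.1 kt.2 : T -> R) A ->
  sigma_of [set kt : 'I_d * R | 0 <= kt.2] measurable (fun kt => W j kt.1 kt.2 : T -> R) B ->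
  measurable A -> measurable B -> pr P (A `&` B) = pr P A * pr P B.
  by move=> ij A B sA sB mA mB; exact: (independent_pair iW ij sA sB).
have nbhs_ge (t0 : R) (Q : R -> Prop) : (forall t, t0 <= t -> Q t) -> \forall t \near +oo%R, Q t.
  by move=> h; exists t0; split; [rewrite num_real|move=> t /ltW; exact: h].
apply: (@ae_limf_esup_ratio _ _ _ _ _ _ _ _ (fun w t => wiener_max_dist W t w) (@lilscale R)) => //.
- by apply: (nbhs_ge (expR (expR 1))) => t; exact: lilscale_gt0.
- move=> e he; have e0 : 0 < e by apply: lt_trans he.
  have H : {ae P, forall w, forall p : 'I_K * 'I_K, exists t0 : R, p.1 != p.2 ->
     forall t, t0 <= t -> enorm (\row_k W p.1 k t w - \row_k W p.2 k t w) <= e * lilscale t}.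
    apply: filter_forall => -[i j] /=.
    have [->|ij] := eqVneq i j; first by apply: nearW => w; exists 0.
    have := wiener_pair_upper (hW i) (hW j) (ind i j ij) he.
    by apply: filterS => w [t0 ht0]; exists t0.
  apply: filterS H => w hw.
  have : \forall t \near +oo%R, forall p : 'I_K * 'I_K, p.1 != p.2 ->
     enorm (\row_k W p.1 k t w - \row_k W p.2 k t w) <= e * lilscale t.
    by apply: filter_forall => p; have [t0 ht0] := hw p; apply: (nbhs_ge t0) => t tt pp; exact: ht0.
  apply: filterS => t ht; apply: max_dist_le => [|i j ij].
    by rewrite mulr_ge0 ?lilscale_ge0// ltW.
  exact: (ht (i, j)).
- move=> e e0 he; pose i : 'I_K := Ordinal (ltnW hK); pose j : 'I_K := Ordinal hK.
  have ij : i != j by [].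
  have := wiener_pair_lower hd (hW i) (hW j) (ind i j ij) e0 he.
  (* Neighbourhoods of +oo are given by the strict condition t0 < t, hence a witness beyond t0 +
     1. *)
  apply: filterS => w hw [t0 [_ hn]]; have [t tt ht'] := hw (t0 + 1).
  have h : t0 < t by apply: lt_le_trans tt; rewrite ltrDl.
  have := hn t h; apply/negP; rewrite -leNgt (le_trans ht')//.
  exact: (le_max_dist (fun i => \row_k W i k t w)).
Qed.

Theorem theorem3p1 (R : realType) (disp : measure_display)
    (T : measurableType disp) (P : probability T R) (K d : nat)
    (hK : (2 <= K)%N) (hd : (1 <= d)%N) :
  (forall W : 'I_K -> 'I_d -> R -> {RV P >-> R},
     independent_wiener_processes W ->
     {ae P, forall w,
       limf_esup (fun t : R =>
         (wiener_max_dist W t w / Num.sqrt (t * ln (ln t)))%:E) +oo%R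
       = 2%:E})
  /\
  (forall S : 'I_K -> nat -> T -> 'rV[int]_d,
     independent_random_walks P S ->
     {ae P, forall w,
       limn_esup (fun n : nat =>
         (walk_max_dist R S n w / Num.sqrt (n%:R * ln (ln n%:R)))%:E)
       = (2 / Num.sqrt d%:R)%:E}).
Proof.
split=> [W hW|S hS]; first exact: wiener_max_dist_lil.
exact: walk_max_dist_lil.
Qed.
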